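(* Let $\mu$ be a real positive measure on $(0,1)$. Let $(a_n)_{n\ge 0}$ and $(b_n)_{n\ge 0}$ be sequences of nonnegative real numbers such that $$f(z)=\sum_{n=0}^{\infty}(-1)^n a_n z^{2n},\qquad g(z)=\sum_{n=0}^{\infty}(-1)^n b_n z^{2n}$$ are entire functions. Assume that the zeros of $f$ and of $g$ are real and simple, and that each of $f$ and $g$ has a countably infinite number of zeros. Let $\lambda_n$ denote the $n$th positive zero of $g$ ($n=1,2,\dots$). If the orders of $f$ and $g$ are both less than one and $$\frac{a_n}{b_n}\to 0\quad\text{as } n\to\infty,$$ then the sequence of functions $\{f(\lambda_n x)\}_{n\ge 1}$ is complete $L[\mu,(0,1)]$.
   Context: The order of an entire function $f$ is $\varrho(f)=\limsup_{r\to\infty}\frac{\log\log M(r;f)}{\log r}$, where $M(r;f)=\max_{|z|=r}|f(z)|$. A sequence of functions $\{f_n\}_{n\ge1}$ on $(0,1)$ is said to be complete $L[\mu,(0,1)]$ (that is, complete in $L^1[\mu,(0,1)]$) if, whenever $y\in L^1[\mu,(0,1)]$ satisfies $\int_{(0,1)} y f_n\,d\mu=0$ for all $n=1,2,\dots$, one has $y=0$ $\mu$-almost everywhere. *)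

(* Defs.v *)
From HB Require Import structures.
From mathcomp Require Import all_boot all_order all_algebra.
From mathcomp Require Import all_classical all_reals all_analysis.
From mathcomp Require Import complex.

Set Implicit Arguments.
Unset Strict Implicit.
Unset Printing Implicit Defensive.

Import Order.TTheory GRing.Theory Num.Theory.
Import numFieldNormedType.Exports.

Local Open Scope classical_set_scope.
Local Open Scope ring_scope.
Local Open Scope complex_scope.

(* The usual topology of the complex plane, given by the modulus. *)
HB.instance Definition _ (R : realType) := NormedModule.copy R[i] (R[i]^o).

Definition modulus (R : realType) (z : R[i]) : R := ComplexField.Normc.normc z.

(* Complex differentiability: both the increment and the quotient in
   [derivable] are taken over the field R[i]. *)
Definition entire (R : realType) (f : R[i] -> R[i]) : Prop :=
  forall z : R[i], derivable f z 1.

(* The supremum is a maximum as soon as f is continuous and r >= 0. *)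
Definition max_modulus (R : realType) (f : R[i] -> R[i]) (r : R) : R :=
  sup [set modulus (f z) | z in [set z : R[i] | modulus z = r]].

(* Since [ln] vanishes on nonpositive reals, functions bounded by 1 get
   order 0. *)
Definition growth_order (R : realType) (f : R[i] -> R[i]) : \bar R :=
  limf_esup (fun r : R => (ln (ln (max_modulus f r)) / ln r)%:E) +oo.

Definition zeros (R : realType) (f : R[i] -> R[i]) : set R[i] :=
  [set z | f z = 0].

Definition real_zeros (R : realType) (f : R[i] -> R[i]) : Prop :=
  forall z, zeros f z -> complex.Im z = 0.

Definition simple_zeros (R : realType) (f : R[i] -> R[i]) : Prop :=
  forall z, zeros f z -> derive1 f z != 0.

Definition countably_infinite_zeros (R : realType) (f : R[i] -> R[i]) : Prop :=
  (zeros f #= [set: nat])%card.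

(* The enumeration is increasing and starts at index 0: the n-th positive zero
   (n >= 1) is [lam n.-1]. *)
Definition enum_positive_zeros (R : realType) (g : R[i] -> R[i])
    (lam : nat -> R) : Prop :=
  {homo lam : m n / (m < n)%N >-> m < n} /\
  range lam = [set x : R | 0 < x /\ zeros g x%:C].

Definition alternating_even_series (R : realType) (a : nat -> R)
    (f : R[i] -> R[i]) : Prop :=
  forall z : R[i],
    series (fun n => (-1) ^+ n * (a n)%:C * z ^+ (2 * n)) @ \oo --> f z.

Definition cintegrable d (T : measurableType d) (R : realType)
    (mu : {measure set T -> \bar R}) (D : set T) (y : T -> R[i]) : Prop :=
  mu.-integrable D (fun x => (complex.Re (y x))%:E) /\
  mu.-integrable D (fun x => (complex.Im (y x))%:E).

Definition cintegral d (T : measurableType d) (R : realType)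
    (mu : {measure set T -> \bar R}) (D : set T) (y : T -> R[i]) : R[i] :=
  (\int[mu]_(x in D) complex.Re (y x)) +i*
  (\int[mu]_(x in D) complex.Im (y x)).

(* Used below for F n bounded on D and measurable, so that the products are
   integrable whenever y is. *)
Definition complete_L1 d (T : measurableType d) (R : realType)
    (mu : {measure set T -> \bar R}) (D : set T)
    (F : nat -> T -> R[i]) : Prop :=
  forall y : T -> R[i], cintegrable mu D y ->
    (forall n, cintegral mu D (fun x => y x * F n x) = 0) ->
    {ae mu, forall x, D x -> y x = 0}.

(* Main.v *)
Require Import Defs.
From mathcomp Require Import all_boot all_order all_algebra.
From mathcomp Require Import all_classical all_reals all_analysis.
From mathcomp Require Import measurable_realfun.
From mathcomp Require Import complex.
From mathcomp Require Import ring lra zify.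
Import Order.TTheory GRing.Theory Num.Theory.
Import numFieldNormedType.Exports.

(* In the variable w = z^2 the series of f and g have order less than 1/2 and
   only positive simple zeros.  If y annihilates all f(lambda_n x), then
   h(w) = sum (-1)^n a_n m_n w^n, with m_n the moments of y of order 2n, vanishes
   at the zeros of g, and a_n / b_n -> 0 makes h / g tend to 0 along the negative
   axis, i.e. along the imaginary z-axis.  Since the order in z is less than one,
   Phragmen-Lindelof in the half planes Re z >= 0 and Re z <= 0 yields h = 0.  All
   a_n are positive, since f is, by Hadamard factorization, a limit of
   a_0 prod (1 - w / w_k).  Hence all even moments of y vanish, and y = 0 by
   approximation of indicators of intervals by polynomials in x^2.

   Analyticity enters only through second-order Taylor expansions, which suffice
   for the maximum principle; Cauchy estimates, the analyticity of 1 / U for a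
   zero-free U and the Borel-Caratheodory bound for log U are deduced from it. *)

Set Implicit Arguments.
Unset Strict Implicit.
Unset Printing Implicit Defensive.

Local Open Scope classical_set_scope.
Local Open Scope ring_scope.
Local Open Scope complex_scope.

(** * Power series *)

(** No infinite product occurs. For each radius r only the zeros up to r^2 / 4 are divided out; the
    quotient d has no zeros there, and the growth bound makes log (d / d_0) of size O(eps |w| / r),
    so that d is nearly constant on bounded sets once r is large. This finite Hadamard
    factorization, [zero_free_part], serves twice: it compares c_n with symmetric functions of the
    zeros, and it replaces lower bounds for g, which would be delicate near the zeros. From the
    order being less than one only exponential type 0 in z is retained. Positivity of a_n turns a_n
    m_n = 0 into m_n = 0; positivity of b_n lets a single later term of g absorb any finite part of
    h. *)

Definition psum (R : realType) (c : nat -> R[i]) (w : R[i]) (n : nat) : R[i] :=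
  \sum_(k < n) c k * w ^+ k.

(** Stated with a real epsilon and [modulus], because the norm of [R[i]] takes its values in
    [R[i]]. *)
Definition pseries_cvg (R : realType) (c : nat -> R[i]) (w S : R[i]) : Prop :=
  forall e : R, 0 < e ->
    exists N, forall n, (N <= n)%N -> modulus (S - psum c w n) <= e.

(** Total by the default value 0 at points of divergence. *)
Definition pseries_sum (R : realType) (c : nat -> R[i]) (w : R[i]) : R[i] :=
  xget 0 [set S | pseries_cvg c w S].

(** Boundedness is asked only on strictly smaller circles, so that operations losing a little
    radius, such as divided differences and termwise differentiation, preserve the same [rho]. *)
Definition has_radius (R : realType) (c : nat -> R[i]) (rho : R) : Prop :=
  forall r, 0 < r -> r < rho ->
    exists2 B, 0 <= B & forall n, modulus (c n) * r ^+ n <= B.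

Section modulus_theory.
Context {R : realType}.
Implicit Types x y z w : R[i].

Lemma modulus_ge0 z : 0 <= modulus z.
Proof. by case: z => a b; rewrite /modulus /= sqrtr_ge0. Qed.

Lemma modulus0 : modulus (0 : R[i]) = 0.
Proof. exact: ComplexField.Normc.normc0. Qed.

Lemma modulus1 : modulus (1 : R[i]) = 1.
Proof. exact: ComplexField.Normc.normc1. Qed.

Lemma modulusM z w : modulus (z * w) = modulus z * modulus w.
Proof. exact: ComplexField.Normc.normcM. Qed.

Lemma modulusV z : modulus z^-1 = (modulus z)^-1.
Proof. exact: ComplexField.Normc.normcV. Qed.

Lemma modulusN z : modulus (- z) = modulus z.
Proof. exact: normcN. Qed.

Lemma modulusD z w : modulus (z + w) <= modulus z + modulus w.
Proof. exact: le_normcD. Qed.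

Lemma modulusB z w : modulus (z - w) <= modulus z + modulus w.
Proof. by rewrite -(modulusN w) modulusD. Qed.

Lemma modulusBC z w : modulus (z - w) = modulus (w - z).
Proof. by rewrite -modulusN opprB. Qed.

Lemma modulus_lB z w : modulus z - modulus w <= modulus (z - w).
Proof. by rewrite lerBlDr -{1}(subrK w z) modulusD. Qed.

Lemma modulus_lD z w : modulus z - modulus w <= modulus (z + w).
Proof. by rewrite -{2}(opprK w) -(modulusN w) modulus_lB. Qed.

Lemma modulusX z n : modulus (z ^+ n) = modulus z ^+ n.
Proof. by elim: n => [|n IH]; rewrite ?expr0 ?modulus1 // !exprS modulusM IH. Qed.

Lemma modulus_eq0 z : (modulus z == 0) = (z == 0).
Proof.
apply/eqP/eqP => [/ComplexField.Normc.eq0_normc//|->]; exact: modulus0.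
Qed.

Lemma modulus_gt0 z : (0 < modulus z) = (z != 0).
Proof. by rewrite lt_def modulus_ge0 andbT modulus_eq0. Qed.

Lemma modulus_normc z : `|z| = (modulus z)%:C.
Proof. by rewrite normc_def; case: z. Qed.

Lemma modulus_real (r : R) : modulus r%:C = `|r|.
Proof. by rewrite /modulus /= expr0n /= addr0 sqrtr_sqr. Qed.

Lemma modulus_sum n (F : 'I_n -> R[i]) :
  modulus (\sum_(k < n) F k) <= \sum_(k < n) modulus (F k).
Proof.
elim: n F => [F|n IH F]; first by rewrite !big_ord0 modulus0.
by rewrite !big_ord_recr /= (le_trans (modulusD _ _))// lerD2r IH.
Qed.

Lemma sqr_modulus z :
  modulus z ^+ 2 = complex.Re z ^+ 2 + complex.Im z ^+ 2.
Proof.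
by case: z => a b; rewrite /modulus /= sqr_sqrtr// addr_ge0 ?sqr_ge0.
Qed.

Lemma Re_le_modulus z : `|complex.Re z| <= modulus z.
Proof.
rewrite -(@ler_pXn2r _ 2)// ?nnegrE ?modulus_ge0//.
by rewrite sqr_modulus real_normK ?num_real// lerDl sqr_ge0.
Qed.

Lemma Im_le_modulus z : `|complex.Im z| <= modulus z.
Proof.
rewrite -(@ler_pXn2r _ 2)// ?nnegrE ?modulus_ge0//.
by rewrite sqr_modulus real_normK ?num_real// lerDr sqr_ge0.
Qed.

Lemma modulus_le_ReIm z : modulus z <= `|complex.Re z| + `|complex.Im z|.
Proof.
rewrite -(@ler_pXn2r _ 2)// ?nnegrE ?modulus_ge0// ?addr_ge0//.
rewrite sqr_modulus sqrrD !real_normK ?num_real//.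
by rewrite -addrA lerD2l lerDr mulrn_wge0// mulr_ge0.
Qed.

Lemma ReD z w : complex.Re (z + w) = complex.Re z + complex.Re w.
Proof. by case: z => ? ?; case: w. Qed.

Lemma ImD z w : complex.Im (z + w) = complex.Im z + complex.Im w.
Proof. by case: z => ? ?; case: w. Qed.

Lemma ReN z : complex.Re (- z) = - complex.Re z.
Proof. by case: z. Qed.

Lemma ImN z : complex.Im (- z) = - complex.Im z.
Proof. by case: z. Qed.

Lemma ReMr z (t : R) : complex.Re (z * t%:C) = complex.Re z * t.
Proof. by case: z => a b /=; rewrite mulr0 subr0. Qed.

Lemma ImMr z (t : R) : complex.Im (z * t%:C) = complex.Im z * t.
Proof. by case: z => a b /=; rewrite mulr0 add0r. Qed.

Lemma modulus_le_eps_eq z w :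
  (forall e : R, 0 < e -> modulus (z - w) <= e) -> z = w.
Proof.
move=> H; apply/eqP; rewrite -subr_eq0 -modulus_eq0 eq_le modulus_ge0 andbT.
by apply/ler_addgt0Pl => e e0; rewrite addr0 H.
Qed.

End modulus_theory.

Section power_series.
Context {R : realType}.
Implicit Types (c d : nat -> R[i]) (z w : R[i]) (r rho B : R).

Lemma psumS c w n : psum c w n.+1 = psum c w n + c n * w ^+ n.
Proof. by rewrite /psum big_ord_recr. Qed.

Lemma psum0 c w : psum c w 0 = 0.
Proof. by rewrite /psum big_ord0. Qed.

Lemma psumSl c w n :
  psum c w n.+1 = c 0%N + w * psum (fun k => c k.+1) w n.
Proof.
rewrite /psum big_ord_recl expr0 mulr1 mulr_sumr; congr (_ + _).
by apply: eq_bigr => k _; rewrite lift0 exprS mulrCA.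
Qed.

Lemma psumZ a c w n : psum (fun k => a * c k) w n = a * psum c w n.
Proof. by rewrite /psum mulr_sumr; apply: eq_bigr => k _; rewrite mulrA. Qed.

Lemma psumD c d w n : psum (fun k => c k + d k) w n = psum c w n + psum d w n.
Proof. by rewrite /psum -big_split; apply: eq_bigr => k _; rewrite mulrDl. Qed.

Lemma pseries_cvg_uniq c w S S' :
  pseries_cvg c w S -> pseries_cvg c w S' -> S = S'.
Proof.
move=> h h'; apply: modulus_le_eps_eq => e e0.
have e20 : 0 < e / 2 by lra.
have [N hN] := h _ e20; have [N' hN'] := h' _ e20.
have := hN (maxn N N') (leq_maxl _ _); have := hN' (maxn N N') (leq_maxr _ _).
set p := psum _ _ _ => h1 h2.
have -> : S - S' = (S - p) - (S' - p) by ring.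
by apply: (le_trans (modulusB _ _)); lra.
Qed.

Lemma psum_diff_le c w r B n m : (forall k, modulus (c k) * r ^+ k <= B) ->
  modulus w < r ->
  modulus (psum c w (n + m) - psum c w n) <=
    B * (modulus w / r) ^+ n / (1 - modulus w / r).
Proof.
move=> hB wr; have r0 : 0 < r := le_lt_trans (modulus_ge0 w) wr.
set q := modulus w / r.
have q0 : 0 <= q by rewrite divr_ge0 ?modulus_ge0// ltW.
have q1 : q < 1 by rewrite ltr_pdivrMr// mul1r.
have B0 : 0 <= B.
  apply: le_trans (hB 0%N).
  by rewrite mulr_ge0 ?modulus_ge0 ?exprn_ge0 ?ltW.
have term k : modulus (c k * w ^+ k) <= B * q ^+ k.
  rewrite modulusM modulusX /q expr_div_n mulrA ler_pdivlMr ?exprn_gt0// mulrAC.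
  by rewrite ler_wpM2r ?exprn_ge0 ?modulus_ge0.
(* The exact finite geometric sum is the form that passes through the induction on m. *)
suff : modulus (psum c w (n + m) - psum c w n) <=
    B * (q ^+ n - q ^+ (n + m)) / (1 - q).
  move=> /le_trans; apply; rewrite ler_pM2r ?invr_gt0 ?subr_gt0//.
  by rewrite ler_wpM2l// gerBl exprn_ge0.
elim: m => [|m IH]; first by rewrite addn0 !subrr modulus0 mulr0 mul0r.
rewrite addnS psumS.
rewrite [X in modulus X](_ : _ =
  psum c w (n + m) - psum c w n + c (n + m)%N * w ^+ (n + m)); last by ring.
apply: (le_trans (modulusD _ _)); apply: (le_trans (lerD IH (term _))).
rewrite le_eqVlt; apply/orP; left; apply/eqP.
by rewrite exprS; field; rewrite subr_eq0 eq_sym lt_eqF.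
Qed.

Lemma geometric_small B (q : R) : 0 <= q -> q < 1 ->
  forall e : R, 0 < e -> exists N, forall n, (N <= n)%N -> B * q ^+ n <= e.
Proof.
move=> q0 q1 e e0.
have /cvgrPdist_le /(_ _ e0) [N _ hN] : geometric B q @ \oo --> (0 : R).
  by apply: cvg_geometric; rewrite ger0_norm.
exists N => n Nn; have := hN n Nn; rewrite sub0r normrN.
by apply: le_trans; rewrite ler_norm.
Qed.

Lemma pseries_cvg_ex c w r B : (forall k, modulus (c k) * r ^+ k <= B) ->
  modulus w < r -> exists S, pseries_cvg c w S.
Proof.
move=> hB wr; have r0 : 0 < r := le_lt_trans (modulus_ge0 w) wr.
pose q := modulus w / r.
have q0 : 0 <= q by rewrite divr_ge0 ?modulus_ge0// ltW.
have q1 : q < 1 by rewrite ltr_pdivrMr// mul1r.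
(* Here p is the real or the imaginary part, so that completeness of R suffices. *)
have cauchy (p : R[i] -> R) : (forall z z', p (z - z') = p z - p z') ->
    (forall z, `|p z| <= modulus z) ->
    (fun n => p (psum c w n)) @ \oo -->
      limn (fun n => p (psum c w n)).
  move=> pB ple; apply/cvg_ex; exists (limn (fun n => p (psum c w n))).
  have : cauchy ((fun n => p (psum c w n)) @ \oo).
    apply: cauchy_exP => e e0.
    have e20 : 0 < e / 2 by lra.
    have [N hN] := geometric_small (B / (1 - q)) q0 q1 e20.
    exists (p (psum c w N)); exists N => // n /= Nn.
    rewrite /ball /= distrC -pB (le_lt_trans (ple _))//.
    rewrite -(subnKC Nn) (le_lt_trans (psum_diff_le N _ hB wr))//.
    by rewrite mulrAC (le_lt_trans (hN N (leqnn N)))//; lra.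
  by move=> /cauchy_cvgP/cvgP.
set x := limn (fun n => complex.Re (psum c w n)).
set y := limn (fun n => complex.Im (psum c w n)).
have ReB z z' : complex.Re (z - z') = complex.Re z - complex.Re z'.
  by rewrite ReD ReN.
have ImB z z' : complex.Im (z - z') = complex.Im z - complex.Im z'.
  by rewrite ImD ImN.
exists (x +i* y) => e e0; have e20 : 0 < e / 2 by lra.
have /cvgrPdist_le/(_ _ e20)[N1 _ h1] := cauchy _ ReB (@Re_le_modulus R).
have /cvgrPdist_le/(_ _ e20)[N2 _ h2] := cauchy _ ImB (@Im_le_modulus R).
exists (maxn N1 N2) => n; rewrite geq_max => /andP[n1 n2].
apply: (le_trans (modulus_le_ReIm _)); rewrite ReB ImB /=.
by have := h1 _ n1; have := h2 _ n2; lra.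
Qed.

Lemma pseries_cvgE c w S : pseries_cvg c w S -> pseries_sum c w = S.
Proof.
move=> h; apply: (@pseries_cvg_uniq c w) => //.
by have := @xgetI _ 0 [set S | pseries_cvg c w S] S h.
Qed.

Lemma pseries_sumP c w r B : (forall k, modulus (c k) * r ^+ k <= B) ->
  modulus w < r -> pseries_cvg c w (pseries_sum c w).
Proof. by move=> hB /(pseries_cvg_ex hB)[S hS]; rewrite (pseries_cvgE hS). Qed.

Lemma pseries_tail_le c w r B n : (forall k, modulus (c k) * r ^+ k <= B) ->
  modulus w < r ->
  modulus (pseries_sum c w - psum c w n) <=
    B * (modulus w / r) ^+ n / (1 - modulus w / r).
Proof.
move=> hB wr; apply/ler_addgt0Pl => e e0.
have [N hN] := pseries_sumP hB wr e0.
rewrite [X in modulus X](_ : _ = (pseries_sum c w - psum c w (n + N)) +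
  (psum c w (n + N) - psum c w n)); last by ring.
rewrite (le_trans (modulusD _ _))// lerD ?psum_diff_le// hN//.
exact: leq_addl.
Qed.

Lemma pseries_sum_le c w r B : (forall k, modulus (c k) * r ^+ k <= B) ->
  modulus w < r -> modulus (pseries_sum c w) <= B / (1 - modulus w / r).
Proof.
move=> hB wr; have := pseries_tail_le 0 hB wr.
by rewrite psum0 subr0 expr0 mulr1.
Qed.

Lemma has_radius_sumP c w rho : has_radius c rho -> modulus w < rho ->
  pseries_cvg c w (pseries_sum c w).
Proof.
move=> hc wr; pose r := (modulus w + rho) / 2.
have w0 := modulus_ge0 w.
have [B _ hB] := hc r ltac:(rewrite /r; lra) ltac:(rewrite /r; lra).
by apply: (pseries_sumP hB); rewrite /r; lra.
Qed.

Lemma has_radiusW c rho rho' : rho' <= rho -> has_radius c rho ->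
  has_radius c rho'.
Proof. by move=> le hc r r0 r1; apply: hc => //; lra. Qed.

Lemma pseries_cvgD c d w S S' : pseries_cvg c w S -> pseries_cvg d w S' ->
  pseries_cvg (fun n => c n + d n) w (S + S').
Proof.
move=> h h' e e0; have e20 : 0 < e / 2 by lra.
have [N hN] := h _ e20; have [N' hN'] := h' _ e20.
exists (maxn N N') => n; rewrite geq_max => /andP[n1 n2].
rewrite [X in modulus X](_ : _ = (S - psum c w n) + (S' - psum d w n)).
  by apply: (le_trans (modulusD _ _)); have := hN _ n1; have := hN' _ n2; lra.
by rewrite psumD; ring.
Qed.

Lemma pseries_cvgZ c a w S : pseries_cvg c w S ->
  pseries_cvg (fun n => a * c n) w (a * S).
Proof.
move=> h e e0; have a0 := modulus_ge0 a.
have e20 : 0 < e / (1 + modulus a) by rewrite divr_gt0//; lra.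
have [N hN] := h _ e20; exists N => n /hN.
rewrite psumZ.
rewrite ler_pdivlMr; last by lra.
rewrite -mulrBr modulusM; apply: le_trans.
by rewrite mulrC ler_wpM2l ?modulus_ge0//; lra.
Qed.

Lemma pseries_cvg_shift c w S : pseries_cvg (fun n => c n.+1) w S ->
  pseries_cvg c w (c 0%N + w * S).
Proof.
move=> h e e0; have a0 := modulus_ge0 w.
have e20 : 0 < e / (1 + modulus w) by rewrite divr_gt0//; lra.
have [N hN] := h _ e20; exists N.+1 => -[//|n] /hN.
rewrite psumSl ler_pdivlMr; last by lra.
rewrite opprD addrACA subrr add0r -mulrBr modulusM; apply: le_trans.
by rewrite mulrC ler_wpM2l ?modulus_ge0//; lra.
Qed.

Lemma has_radiusD c d rho : has_radius c rho -> has_radius d rho ->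
  has_radius (fun n => c n + d n) rho.
Proof.
move=> hc hd r r0 r1; have [B B0 hB] := hc r r0 r1; have [D D0 hD] := hd r r0 r1.
exists (B + D); first exact: addr_ge0.
move=> n; apply: le_trans (lerD (hB n) (hD n)).
by rewrite -mulrDl ler_wpM2r ?modulusD// exprn_ge0// ltW.
Qed.

Lemma has_radiusZ c a rho : has_radius c rho ->
  has_radius (fun n => a * c n) rho.
Proof.
move=> hc r r0 r1; have [B B0 hB] := hc r r0 r1.
exists (modulus a * B); first by rewrite mulr_ge0 ?modulus_ge0.
by move=> n; rewrite modulusM -mulrA ler_wpM2l ?modulus_ge0.
Qed.

Lemma has_radius_shift c rho : has_radius c rho ->
  has_radius (fun n => c n.+1) rho.
Proof.
move=> hc r r0 r1; have [B B0 hB] := hc r r0 r1.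
exists (B / r) => [|n]; first by rewrite divr_ge0// ltW.
by rewrite ler_pdivlMr// -mulrA -exprSr.
Qed.

Lemma pseries_sumD c d w rho : has_radius c rho -> has_radius d rho ->
  modulus w < rho ->
  pseries_sum (fun n => c n + d n) w = pseries_sum c w + pseries_sum d w.
Proof.
by move=> hc hd wr; apply/pseries_cvgE/pseries_cvgD; exact: has_radius_sumP wr.
Qed.

Lemma pseries_sumZ c a w rho : has_radius c rho -> modulus w < rho ->
  pseries_sum (fun n => a * c n) w = a * pseries_sum c w.
Proof.
by move=> hc wr; apply/pseries_cvgE/pseries_cvgZ; exact: has_radius_sumP wr.
Qed.

Lemma pseries_sum_shift c w rho : has_radius c rho -> modulus w < rho ->
  pseries_sum c w = c 0%N + w * pseries_sum (fun n => c n.+1) w.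
Proof.
move=> hc wr; apply/pseries_cvgE/pseries_cvg_shift.
by apply: has_radius_sumP wr; exact: has_radius_shift.
Qed.

Lemma pseries_sum0 c : pseries_sum c 0 = c 0%N.
Proof.
apply: pseries_cvgE => e e0; exists 1%N => -[//|n] _.
by rewrite psumSl mul0r addr0 subrr modulus0 ltW.
Qed.

(* The coefficients of the power series (c(w) - c(z)) / (w - z). *)
Definition divdiff c z (n : nat) : R[i] :=
  pseries_sum (fun k => c (n + k).+1) z.

Lemma has_radius_shiftn c n rho : has_radius c rho ->
  has_radius (fun k => c (n + k)%N) rho.
Proof.
elim: n => [//|n IH] /IH; move=> h; have := has_radius_shift h.
by under eq_fun do rewrite addnS.
Qed.

Lemma divdiffS c z n rho : has_radius c rho -> modulus z < rho ->
  divdiff c z n = c n.+1 + z * divdiff c z n.+1.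
Proof.
move=> hc zr; rewrite /divdiff (pseries_sum_shift _ zr).
  by rewrite addn0; under [in RHS]eq_fun do rewrite addSnnS.
exact: (has_radius_shiftn n.+1).
Qed.

Lemma has_radius_divdiff c z rho : has_radius c rho -> modulus z < rho ->
  has_radius (divdiff c z) rho.
Proof.
move=> hc zr r r0 r1; have z0 := modulus_ge0 z.
(* s exceeds |z|, so the tails defining the divided differences converge geometrically, and r, so
   the resulting bound B / s^n controls r^n. *)
pose s := (Num.max r (modulus z) + rho) / 2.
have [rs zs srho] : [/\ r < s, modulus z < s & s < rho].
  by split; rewrite /s maxEle; case: ifP; lra.
have s0 : 0 < s by lra.
have q1 : 0 < 1 - modulus z / s by rewrite subr_gt0 ltr_pdivrMr// mul1r.
have [B B0 hB] := hc s s0 srho.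
exists (B / s / (1 - modulus z / s)) => [|n].
  by apply: divr_ge0 (ltW q1); apply: divr_ge0 (ltW s0).
have hB' k : modulus (c (n + k).+1) * s ^+ k <= B / s ^+ n.+1.
  by rewrite ler_pdivlMr ?exprn_gt0// -mulrA -exprD addnS addnC hB.
apply: le_trans (_ : B / s ^+ n.+1 / (1 - modulus z / s) * s ^+ n <= _).
  apply: ler_pM; [exact: modulus_ge0|exact: exprn_ge0 (ltW r0)|
    exact: pseries_sum_le|].
  by apply: lerXn2r; rewrite ?nnegrE; lra.
rewrite exprS invfM le_eqVlt; apply/orP; left; apply/eqP; field.
by rewrite expf_neq0 ?gt_eqF//; lra.
Qed.

Lemma bounded_geometric_small c r rho : has_radius c rho -> 0 <= r ->
  r < rho -> forall e, 0 < e ->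
  exists N, forall n, (N <= n)%N -> modulus (c n) * r ^+ n <= e.
Proof.
move=> hc r0 r1 e e0; pose s := (r + rho) / 2.
have s0 : 0 < s by rewrite /s; lra.
have [B B0 hB] := hc s s0 ltac:(rewrite /s; lra).
have q0 : 0 <= r / s by rewrite divr_ge0// ltW.
have q1 : r / s < 1 by rewrite ltr_pdivrMr// mul1r /s; lra.
have [N hN] := geometric_small B q0 q1 e0.
exists N => n /hN; apply: le_trans.
rewrite expr_div_n mulrA ler_pdivlMr ?exprn_gt0//.
by rewrite mulrAC ler_wpM2r// exprn_ge0.
Qed.

Lemma divdiffE c z w rho : has_radius c rho -> modulus z < rho ->
  modulus w < rho ->
  pseries_sum c w = pseries_sum c z + (w - z) * pseries_sum (divdiff c z) w.
Proof.
move=> hc zr wr.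
have hd := has_radius_divdiff hc zr.
(* The recursion [divdiffS] makes the product telescope; the extra term d_n w^(n+1) tends to 0. *)
have tele n : (w - z) * psum (divdiff c z) w n.+1 =
   divdiff c z n * w ^+ n.+1 + psum c w n.+1 - pseries_sum c z.
  elim: n => [|n IH].
    rewrite !psumS !psum0 expr0 expr1 (pseries_sum_shift hc zr).
    by rewrite [divdiff c z 0](_ : _ = pseries_sum (fun n => c n.+1) z)//; ring.
  rewrite psumS mulrDr IH (psumS c w n.+1) (divdiffS n hc zr) !exprS.
  by ring.
apply: modulus_le_eps_eq => e e0; have w0 := modulus_ge0 (w - z).
have w1 : 0 < 1 + modulus (w - z) by lra.
have e1 : 0 < e / 3 / (1 + modulus (w - z)) by rewrite divr_gt0//; lra.
have e2 : 0 < e / 3 / (1 + modulus w).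
  by apply: divr_gt0; have := modulus_ge0 w; lra.
have e3 : 0 < e / 3 by lra.
have [N1 h1] := has_radius_sumP hd wr e1.
have [N2 h2] := has_radius_sumP hc wr e3.
have [N3 h3] := bounded_geometric_small hd (modulus_ge0 w) wr e2.
pose n := (N1 + N2 + N3)%N.
have := h1 n.+1 ltac:(rewrite /n; lia).
have := h2 n.+1 ltac:(rewrite /n; lia).
have := h3 n ltac:(rewrite /n; lia).
set X := pseries_sum (divdiff c z) w; set Y := pseries_sum c w.
rewrite ler_pdivlMr => [i3 i2|]; last by have := modulus_ge0 w; lra.
rewrite ler_pdivlMr// => i1.
rewrite [X in modulus X](_ : _ = (Y - psum c w n.+1) -
  (w - z) * (X - psum (divdiff c z) w n.+1) - divdiff c z n * w ^+ n.+1); last first.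
  by rewrite mulrBr tele; ring.
apply: (le_trans (modulusB _ _)); rewrite [X in _ + X]modulusM modulusX.
have : modulus (Y - psum c w n.+1 - (w - z) * (X - psum (divdiff c z) w n.+1))
  <= e / 3 + e / 3.
  apply: (le_trans (modulusB _ _)); apply: lerD => //.
  rewrite modulusM mulrC; apply: le_trans i1.
  by rewrite ler_wpM2l ?modulus_ge0//; lra.
have : modulus (divdiff c z n) * modulus w ^+ n.+1 <= e / 3.
  rewrite exprSr mulrA; apply: le_trans i3.
  by rewrite ler_wpM2l ?mulr_ge0 ?exprn_ge0 ?modulus_ge0//; lra.
lra.
Qed.

Lemma natmul_expr_le (q : R) n : 0 <= q -> q < 1 ->
  n%:R * q ^+ n <= (1 - q)^-1.
Proof.
move=> q0 q1; have q2 : 0 < 1 - q by lra.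
(* (1 - q^n) / (1 - q) is a sum of n powers of q, each at least q^n. *)
suff : n%:R * q ^+ n * (1 - q) <= 1 - q ^+ n.
  move=> h; rewrite -[leRHS]mul1r ler_pdivlMr//.
  by apply: (le_trans h); rewrite gerBl exprn_ge0.
elim: n => [|n IH]; first by rewrite expr0; lra.
have qn : 0 <= q ^+ n by rewrite exprn_ge0.
have qn1 : q ^+ n <= 1 by rewrite exprn_ile1// ltW.
rewrite -natr1 exprS.
have -> : (n%:R + 1) * (q * q ^+ n) * (1 - q) =
  q * (n%:R * q ^+ n * (1 - q)) + q * q ^+ n * (1 - q) by ring.
have := ler_wpM2l q0 IH.
have : 0 <= (1 - q) * (1 - q * q ^+ n).
  by rewrite mulr_ge0 ?subr_ge0 ?mulr_ile1// ltW.
by lra.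
Qed.

Lemma has_radius_natmul c rho : has_radius c rho ->
  has_radius (fun n => n%:R * c n) rho.
Proof.
move=> hc r r0 r1; pose s := (r + rho) / 2.
have s0 : 0 < s by rewrite /s; lra.
have [B B0 hB] := hc s s0 ltac:(rewrite /s; lra).
have q0 : 0 <= r / s by rewrite divr_ge0// ltW.
have q1 : r / s < 1 by rewrite ltr_pdivrMr// mul1r /s; lra.
exists (B * (1 - r / s)^-1) => [|n].
  by rewrite mulr_ge0// invr_ge0 subr_ge0 ltW.
rewrite [leLHS](_ : _ = (modulus (c n) * s ^+ n) * (n%:R * (r / s) ^+ n)).
  apply: ler_pM; rewrite ?natmul_expr_le//.
    by rewrite mulr_ge0 ?modulus_ge0 ?exprn_ge0// ltW.
  by rewrite mulr_ge0 ?exprn_ge0.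
rewrite modulusM -(rmorph_nat (real_complex R)) modulus_real normr_nat (expr_div_n r s).
by field; rewrite expf_neq0// gt_eqF.
Qed.

Lemma has_radius_deriv c rho : has_radius c rho ->
  has_radius (fun n => n.+1%:R * c n.+1) rho.
Proof.
by move=> /has_radius_natmul/has_radius_shift.
Qed.

(* D_N = sum_(n < N) d_n z^n with d = divdiff c z satisfies
   D_N = sum_(k <= N) k c_k z^(k-1) + N d_N z^N. *)
Lemma pseries_sum_deriv c z rho : has_radius c rho -> modulus z < rho ->
  pseries_sum (fun n => n.+1%:R * c n.+1) z = pseries_sum (divdiff c z) z.
Proof.
move=> hc zr; have hd := has_radius_divdiff hc zr.
have tele n : psum (divdiff c z) z n =
    psum (fun n => n.+1%:R * c n.+1) z n + n%:R * divdiff c z n * z ^+ n.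
  elim: n => [|n IH]; first by rewrite !psum0 !mul0r addr0.
  rewrite !psumS IH (divdiffS n hc zr) exprS -(natr1 n).
  by ring.
apply: pseries_cvgE => e e0; have e20 : 0 < e / 2 by lra.
have [N1 h1] := has_radius_sumP hd zr e20.
suff [N2 h2] : exists N, forall n, (N <= n)%N ->
    modulus (n%:R * divdiff c z n * z ^+ n) <= e / 2.
  exists (N1 + N2)%N => n nN.
  rewrite [X in modulus X](_ : _ = pseries_sum (divdiff c z) z -
    psum (divdiff c z) z n + n%:R * divdiff c z n * z ^+ n).
    apply: (le_trans (modulusD _ _)).
    by have := h1 n ltac:(lia); have := h2 n ltac:(lia); lra.
  by rewrite tele; ring.
have [N hN] := bounded_geometric_small (has_radius_natmul hd) (modulus_ge0 z) zr e20.
by exists N => n /hN; rewrite !modulusM modulusX.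
Qed.

End power_series.

(** * The maximum principle *)

Section maximum_principle.
Context {R : realType}.
Implicit Types (u v e : R[i] -> R[i]) (z w h : R[i]).

Definition bounded_near0 e : Prop :=
  exists d D : R, 0 < d /\ forall h, modulus h <= d -> modulus (e h) <= D.

(** Order two is what the maximum principle needs: the remainder O(t^3) must lose against a gain of
    order t^2. In this form, closure under products, inverses and w -> w^2 is plain algebra. *)
Definition taylor2 u z : Prop := exists c1 c2 e, bounded_near0 e /\
  forall h, u (z + h) = u z + c1 * h + c2 * h ^+ 2 + h ^+ 3 * e h.

Lemma bounded_near0D e e' : bounded_near0 e -> bounded_near0 e' ->
  bounded_near0 (fun h => e h + e' h).
Proof.
move=> [d [D [d0 H]]] [d' [D' [d0' H']]].
exists (Num.min d d'), (D + D'); split; first by rewrite lt_min d0.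
move=> h; rewrite le_min => /andP[hd hd'].
by rewrite (le_trans (modulusD _ _))// lerD ?H ?H'.
Qed.

Lemma bounded_near0M e e' : bounded_near0 e -> bounded_near0 e' ->
  bounded_near0 (fun h => e h * e' h).
Proof.
move=> [d [D [d0 H]]] [d' [D' [d0' H']]].
exists (Num.min d d'), (D * D'); split; first by rewrite lt_min d0.
move=> h; rewrite le_min => /andP[hd hd'].
by rewrite modulusM ler_pM ?modulus_ge0 ?H ?H'.
Qed.

Lemma bounded_near0_cst a : bounded_near0 (fun=> a).
Proof. by exists 1, (modulus a). Qed.

Lemma bounded_near0_id : bounded_near0 id.
Proof. by exists 1, 1. Qed.

Lemma bounded_near0_eq e e' (d : R) : 0 < d ->
  (forall h, modulus h <= d -> h != 0 -> e h = e' h) ->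
  bounded_near0 e' -> bounded_near0 e.
Proof.
move=> d0 ee' [d' [D [d0' H]]].
exists (Num.min d d'), (Num.max (modulus (e 0)) D); split.
  by rewrite lt_min d0.
move=> h; rewrite le_min le_max => /andP[hd hd'].
by have [->|h0] := eqVneq h 0; rewrite ?lexx// ee'// H// orbT.
Qed.

(** A local expansion suffices: away from 0 the error function is redefined by solving the equation
    for it. *)
Lemma taylor2I u z c1 c2 e (d : R) : 0 < d -> bounded_near0 e ->
  (forall h, modulus h <= d ->
    u (z + h) = u z + c1 * h + c2 * h ^+ 2 + h ^+ 3 * e h) -> taylor2 u z.
Proof.
move=> d0 be H; exists c1, c2.
exists (fun h => (u (z + h) - (u z + c1 * h + c2 * h ^+ 2)) / h ^+ 3); split.
  apply: (bounded_near0_eq d0 _ be) => h hd h0; rewrite H//.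
  by field.
move=> h; have [->|h0] := eqVneq h 0.
  by rewrite addr0 expr0n /= expr0n /= !mulr0 !mul0r !addr0.
by field.
Qed.

Lemma taylor2_cst a z : taylor2 (fun=> a) z.
Proof.
exists 0, 0, (fun=> 0); split; first exact: bounded_near0_cst.
by move=> h; ring.
Qed.

Lemma taylor2_id z : taylor2 id z.
Proof.
exists 1, 0, (fun=> 0); split; first exact: bounded_near0_cst.
by move=> h; ring.
Qed.

Lemma taylor2D u v z : taylor2 u z -> taylor2 v z ->
  taylor2 (fun w => u w + v w) z.
Proof.
move=> [c1 [c2 [e [be H]]]] [d1 [d2 [f [bf H']]]].
exists (c1 + d1), (c2 + d2), (fun h => e h + f h).
by split=> [|h]; [exact: bounded_near0D|rewrite H H'; ring].
Qed.

Lemma taylor2M u v z : taylor2 u z -> taylor2 v z ->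
  taylor2 (fun w => u w * v w) z.
Proof.
move=> [c1 [c2 [e [be H]]]] [d1 [d2 [f [bf H']]]].
exists (u z * d1 + c1 * v z), (u z * d2 + c1 * d1 + c2 * v z).
exists (fun h => (c1 * d2 + c2 * d1 + c2 * d2 * h) +
   (v z + d1 * h + d2 * (h * h)) * e h + (u z + c1 * h + c2 * (h * h)) * f h +
   h * (h * (h * (e h * f h)))).
split=> [|h]; last by rewrite H H'; ring.
by repeat (apply: bounded_near0D || apply: bounded_near0M ||
  exact: bounded_near0_cst || exact: bounded_near0_id || assumption).
Qed.

Lemma taylor2X u z n : taylor2 u z -> taylor2 (fun w => u w ^+ n) z.
Proof.
move=> tu; elim: n => [|n IH].
  by under eq_fun do rewrite expr0; exact: taylor2_cst.
by under eq_fun do rewrite exprS; exact: taylor2M.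
Qed.

Lemma taylor2_lip u z : taylor2 u z -> exists d D : R, [/\ 0 < d, 0 <= D &
  forall h, modulus h <= d -> modulus (u (z + h) - u z) <= D * modulus h].
Proof.
move=> [c1 [c2 [e [be H]]]].
have : bounded_near0 (fun h => c1 + c2 * h + h * h * e h).
  by repeat (apply: bounded_near0D || apply: bounded_near0M ||
    exact: bounded_near0_cst || exact: bounded_near0_id || assumption).
move=> [d [D [d0 b]]]; exists d, D; split => //.
  apply: le_trans (modulus_ge0 _) (b 0 _); rewrite modulus0; exact: ltW.
move=> h /b b'.
rewrite H [X in modulus X](_ : _ = (c1 + c2 * h + h * h * e h) * h); last by ring.
by rewrite modulusM ler_wpM2r ?modulus_ge0.
Qed.

Lemma taylor2_small u z (eps : R) : taylor2 u z -> 0 < eps ->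
  exists2 d : R, 0 < d &
    forall h, modulus h <= d -> modulus (u (z + h) - u z) <= eps.
Proof.
move=> /taylor2_lip[d [D [d0 D0 H]]] e0.
have D1 : 0 < D + 1 by lra.
exists (Num.min d (eps / (D + 1))); first by rewrite lt_min d0 divr_gt0.
move=> h; rewrite le_min ler_pdivlMr// => /andP[hd he].
by apply: (le_trans (H _ hd)); have := modulus_ge0 h; lra.
Qed.

Lemma taylor2V u z : u z != 0 -> taylor2 u z -> taylor2 (fun w => (u w)^-1) z.
Proof.
move=> uz0 tu.
have uz1 : 0 < modulus (u z) / 2 by rewrite divr_gt0// modulus_gt0.
have [d d0 hd] := taylor2_small tu uz1.
case: tu => [c1 [c2 [e [be H]]]].
have low h : modulus h <= d -> modulus (u z) / 2 <= modulus (u (z + h)).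
  move=> /hd; have := modulus_lB (u z) (u (z + h)); rewrite modulusBC.
  by lra.
have nz h : modulus h <= d -> u (z + h) != 0.
  by move=> /low; rewrite -modulus_gt0; apply: lt_le_trans.
(* a0 + a1 h + a2 h^2 inverts the Taylor polynomial of u modulo h^3; its product with u (z + h) is 1
   + h^3 s(h). *)
pose a0 := (u z)^-1; pose a1 := - c1 / u z ^+ 2.
pose a2 := (c1 ^+ 2 / u z - c2) / u z ^+ 2.
pose s h := (c1 * a2 + c2 * a1) + c2 * a2 * h + (a0 + a1 * h + a2 * (h * h)) * e h.
apply: (@taylor2I _ _ a1 a2 (fun h => - s h * (u (z + h))^-1) d d0).
  apply: bounded_near0M.
    under eq_fun do rewrite -mulN1r.
    by repeat (apply: bounded_near0D || apply: bounded_near0M ||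
      exact: bounded_near0_cst || exact: bounded_near0_id || assumption).
  exists d, (modulus (u z) / 2)^-1; split => // h hd'.
  rewrite modulusV lef_pV2 ?posrE ?low//.
  exact: lt_le_trans (low _ hd').
move=> h /nz; rewrite H => nzh; rewrite /s /a0 /a1 /a2.
by field; rewrite nzh uz0.
Qed.

Lemma taylor2_comp_sqr u z : taylor2 u (z ^+ 2) -> taylor2 (fun w => u (w ^+ 2)) z.
Proof.
move=> [c1 [c2 [e [be H]]]].
exists (c1 * (2 * z)), (c1 + c2 * (4 * z ^+ 2)).
exists (fun h => c2 * (4 * z + h) + (2 * z + h) ^+ 3 * e (h * (2 * z + h))).
split=> [|h]; last first.
  rewrite sqrrD -addrA [X in u (_ + X)](_ : _ = h * (2 * z + h)); last by ring.
  by rewrite H; ring.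
under eq_fun do rewrite exprS expr2.
have bz : bounded_near0 (fun h => 2 * z + h).
  by apply: bounded_near0D; [exact: bounded_near0_cst|exact: bounded_near0_id].
have be' : bounded_near0 (fun h => e (h * (2 * z + h))).
  case: be bz => d [D [d0 bD]] [d' [D' [d0' bD']]].
  have D0' : 0 <= D'.
    by apply: le_trans (modulus_ge0 _) (bD' 0 _); rewrite modulus0 ltW.
  exists (Num.min d' (d / (D' + 1))), D; split.
    by rewrite lt_min d0' divr_gt0//; lra.
  move=> h; rewrite le_min ler_pdivlMr; last by lra.
  move=> /andP[h1 h2]; apply: bD; rewrite modulusM; apply: le_trans h2.
  by rewrite ler_wpM2l ?modulus_ge0// (le_trans (bD' _ h1)); lra.
by repeat (apply: bounded_near0D || apply: bounded_near0M ||
  exact: bounded_near0_cst || exact: bounded_near0_id || assumption).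
Qed.

Lemma taylor2_pseries (c : nat -> R[i]) z rho : has_radius c rho ->
  modulus z < rho -> taylor2 (pseries_sum c) z.
Proof.
(* Three divided differences at z give c(w) = c(z) + (w - z) d(z) + (w - z)^2 f(z) + (w - z)^3
   g(w). *)
move=> hc zr; pose d := divdiff c z; pose f := divdiff d z.
pose g := divdiff f z.
have hd : has_radius d rho by exact: has_radius_divdiff.
have hf : has_radius f rho by exact: has_radius_divdiff.
have hg : has_radius g rho by exact: has_radius_divdiff.
pose r := (modulus z + rho) / 2; pose r' := (r + rho) / 2.
have z0 := modulus_ge0 z.
have [B B0 hB] := hg r' ltac:(rewrite /r' /r; lra) ltac:(rewrite /r' /r; lra).
have r0 : 0 < r by rewrite /r; lra.
have rr' : r < r' by rewrite /r' /r; lra.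
have rrho : r < rho by rewrite /r; lra.
have hr : modulus z < r by rewrite /r; lra.
clearbody r r'.
have nz h : modulus h <= r - modulus z -> modulus (z + h) <= r.
  by move=> hh; apply: (le_trans (modulusD _ _)); lra.
apply: (@taylor2I _ _ (pseries_sum d z) (pseries_sum f z)
  (fun h => pseries_sum g (z + h)) (r - modulus z)).
- by lra.
- exists (r - modulus z), (B / (1 - r / r')); split=> [|h /nz hh]; first by lra.
  have hlt := le_lt_trans hh rr'.
  apply: (le_trans (pseries_sum_le hB hlt)).
  have r'0 : 0 < r' by lra.
  rewrite ler_wpM2l// lef_pV2 ?posrE ?subr_gt0 ?ltr_pdivrMr ?mul1r//.
  by rewrite lerB// ler_pM2r ?invr_gt0.
move=> h /nz hh; have hlt := le_lt_trans hh rrho.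
rewrite (divdiffE hc zr hlt) (divdiffE hd zr hlt) (divdiffE hf zr hlt).
rewrite -/d -/f -/g.
move: (pseries_sum c z) (pseries_sum d z) (pseries_sum f z) => x1 x2 x3.
by move: (pseries_sum g _) => x4; ring.
Qed.

End maximum_principle.

(** * Compactness of half discs *)

Section half_disc.
Context {R : realType}.
Implicit Types (u v e : R[i] -> R[i]) (z w h : R[i]).

(** The cut at Re z = k lets one maximum principle serve right half discs (k = 0) and full discs (k
    = - r - 1, where the cut misses the disc). *)
Definition half_disc (r k : R) : set R[i] :=
  [set z | modulus z <= r /\ k <= complex.Re z].

Lemma half_disc_max (v : R[i] -> R) (r k : R) :
  half_disc r k !=set0 ->
  (forall z, half_disc r k z -> forall eps : R, 0 < eps ->
    exists2 d : R, 0 < d &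
      forall h, modulus h <= d -> `|v (z + h) - v z| <= eps) ->
  exists2 z0, half_disc r k z0 & forall z, half_disc r k z -> v z <= v z0.
Proof.
move=> [z1 Kz1] cv.
(* Compactness is obtained in the plane R x R, inside a product of two segments, and transported by
   [m]. *)
pose T := (R^o * R^o)%type; pose m (p : T) : R[i] := p.1 +i* p.2.
pose K : set T := [set p | half_disc r k (m p)].
have modc : continuous (fun p : T => p.1 ^+ 2 + p.2 ^+ 2 : R^o).
  move=> p; apply: cvgD; (apply: (@continuous_comp _ _ _ _ (fun x : R^o => x ^+ 2));
    [by [apply: cvg_fst|apply: cvg_snd]|exact: exprn_continuous]).
have r0 : 0 <= r by case: Kz1 => + _; apply: le_trans (modulus_ge0 _).
have KE : K = [set p : T | p.1 ^+ 2 + p.2 ^+ 2 \in `]-oo, r ^+ 2]] `&`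
              [set p : T | p.1 \in `[k, +oo[ ].
  apply/seteqP; split => -[x y]; rewrite /K /half_disc /m /= !in_itv /= ?andbT.
    move=> [h1 ->]; split => //; rewrite -(@sqr_sqrtr _ (x ^+ 2 + y ^+ 2)).
      by rewrite lerXn2r ?nnegrE ?sqrtr_ge0.
    by rewrite addr_ge0 ?sqr_ge0.
  move=> [h1 h2]; split => //; rewrite /modulus /=.
  by rewrite -(ger0_norm r0) -sqrtr_sqr ler_wsqrtr.
have clK : closed K.
  rewrite KE; apply: closedI.
    apply: (@closed_comp _ _ (fun p : T => p.1 ^+ 2 + p.2 ^+ 2 : R^o)
      `]-oo, r ^+ 2]) => [p _|];
      [exact: modc|exact: interval_closed].
  apply: (@closed_comp _ _ (fun p : T => p.1) `[k, +oo[) => [p _|];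
      [exact: cvg_fst|exact: interval_closed].
have cK : compact K.
  apply: (@subclosed_compact _ K (`[-r, r] `*` `[-r, r])) => //.
    by apply: compact_setX; exact: segment_compact.
  move=> [x y] [/= h _]; rewrite /= !in_itv /= -!ler_norml.
  by split; [apply: le_trans (Re_le_modulus (x +i* y)) h|
             apply: le_trans (Im_le_modulus (x +i* y)) h].
have [||p + maxp] :=
    @compact_EVT_max T R (v \o m) K _ cK.
- by exists (complex.Re z1, complex.Im z1); rewrite /K /m /=; case: z1 Kz1.
- apply: continuous_in_subspaceT => -[x y]; rewrite inE => Kp.
  apply/cvgrPdist_le => eps e0; have [d d0 hd] := cv _ Kp eps e0.
  near=> q; rewrite distrC /=.
  rewrite [m q](_ : _ = m (x, y) + ((q.1 - x) +i* (q.2 - y))).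
    apply: hd; apply: (le_trans (modulus_le_ReIm _)) => /=.
    have -> : d = d / 2 + d / 2 by lra.
    apply: lerD; rewrite distrC; near: q.
      have /cvgrPdist_le : (fun q : T => q.1) q @[q --> (x, y)] --> x by exact: cvg_fst.
      by apply; lra.
    have /cvgrPdist_le : (fun q : T => q.2) q @[q --> (x, y)] --> y by exact: cvg_snd.
    by apply; lra.
  rewrite /m /=; apply/eqP; rewrite eq_complex /=.
  by rewrite !addrA ![_ + _ - _]addrC !addrA !addNr !add0r !eqxx.
rewrite inE => Kp; exists (m p) => // z Kz.
have := maxp (complex.Re z, complex.Im z); rewrite /= /m /=.
by case: z Kz => a b Kz; apply; apply/mem_set.
Unshelve. all: by end_near.
Qed.

Lemma taylor2_modulus_small u z (eps : R) : taylor2 u z -> 0 < eps ->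
  exists2 d : R, 0 < d &
    forall h, modulus h <= d -> `|modulus (u (z + h)) - modulus (u z)| <= eps.
Proof.
move=> tu e0; have [d d0 hd] := taylor2_small tu e0.
exists d => // h /hd hh; rewrite ler_norml.
have := modulus_lB (u (z + h)) (u z); have := modulus_lB (u z) (u (z + h)).
by rewrite (modulusBC (u z)); lra.
Qed.

Lemma taylor2_bounded u (r k : R) :
  (forall z, half_disc r k z -> taylor2 u z) ->
  exists2 B : R, 0 <= B & forall z, half_disc r k z -> modulus (u z) <= B.
Proof.
move=> tu; have [ne|] := pselect (half_disc r k !=set0); last first.
  by move=> e; exists 0 => // z Kz; exfalso; apply: e; exists z.
have [z Kz|z0 _ h] := half_disc_max (v := fun z => modulus (u z)) ne.
  by move=> e e0; apply: taylor2_modulus_small => //; exact: tu.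
by exists (modulus (u z0)); rewrite ?modulus_ge0.
Qed.

End half_disc.

Section maximum_modulus.
Context {R : realType}.
Implicit Types (u : R[i] -> R[i]) (z w h : R[i]).

Lemma sqr_modulus_lD z w :
  modulus z ^+ 2 - 2 * modulus z * modulus w <= modulus (z + w) ^+ 2.
Proof.
have h := modulus_lD z w; have h1 := modulus_ge0 (z + w).
have h2 := modulus_ge0 z; have h3 := modulus_ge0 w.
have [h4|h4] := leP (modulus w) (modulus z).
  apply: le_trans (_ : (modulus z - modulus w) ^+ 2 <= _).
    by rewrite sqrrB; have := sqr_ge0 (modulus w); lra.
  by rewrite lerXn2r// nnegrE; lra.
apply: le_trans (_ : 0 <= _); last exact: sqr_ge0.
have : modulus z * (2 * modulus w - modulus z) >= 0 by rewrite mulr_ge0//; lra.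
by rewrite expr2; lra.
Qed.

(* The cross terms cancel over the four directions 1, -1, i, -i. *)
Lemma quadratic_mean4 (a b c : R[i]) (t : R) :
  let q h := modulus (a + b * h + c * h ^+ 2) ^+ 2 in
  q t%:C + q (- t%:C) + q ('i * t%:C) + q (- ('i * t%:C)) =
  4 * (modulus a ^+ 2 + modulus b ^+ 2 * t ^+ 2 + modulus c ^+ 2 * t ^+ 4).
Proof.
rewrite /= !sqr_modulus; case: a b c => a a' [b b'] [c c'] /=.
by ring.
Qed.

(** Sub-mean-value property of |u|^2 up to O(t^3): the quadratic Taylor polynomial satisfies it by
    [quadratic_mean4], and the cubic remainder costs at most 2 D t^3 in each direction. *)
Lemma taylor2_mean4 u z : taylor2 u z -> exists D t0 : R, [/\ 0 <= D, 0 < t0 &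
  forall t, 0 < t -> t <= t0 ->
  4 * modulus (u z) ^+ 2 - D * t ^+ 3 <=
    modulus (u (z + t%:C)) ^+ 2 + modulus (u (z + - t%:C)) ^+ 2 +
    modulus (u (z + 'i * t%:C)) ^+ 2 + modulus (u (z + - ('i * t%:C))) ^+ 2].
Proof.
move=> [c1 [c2 [e [be H]]]].
pose q h := u z + c1 * h + c2 * h ^+ 2.
have bq : bounded_near0 q.
  rewrite /q; under eq_fun do rewrite expr2.
  by repeat (apply: bounded_near0D || apply: bounded_near0M ||
    exact: bounded_near0_cst || exact: bounded_near0_id || assumption).
have := bounded_near0M bq be.
move=> [d [D [d0 bD]]].
have D0 : 0 <= D by apply: le_trans (modulus_ge0 _) (bD 0 _); rewrite modulus0 ltW.
exists (8 * D), d; split; [by lra|exact: d0|move=> t t0 td].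
have key h : modulus h = t ->
    modulus (q h) ^+ 2 - 2 * D * t ^+ 3 <= modulus (u (z + h)) ^+ 2.
  move=> ht; rewrite H -/(q h); apply: le_trans (sqr_modulus_lD _ _).
  rewrite modulusM modulusX ht lerD2l lerN2.
  have := bD h; rewrite ht modulusM => /(_ td) i1.
  have t3 : 0 <= t ^+ 3 by rewrite exprn_ge0// ltW.
  have := ler_wpM2r t3 i1; lra.
have mt : modulus t%:C = t by rewrite modulus_real gtr0_norm.
have mi : modulus ('i : R[i]) = 1.
  by rewrite /modulus /= expr0n /= add0r expr1n sqrtr1.
have := quadratic_mean4 (u z) c1 c2 t; rewrite /= -!/(q _) => Q.
have k1 := key _ mt.
have k2 := key (- t%:C) ltac:(by rewrite modulusN).
have k3 := key ('i * t%:C) ltac:(by rewrite modulusM mi mt mul1r).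
have k4 := key (- ('i * t%:C)) ltac:(by rewrite modulusN modulusM mi mt mul1r).
have : 0 <= modulus c1 ^+ 2 * t ^+ 2 by rewrite mulr_ge0 ?sqr_ge0.
have : 0 <= modulus c2 ^+ 2 * t ^+ 4.
  by rewrite mulr_ge0 ?sqr_ge0// exprn_ge0// ltW.
lra.
Qed.

(* At an interior maximum of |u|^2 + delta |z|^2 the mean over the four
   directions would increase by at least 4 delta t^2 - O(t^3). *)
Theorem maximum_modulus u (r k M : R) :
  (forall z, half_disc r k z -> taylor2 u z) ->
  (forall z, half_disc r k z -> modulus z = r \/ complex.Re z = k ->
    modulus (u z) <= M) ->
  forall z, half_disc r k z -> modulus (u z) <= M.
Proof.
move=> tu bM z1 Kz1; rewrite leNgt; apply/negP => Mz1.
have r0 : 0 <= r by case: Kz1 => + _; apply: le_trans (modulus_ge0 _).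
(* Squares are compared below, so M is replaced by max(0, M). This stays below |u(z1)|: otherwise M
   < 0, which the boundary point r excludes. *)
have [M' [M0 MM' M'z]] : exists M', [/\ 0 <= M', M <= M' & M' < modulus (u z1)].
  exists (Num.max 0 M); rewrite le_max lexx le_max lexx orbT; split => //.
  rewrite gt_max Mz1 andbT lt_neqAle modulus_ge0 andbT eq_sym.
  apply/negP => /eqP u0.
  have [m0|m0] := ltP M 0; last by move: Mz1; rewrite u0 ltNge m0.
  have bd z : half_disc r k z -> modulus z = r \/ complex.Re z = k -> False.
    move=> Kz /(bM _ Kz); rewrite leNgt => /negP; apply.
    exact: lt_le_trans m0 (modulus_ge0 _).
  have : half_disc r k (r%:C).
    split; first by rewrite modulus_real ger0_norm.
    case: Kz1 => h1 h2; apply: (le_trans h2).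
    by apply: le_trans h1; apply: le_trans (Re_le_modulus _); rewrite ler_norm.
  by move=> /bd; apply; left; rewrite modulus_real ger0_norm.
pose gap := modulus (u z1) ^+ 2 - M' ^+ 2.
have gap0 : 0 < gap by rewrite subr_gt0 ltrXn2r// nnegrE modulus_ge0.
have r1 : 0 < 1 + r ^+ 2 by have := sqr_ge0 r; lra.
(* Small enough that dl |z|^2 cannot bring the maximum to the boundary. *)
pose dl := gap / 2 / (1 + r ^+ 2).
have dl0 : 0 < dl by rewrite !divr_gt0//.
have dlr : dl * r ^+ 2 < gap.
  have : dl * (1 + r ^+ 2) = gap / 2 by rewrite /dl mulfVK// gt_eqF.
  by lra.
clearbody dl.
pose v z := modulus (u z) ^+ 2 + dl * modulus z ^+ 2.
have [z Kz eps e0|z0 Kz0 mx] := half_disc_max (v := v) (ex_intro _ z1 Kz1).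
  have e1 : 0 < Num.min 1 (eps / (2 * (1 + 2 * modulus (u z)))).
    by rewrite lt_min ltr01 divr_gt0//; have := modulus_ge0 (u z); lra.
  have e2 : 0 < Num.min 1 (eps / (2 * (1 + 2 * modulus z) * dl)).
    rewrite lt_min ltr01 divr_gt0// mulr_gt0//; have := modulus_ge0 z; lra.
  have [d d0 hd] := taylor2_modulus_small (tu _ Kz) e1.
  have [d' d'0 hd'] := taylor2_modulus_small (taylor2_id z) e2.
  have sq (x y eta : R) : 0 <= x -> 0 <= y -> `|y - x| <= Num.min 1 eta ->
      `|y ^+ 2 - x ^+ 2| <= eta * (1 + 2 * x).
    move=> x0 y0; rewrite le_min => /andP[h1 h2].
    rewrite subr_sqr normrM; apply: ler_pM => //.
    by rewrite ger0_norm ?addr_ge0//; move: h1; rewrite ler_norml; lra.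
  exists (Num.min d d'); first by rewrite lt_min d0.
  move=> h; rewrite le_min => /andP[/hd h1 /hd' h2].
  have := sq _ _ _ (modulus_ge0 _) (modulus_ge0 _) h1.
  have := sq _ _ _ (modulus_ge0 _) (modulus_ge0 _) h2.
  have -> : eps / (2 * (1 + 2 * modulus (u z))) * (1 + 2 * modulus (u z)) = eps / 2.
    by field; have := modulus_ge0 (u z); lra.
  have -> : eps / (2 * (1 + 2 * modulus z) * dl) * (1 + 2 * modulus z) = eps / 2 / dl.
    by field; rewrite gt_eqF//; have := modulus_ge0 z; lra.
  rewrite ler_pdivlMr// /v /= => i1 i2.
  rewrite [X in `|X|](_ : _ = (modulus (u (z + h)) ^+ 2 - modulus (u z) ^+ 2) +
    (modulus (z + h) ^+ 2 - modulus z ^+ 2) * dl); last by ring.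
  apply: (le_trans (ler_normD _ _)); rewrite normrM (gtr0_norm dl0); lra.
have vz1 : M' ^+ 2 + dl * r ^+ 2 < v z0.
  apply: lt_le_trans (mx _ Kz1); rewrite /v.
  have : 0 <= dl * modulus z1 ^+ 2 by rewrite mulr_ge0 ?sqr_ge0// ltW.
  by move: dlr; rewrite /gap; lra.
have z0r : modulus z0 <= r by case: Kz0.
have uz0 : M < modulus (u z0).
  rewrite ltNge; apply/negP => le1; move: vz1; rewrite ltNge => /negP; apply.
  rewrite /v; apply: lerD.
    by rewrite lerXn2r ?nnegrE ?modulus_ge0//; exact: le_trans MM'.
  by rewrite ler_wpM2l ?(ltW dl0)// lerXn2r ?nnegrE ?modulus_ge0.
have int1 : modulus z0 < r.
  rewrite lt_neqAle z0r andbT; apply/eqP => e.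
  by have := bM _ Kz0 (or_introl e); lra.
have int2 : k < complex.Re z0.
  case: Kz0 => _ h; rewrite lt_neqAle h andbT; apply/eqP => e.
  have Kz : half_disc r k z0 by split.
  by have := bM _ Kz (or_intror (esym e)); lra.
have [D [t0 [D0 t00 mean]]] := taylor2_mean4 (tu _ Kz0).
(* The four points stay in the half disc, and D t <= dl - t makes the cubic loss smaller than the
   gain 4 dl t^2. *)
pose t := Num.min (Num.min t0 (r - modulus z0))
  (Num.min (complex.Re z0 - k) (dl / (D + 1))).
have t_gt0 : 0 < t by rewrite !lt_min t00 !subr_gt0 int1 int2 divr_gt0//; lra.
have [t1 t2 t3 t4] : [/\ t <= t0, t <= r - modulus z0,
    t <= complex.Re z0 - k & t <= dl / (D + 1)].
  by rewrite /t !ge_min !lexx ?orbT.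
clearbody t.
have inK h : modulus h = t -> half_disc r k (z0 + h).
  move=> ht; split; first by apply: (le_trans (modulusD _ _)); lra.
  rewrite ReD; have := Re_le_modulus h; rewrite ler_norml ht; lra.
have mt : modulus t%:C = t by rewrite modulus_real gtr0_norm.
have mi : modulus ('i : R[i]) = 1.
  by rewrite /modulus /= expr0n /= add0r expr1n sqrtr1.
have k1 := mx _ (inK _ mt).
have k2 := mx _ (inK (- t%:C) ltac:(by rewrite modulusN)).
have k3 := mx _ (inK ('i * t%:C) ltac:(by rewrite modulusM mi mt mul1r)).
have k4 := mx _ (inK (- ('i * t%:C)) ltac:(by rewrite modulusN modulusM mi mt mul1r)).
(* Applied to z itself: the mean of |z|^2 exceeds |z0|^2 by t^2. *)
have := quadratic_mean4 z0 1 0 t.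
cbv beta zeta; rewrite !mul0r !addr0 !mul1r modulus0 modulus1 expr1n expr0n.
rewrite mul1r mul0r addr0 => Q.
have := mean t t_gt0 t1.
rewrite /v in k1 k2 k3 k4.
move: t4; rewrite ler_pdivlMr; last by lra.
move=> t4 mn.
have tt : 0 < t ^+ 2 by rewrite exprn_gt0.
have p1 : D * t ^+ 3 <= (dl - t) * t ^+ 2.
  by rewrite exprS mulrA ler_wpM2r ?(ltW tt)//; lra.
have p2 : 0 < t * t ^+ 2 by rewrite mulr_gt0.
have p3 : 0 < dl * t ^+ 2 by rewrite mulr_gt0.
have Q' := congr1 ( *%R dl) Q.
lra.
Qed.

Lemma disc_half_disc (r : R) z : modulus z <= r -> half_disc r (- r - 1) z.
Proof.
by move=> zr; split => //; have := Re_le_modulus z; rewrite ler_norml; lra.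
Qed.

Corollary maximum_modulus_disc u (r M : R) :
  (forall z, modulus z <= r -> taylor2 u z) ->
  (forall z, modulus z = r -> modulus (u z) <= M) ->
  forall z, modulus z <= r -> modulus (u z) <= M.
Proof.
move=> tu bM z /disc_half_disc; apply: maximum_modulus => [w [] /tu//|].
move=> w [wr _] [/bM//|Rw].
by have := Re_le_modulus w; rewrite Rw ler_norml; lra.
Qed.

End maximum_modulus.

(** * Quotients and logarithms of power series *)

Section cauchy_estimates.
Context {R : realType}.
Implicit Types (c d N U : nat -> R[i]) (z w : R[i]) (r rho B : R).

(** X (n+1) is (X n - X n 0) / w, which on the circle |w| = rho is at most 2 / rho times the bound
    for X n; the maximum principle carries this inside. It stands in for Cauchy's formula, at the
    price of a factor 2^n. *)
Lemma iterated_quotient_le (X : nat -> R[i] -> R[i]) rho B : 0 < rho ->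
  (forall n w, modulus w <= rho -> taylor2 (X n) w) ->
  (forall n w, modulus w <= rho -> X n w = X n 0 + w * X n.+1 w) ->
  (forall w, modulus w <= rho -> modulus (X 0%N w) <= B) ->
  forall n w, modulus w <= rho -> modulus (X n w) <= B * (2 / rho) ^+ n.
Proof.
move=> r0 tX eX bX; elim=> [|n IH] w wr; first by rewrite expr0 mulr1 bX.
apply: maximum_modulus_disc w wr => [w|w wr]; first exact: tX.
have := eX n w ltac:(by rewrite wr); move=> /(canLR (addKr _)) e.
have : modulus w * modulus (X n.+1 w) <= 2 * (B * (2 / rho) ^+ n).
  rewrite -modulusM -e addrC; apply: (le_trans (modulusB _ _)).
  have := IH w ltac:(by rewrite wr); have := IH 0 ltac:(by rewrite modulus0 ltW).
  by lra.
rewrite wr mulrC -ler_pdivlMr// => /le_trans; apply.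
by rewrite exprS le_eqVlt; apply/orP; left; apply/eqP; field; rewrite gt_eqF.
Qed.

Lemma pseries_coef_le c rho rho' M n : 0 < rho -> rho < rho' ->
  has_radius c rho' ->
  (forall w, modulus w <= rho -> modulus (pseries_sum c w) <= M) ->
  modulus (c n) * rho ^+ n <= 2 ^+ n * M.
Proof.
move=> r0 rr hc bM.
pose X n := pseries_sum (fun k => c (n + k)%N).
have hX m : has_radius (fun k => c (m + k)%N) rho' by exact: has_radius_shiftn.
have eX m w : modulus w <= rho -> X m w = X m 0 + w * X m.+1 w.
  move=> wr; rewrite /X (pseries_sum_shift (hX m)) ?(le_lt_trans wr)//.
  by rewrite pseries_sum0; under eq_fun do rewrite addnS.
have := @iterated_quotient_le X rho M r0 _ eX bM n 0.
rewrite modulus0 (ltW r0) /X pseries_sum0 addn0.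
rewrite expr_div_n mulrA ler_pdivlMr ?exprn_gt0// [M * _]mulrC.
apply => // m w wr; apply: taylor2_pseries (hX m) _.
exact: le_lt_trans rr.
Qed.

Lemma pseries_sum_eq0 c rho : 0 < rho -> has_radius c rho ->
  (forall w, modulus w < rho -> pseries_sum c w = 0) -> forall n, c n = 0.
Proof.
move=> r0 hc c0 n; have r1 : 0 < rho / 2 by lra.
have := @pseries_coef_le c (rho / 2) rho 0 n r1 ltac:(lra) hc _.
rewrite mulr0 => /(_ _) h; apply/eqP; rewrite -modulus_eq0 eq_le modulus_ge0 andbT.
rewrite -(@pmulr_lle0 _ ((rho / 2) ^+ n)) ?exprn_gt0// h// => w wr.
by rewrite c0 ?modulus0//; lra.
Qed.

(** Long division of power series: the remainder after n quotient terms q_k, divided by w^n, that is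
    (N - (q_0 + ... + q_(n-1) w^(n-1)) U) / w^n. *)
Fixpoint quot_rem N U n : nat -> R[i] :=
  if n is m.+1 then
    fun k => quot_rem N U m k.+1 - quot_rem N U m 0%N / U 0%N * U k.+1
  else N.

Definition quot_coef N U n : R[i] := quot_rem N U n 0%N / U 0%N.

Lemma quot_remS N U n k :
  quot_rem N U n.+1 k = quot_rem N U n k.+1 - quot_coef N U n * U k.+1.
Proof. by []. Qed.

Lemma has_radius_quot_rem N U n rho : has_radius N rho -> has_radius U rho ->
  has_radius (quot_rem N U n) rho.
Proof.
move=> hN hU; elim: n => [//|n IH]; rewrite /=.
under eq_fun do rewrite -mulNr.
by apply: has_radiusD; [exact: has_radius_shift|apply/has_radiusZ/has_radius_shift].
Qed.

Lemma quot_remE N U n w rho : has_radius N rho -> has_radius U rho ->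
  U 0%N != 0 -> modulus w < rho ->
  pseries_sum (quot_rem N U n) w =
  quot_coef N U n * pseries_sum U w + w * pseries_sum (quot_rem N U n.+1) w.
Proof.
move=> hN hU U0 wr; have hr := has_radius_quot_rem n hN hU.
rewrite (pseries_sum_shift hr wr) (pseries_sum_shift hU wr).
have -> : pseries_sum (quot_rem N U n.+1) w =
  pseries_sum (fun k => quot_rem N U n k.+1) w +
  (- quot_coef N U n) * pseries_sum (fun k => U k.+1) w.
  rewrite -(pseries_sumZ _ (has_radius_shift hU) wr).
  rewrite -(pseries_sumD (has_radius_shift hr) _ wr).
    by under [in RHS]eq_fun do rewrite mulNr.
  by apply: has_radiusZ; exact: has_radius_shift.
by rewrite /quot_coef; field.
Qed.

Lemma quot_coef_conv N U n : U 0%N != 0 ->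
  N n = \sum_(k < n.+1) quot_coef N U k * U (n - k)%N.
Proof.
move=> U0.
have key m j : N (m + j)%N = quot_rem N U m j +
    \sum_(k < m) quot_coef N U k * U (m + j - k)%N.
  elim: m j => [|m IH] j; first by rewrite big_ord0 addr0.
  rewrite addSnnS IH big_ord_recr quot_remS /=.
  have -> : (m + j.+1 - m)%N = j.+1 by lia.
  by ring.
have := key n 0%N; rewrite addn0 => ->.
rewrite big_ord_recr /= subnn addrC; congr (_ + _).
by rewrite /quot_coef divfK.
Qed.

(** The functions X n = [quot_rem] n / U are the iterated quotients of N / U. Their bound B (2 /
    rho)^n controls both the coefficients X n 0 and the remainder w^n X n, hence the radius rho /
    2. *)
Lemma pseries_quot N U rho : 0 < rho ->
  (forall r, has_radius N r) -> (forall r, has_radius U r) ->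
  (forall w, modulus w <= rho -> pseries_sum U w != 0) ->
  has_radius (quot_coef N U) (rho / 2) /\
  forall w, modulus w < rho / 2 ->
    pseries_sum N w = pseries_sum (quot_coef N U) w * pseries_sum U w.
Proof.
move=> r0 hN hU U0.
have U00 : U 0%N != 0 by rewrite -pseries_sum0 U0// modulus0 ltW.
pose X n w := pseries_sum (quot_rem N U n) w * (pseries_sum U w)^-1.
have tX n w : modulus w <= rho -> taylor2 (X n) w.
  move=> wr; have wr1 : modulus w < rho + 1 by lra.
  apply: taylor2M.
    exact: taylor2_pseries (has_radius_quot_rem n (hN _) (hU _)) wr1.
  by apply: taylor2V; [exact: U0|exact: taylor2_pseries (hU _) wr1].
have X0 n : X n 0 = quot_coef N U n by rewrite /X !pseries_sum0.
have eX n w : modulus w <= rho -> X n w = X n 0 + w * X n.+1 w.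
  move=> wr; have wr1 : modulus w < rho + 1 by lra.
  rewrite X0 /X (quot_remE n (hN _) (hU _) U00 wr1).
  by field; exact: U0.
have [B B0 bB] := @taylor2_bounded _ (X 0%N) rho (- rho - 1)
  (fun z hz => tX 0%N z (proj1 hz)).
have bX := iterated_quotient_le r0 tX eX (fun w wr => bB w (disc_half_disc wr)).
have hq n : modulus (quot_coef N U n) * (rho / 2) ^+ n <= B.
  have := bX n 0; rewrite modulus0 X0 => /(_ (ltW r0)).
  have -> : (2 / rho) ^+ n = ((rho / 2) ^+ n)^-1 by rewrite -exprVn invf_div.
  by rewrite ler_pdivlMr// exprn_gt0// divr_gt0.
split.
  move=> r r1 r2; exists B => // n; apply: le_trans (hq n).
  by rewrite ler_wpM2l ?modulus_ge0// lerXn2r ?nnegrE//; lra.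
move=> w wr.
have Uw : pseries_sum U w != 0 by apply: U0; lra.
suff : pseries_cvg (quot_coef N U) w (pseries_sum N w / pseries_sum U w).
  by move=> /pseries_cvgE ->; rewrite divfK.
move=> e e0.
have q0 : 0 <= modulus w / (rho / 2) by rewrite divr_ge0 ?modulus_ge0//; lra.
have q1 : modulus w / (rho / 2) < 1 by rewrite ltr_pdivrMr ?mul1r//; lra.
have [M hM] := geometric_small B q0 q1 e0.
exists M => n /hM; apply: le_trans.
have -> : pseries_sum N w / pseries_sum U w - psum (quot_coef N U) w n =
    w ^+ n * X n w.
  elim: n => [|n IH]; first by rewrite psum0 subr0 expr0 mul1r.
  rewrite psumS opprD addrA IH eX ?X0; last by lra.
  by rewrite exprS; ring.
rewrite modulusM modulusX.
have -> : B * (modulus w / (rho / 2)) ^+ n = modulus w ^+ n * (B * (2 / rho) ^+ n).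
  by rewrite -(invf_div rho 2) exprMn; ring.
by rewrite ler_wpM2l ?exprn_ge0 ?modulus_ge0// bX//; lra.
Qed.

End cauchy_estimates.

(** * The logarithm of a zero-free power series *)

Section logarithm.
Context {R : realType}.
Implicit Types (c U : nat -> R[i]) (z w : R[i]) (r rho : R).

Lemma is_derive_quadratic (f : R -> R) (x df d D : R) : 0 < d ->
  (forall h, `|h| <= d -> `|f (x + h) - f x - df * h| <= D * h ^+ 2) ->
  is_derive x 1 f df.
Proof.
move=> d0 H.
have lim : (fun h => h^-1 *: (f (h *: 1 + x) - f x)) @ 0^' --> (df : R).
  apply/cvgrPdist_le => e e0.
  have D1 : 0 < `|D| + 1 by rewrite ltr_pwDr.
  near=> h.
  have h0 : h != 0 by near: h; exact: nbhs_dnbhs_neq.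
  have hd : `|h| <= d.
    near: h; apply: dnbhs0_le; exact: d0.
  have he : `|h| <= e / (`|D| + 1).
    by near: h; apply: dnbhs0_le; rewrite divr_gt0.
  rewrite /GRing.scale /= mulr1 (addrC h) distrC.
  have -> : h^-1 * (f (x + h) - f x) - df = (f (x + h) - f x - df * h) / h.
    by field.
  rewrite normrM normfV ler_pdivrMr ?normr_gt0//.
  apply: (le_trans (H _ hd)); rewrite -real_normK ?num_real// expr2 mulrA.
  rewrite ler_wpM2r//; move: he; rewrite ler_pdivlMr//; apply: le_trans.
  rewrite mulrC ler_wpM2l//; have := ler_norm D; lra.
split; first by apply/cvg_ex; exists df.
exact: cvg_lim lim.
Unshelve. all: by end_near.
Qed.

Lemma pseries_deriv_le c z rho : has_radius c rho -> modulus z < rho ->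
  exists d D : R, 0 < d /\ forall h, modulus h <= d ->
    modulus (pseries_sum c (z + h) - pseries_sum c z -
      pseries_sum (fun n => n.+1%:R * c n.+1) z * h) <= D * modulus h ^+ 2.
Proof.
move=> hc zr; have hd := has_radius_divdiff hc zr.
have [d [D [d0 D0 H]]] := taylor2_lip (taylor2_pseries hd zr).
exists (Num.min d ((rho - modulus z) / 2)), D; split.
  by rewrite lt_min d0; lra.
move=> h; rewrite le_min => /andP[/H hh hr].
have zhr : modulus (z + h) < rho by apply: (le_lt_trans (modulusD _ _)); lra.
rewrite (pseries_sum_deriv hc zr) (divdiffE hc zr zhr).
rewrite [X in modulus X](_ : _ =
  h * (pseries_sum (divdiff c z) (z + h) - pseries_sum (divdiff c z) z)).
  by rewrite modulusM expr2 mulrA mulrC ler_wpM2r ?modulus_ge0.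
move: (pseries_sum c z) (pseries_sum (divdiff c z) _) (pseries_sum _ z) => *.
by ring.
Qed.

(** Applied with p the real or the imaginary part, so that the identity for log U becomes real
    calculus along a ray. *)
Lemma is_derive_ray (p : R[i] -> R) c w rho (s : R) :
  (forall z z', p (z + z') = p z + p z') -> (forall z, p (- z) = - p z) ->
  (forall z (t : R), p (z * t%:C) = p z * t) ->
  (forall z, `|p z| <= modulus z) ->
  has_radius c rho -> modulus (s%:C * w) < rho ->
  is_derive s 1 (fun s => p (pseries_sum c (s%:C * w)))
    (p (pseries_sum (fun n => n.+1%:R * c n.+1) (s%:C * w) * w)).
Proof.
move=> pD pN pZ ple hc wr.
have [d [D [d0 H]]] := pseries_deriv_le hc wr.
have w1 : 0 < modulus w + 1 by have := modulus_ge0 w; lra.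
apply: (@is_derive_quadratic _ _ _ (d / (modulus w + 1)) (D * modulus w ^+ 2)).
  by rewrite divr_gt0.
move=> h; rewrite ler_pdivlMr// => hd.
rewrite rmorphD mulrDl -pZ -!pN -!pD; apply: (le_trans (ple _)).
have := H (h%:C * w); rewrite modulusM modulus_real => /(_ _).
rewrite exprMn real_normK ?num_real// => Hh.
rewrite -(mulrA D) (mulrC (modulus w ^+ 2)) -(mulrA _ w) (mulrC w).
apply: Hh; apply: le_trans hd; rewrite ler_wpM2l//; lra.
Qed.

(** Termwise primitive of U' / U with constant term 0; for U(0) = 1 this is log U, without any
    choice of branch. *)
Definition log_coef U (n : nat) : R[i] :=
  if n is m.+1 then quot_coef (fun k => k.+1%:R * U k.+1) U m / m.+1%:R else 0.

Lemma natrS_neq0 n : (n.+1%:R : R[i]) != 0.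
Proof. by rewrite pnatr_eq0. Qed.

Lemma log_coef_deriv U n :
  n.+1%:R * log_coef U n.+1 = quot_coef (fun k => k.+1%:R * U k.+1) U n.
Proof. by rewrite /log_coef mulrC divfK// natrS_neq0. Qed.

Lemma log_coef_conv U n : U 0%N != 0 -> n.+1%:R * U n.+1 =
  \sum_(k < n.+1) k.+1%:R * log_coef U k.+1 * U (n - k)%N.
Proof.
move=> U0; rewrite (@quot_coef_conv _ (fun k => k.+1%:R * U k.+1) U n U0).
by apply: eq_bigr => k _; rewrite log_coef_deriv.
Qed.

Lemma has_radius_log_coef U rho : 0 < rho ->
  (forall r, has_radius U r) ->
  (forall w, modulus w <= rho -> pseries_sum U w != 0) ->
  has_radius (log_coef U) (rho / 2).
Proof.
move=> r0 hU U0.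
have [hl _] := pseries_quot r0 (fun r => has_radius_deriv (hU r)) hU U0.
move=> r r1 r2; have [B B0 hB] := hl r r1 r2.
exists (B * r); first by rewrite mulr_ge0// ltW.
case=> [|n]; first by rewrite modulus0 mul0r mulr_ge0// ltW.
rewrite exprSr mulrA ler_wpM2r ?(ltW r1)//; apply: le_trans (hB n).
rewrite ler_wpM2r ?exprn_ge0 ?(ltW r1)// modulusM modulusV.
rewrite ler_pdivrMr ?modulus_gt0 ?natrS_neq0// ler_peMr ?modulus_ge0//.
by rewrite -(rmorph_nat (real_complex R)) modulus_real normr_nat ler1n.
Qed.

(* |U|^2 exp(-2 Re phi) is constant along rays. *)
Lemma modulus_expR_log U rho w : 0 < rho -> U 0%N = 1 ->
  (forall r, has_radius U r) ->
  (forall w, modulus w <= rho -> pseries_sum U w != 0) ->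
  modulus w < rho / 2 ->
  modulus (pseries_sum U w) = expR (complex.Re (pseries_sum (log_coef U) w)).
Proof.
move=> r0 U01 hU U0 wr.
have hlog := has_radius_log_coef r0 hU U0.
have [hl lE] := pseries_quot r0 (fun r => has_radius_deriv (hU r)) hU U0.
pose X (s : R) := complex.Re (pseries_sum U (s%:C * w)).
pose Y (s : R) := complex.Im (pseries_sum U (s%:C * w)).
pose P (s : R) := complex.Re (pseries_sum (log_coef U) (s%:C * w)).
pose E (s : R) := (X s ^+ 2 + Y s ^+ 2) * expR (- (2 * P s)).
have E0 : E 0 = 1.
  rewrite /E /X /Y /P mul0r !pseries_sum0 U01 /= mulr0 oppr0 expR0.
  by rewrite expr0n /= expr1n addr0 mulr1.
suff E10 : E 1 = E 0.
  move: E10; rewrite E0 /E /X /Y /P mul1r -sqr_modulus expRN expRM_natl.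
  move=> /divr1_eq/eqP.
  by rewrite eqrXn2 ?modulus_ge0 ?expR_ge0// => /eqP.
have sw (s : R) : 0 <= s -> s <= 1 -> modulus (s%:C * w) < rho / 2.
  move=> s0 s1; rewrite modulusM modulus_real ger0_norm//.
  by apply: le_lt_trans wr; rewrite ler_piMl ?modulus_ge0.
have derE (s : R) : 0 <= s -> s <= 1 -> is_derive s 1 E 0.
  move=> s0 s1; have wrs := sw s s0 s1.
  have dX : is_derive s 1 X _ :=
    is_derive_ray ReD ReN ReMr (@Re_le_modulus R) (hU _) wrs.
  have dY : is_derive s 1 Y _ :=
    is_derive_ray ImD ImN ImMr (@Im_le_modulus R) (hU _) wrs.
  have dP : is_derive s 1 P _ :=
    is_derive_ray ReD ReN ReMr (@Re_le_modulus R) hlog wrs.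
  rewrite /E; apply: is_derive_eq.
  rewrite /GRing.scale /=.
  (* Substituting U' = (U' / U) U makes the derivative of E cancel identically. *)
  rewrite lE//.
  have -> : pseries_sum (fun n => n.+1%:R * log_coef U n.+1) (s%:C * w) =
     pseries_sum (quot_coef (fun k => k.+1%:R * U k.+1) U) (s%:C * w).
    by under eq_fun do rewrite log_coef_deriv.
  rewrite /X /Y; move: (expR _) (pseries_sum U _) => F [v v'].
  move: (pseries_sum (quot_coef _ _) _) => [l l']; move: (w) => [a b] /=.
  by rewrite /GRing.scale /=; ring.
have [||t /andP[t0 t1]] := @MVT R E (fun=> 0) 0 1 ltr01.
- by move=> s; rewrite in_itv /= => /andP[s0 s1]; apply: derE; exact: ltW.
- apply: continuous_in_subspaceT => s; rewrite inE /= in_itv /= => /andP[s0 s1].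
  have := derE s s0 s1; move=> [/derivable1_diffP/differentiable_continuous //].
by rewrite mul0r => /eqP; rewrite subr_eq0 => /eqP.
Qed.

End logarithm.

(** * The Borel-Caratheodory inequality *)

Section borel_caratheodory.
Context {R : realType}.
Implicit Types (c d U : nat -> R[i]) (z w : R[i]) (r rho A : R).

(* Schwarz's lemma for phi / (2A - phi), which is bounded by 1 because
   Re phi <= A. *)
Lemma log_coef_le U rho A w : 0 < rho -> 0 < A -> U 0%N = 1 ->
  (forall r, has_radius U r) ->
  (forall w, modulus w <= rho -> pseries_sum U w != 0) ->
  (forall w, modulus w <= rho -> modulus (pseries_sum U w) <= expR A) ->
  modulus w <= rho / 8 ->
  modulus (pseries_sum (log_coef U) w) <= 16 * A * modulus w / rho.
Proof.
move=> r0 A0 U01 hU U0 bU wr.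
have hlog := has_radius_log_coef r0 hU U0.
set phi := pseries_sum (log_coef U).
have phi_le z : modulus z <= rho / 4 -> complex.Re (phi z) <= A.
  move=> zr; rewrite -ler_expR -(modulus_expR_log r0 U01 hU U0) ?bU//; lra.
pose psi := pseries_sum (fun n => log_coef U n.+1).
have phiE z : modulus z <= rho / 4 -> phi z = z * psi z.
  by move=> zr; rewrite /phi (pseries_sum_shift hlog) ?add0r//; lra.
have denom z : modulus z <= rho / 4 ->
    modulus (phi z) <= modulus (2 * A%:C - phi z) /\ 2 * A%:C - phi z != 0.
  move=> /phi_le; case: (phi z) => x y; rewrite [complex.Re _]/= => xA.
  have e : 2 * A%:C - (x +i* y) = (2 * A - x) +i* (- y).
    by apply/eqP; rewrite eq_complex /=; apply/andP; split; apply/eqP; ring.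
  rewrite e; split.
    rewrite -(@ler_pXn2r _ 2)// ?nnegrE ?modulus_ge0// !sqr_modulus /=.
    by rewrite sqrrN lerD2r !expr2; have := mulr_ge0 (ltW A0) (_ : 0 <= A - x); nra.
  by rewrite eq_complex negb_and /=; apply/orP; left; apply/eqP; lra.
(* phi / (2A - phi) divided by z. The radius rho / 4 lies inside rho / 2, where the series of the
   logarithm is controlled. *)
pose G z := psi z * (2 * A%:C - phi z)^-1.
have bG z : modulus z <= rho / 4 -> modulus (G z) <= 4 / rho.
  move: z; apply: maximum_modulus_disc => z zr.
    have zr2 : modulus z < rho / 2 by lra.
    apply: taylor2M; first exact: taylor2_pseries (has_radius_shift hlog) zr2.
    apply: taylor2V; first by case: (denom z zr).
    have -> : (fun z => 2 * A%:C - phi z) = (fun z => 2 * A%:C + (-1) * phi z).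
      by apply/funext => x; rewrite mulN1r.
    apply: taylor2D; first exact: taylor2_cst.
    by apply: taylor2M; [exact: taylor2_cst|exact: taylor2_pseries hlog zr2].
  have zr' : modulus z <= rho / 4 by lra.
  have [d1 d2] := denom z zr'.
  rewrite /G modulusM modulusV ler_pdivrMr ?modulus_gt0//.
  move: d1; rewrite {1}phiE// modulusM zr.
  by rewrite -ler_pdivlMl ?divr_gt0// invf_div.
have wr4 : modulus w <= rho / 4 by lra.
have [_ d2] := denom w wr4; have := bG w wr4.
rewrite /G modulusM modulusV ler_pdivrMr ?modulus_gt0// => h1.
have mphi : modulus (phi w) = modulus w * modulus (psi w) by rewrite phiE// modulusM.
have h2 : modulus (2 * A%:C - phi w) <= 2 * A + modulus (phi w).
  apply: (le_trans (modulusB _ _)); rewrite lerD2r modulusM modulus_real gtr0_norm//.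
  by rewrite -(rmorph_nat (real_complex R)) modulus_real normr_nat.
have w0 := modulus_ge0 w; have p0 := modulus_ge0 (phi w).
set t := modulus w / rho.
have t0 : 0 <= t by rewrite /t divr_ge0// ltW.
have t1 : t <= 1 / 8 by rewrite /t ler_pdivrMr//; lra.
(* The bound involves |phi| itself; t <= 1/8 lets half of |phi| be absorbed, whence 16 A t. *)
have h3 : modulus (phi w) <= 4 * t * (2 * A + modulus (phi w)).
  rewrite mphi; apply: le_trans (ler_wpM2l w0 (le_trans h1 (ler_wpM2l _ h2))) _.
    by rewrite divr_ge0// ltW.
  by rewrite -mphi /t le_eqVlt; apply/orP; left; apply/eqP; field; rewrite gt_eqF.
have -> : 16 * A * modulus w / rho = 16 * A * t by rewrite /t; ring.
have : t * modulus (phi w) <= 1 / 8 * modulus (phi w) by rewrite ler_wpM2r.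
lra.
Qed.

(** In (m+1) U_(m+1) = sum (k+1) l_(k+1) U_(m-k), with l the coefficients of log U, the weights k+1
    are at most m+1; hence |U_(m+1)| <= eta (|U_0| + ... + |U_m|), and these sums at most double at
    each step. *)
Lemma log_coef_small U (eta : R) n : U 0%N = 1 -> 0 <= eta -> eta <= 1 ->
  (forall k, modulus (log_coef U k.+1) <= eta) ->
  modulus (U n.+1) <= eta * 2 ^+ n.
Proof.
move=> U01 e0 e1 bl.
have step m : modulus (U m.+1) <= eta * \sum_(k < m.+1) modulus (U k).
  have : modulus (m.+1%:R * U m.+1) <=
      \sum_(k < m.+1) m.+1%:R * (eta * modulus (U (m - k)%N)).
    rewrite log_coef_conv ?U01 ?oner_neq0//; apply: (le_trans (modulus_sum _)).
    apply: ler_sum => k _; rewrite modulusM mulrA ler_wpM2r ?modulus_ge0//.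
    rewrite modulusM ler_pM ?modulus_ge0//.
    by rewrite -(rmorph_nat (real_complex R)) modulus_real normr_nat ler_nat ltnS -ltnS.
  rewrite modulusM -(rmorph_nat (real_complex R)) modulus_real normr_nat.
  rewrite -mulr_sumr ler_pM2l ?ltr0Sn// => /le_trans; apply.
  rewrite -mulr_sumr ler_wpM2l// (reindex_inj rev_ord_inj) /=.
  by apply: ler_sum => k _; rewrite subSS subKn// -ltnS.
have sum_le m : \sum_(k < m.+1) modulus (U k) <= 2 ^+ m.
  elim: m => [|m IH]; first by rewrite big_ord_recr big_ord0 /= add0r U01 modulus1.
  rewrite big_ord_recr /= exprS mulr_natl mulr2n lerD//.
  apply: (le_trans (step m)); apply: le_trans IH.
  by rewrite ler_piMl// sumr_ge0// => k _; exact: modulus_ge0.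
by apply: (le_trans (step n)); rewrite ler_wpM2l.
Qed.

End borel_caratheodory.

(** * Zeros and growth *)

Section zeros_of_power_series.
Context {R : realType}.
Implicit Types (c d : nat -> R[i]) (z w : R[i]) (s : seq R) (x rho : R).

Definition root_prod s w : R[i] := \prod_(x <- s) (1 - w / x%:C).

(* The coefficients of (1 - w / x) d(w). *)
Definition root_factor x d (n : nat) : R[i] :=
  d n - (if n is m.+1 then d m / x%:C else 0).

(** A quadratic bound instead of a vanishing derivative: it follows from two factors that are each
    O(h), and it is transported easily through w = z^2. *)
Definition double_zero c z : Prop := exists d D : R, 0 < d /\
  forall h, modulus h <= d -> modulus (pseries_sum c (z + h)) <= D * modulus h ^+ 2.

Lemma realC_eq0 x : (x%:C == 0 :> R[i]) = (x == 0).
Proof. by rewrite -modulus_eq0 modulus_real normr_eq0. Qed.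

Lemma pseries_div_zero c x : x != 0 -> (forall r, has_radius c r) ->
  pseries_sum c x%:C = 0 -> exists d, [/\ forall r, has_radius d r,
    forall w, pseries_sum c w = (1 - w / x%:C) * pseries_sum d w &
    c = root_factor x d].
Proof.
move=> x0 hc cx; have xC0 : x%:C != 0 :> R[i] by rewrite realC_eq0.
have hD r : has_radius (divdiff c x%:C) r.
  apply: (@has_radiusW _ _ (Num.max r (`|x| + 1))); first by rewrite le_max lexx.
  apply: has_radius_divdiff (hc _) _.
  by rewrite modulus_real lt_max; apply/orP; right; lra.
(* c(w) = (w - x) D(w) = (1 - w / x) (- x D(w)), with D the divided difference at x. *)
exists (fun n => - x%:C * divdiff c x%:C n); split.
- by move=> r; exact: has_radiusZ.
- move=> w; pose r := `|x| + modulus w + 1.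
  have w0 := modulus_ge0 w; have x1 := normr_ge0 x.
  have wr : modulus w < r by rewrite /r; lra.
  have xr : modulus x%:C < r by rewrite modulus_real /r; lra.
  rewrite (pseries_sumZ _ (hD r) wr) (divdiffE (hc r) xr wr) cx add0r.
  by field.
apply/funext => -[|n]; rewrite /root_factor.
  rewrite subr0; have xr : modulus x%:C < `|x| + 1 by rewrite modulus_real; lra.
  have := pseries_sum_shift (hc _) xr; rewrite cx => /esym/eqP.
  by rewrite addr_eq0 => /eqP ->; rewrite mulNr.
have xr : modulus x%:C < `|x| + 1 by rewrite modulus_real; lra.
by rewrite (divdiffS n (hc _) xr); field.
Qed.

Lemma root_prod_cons x s w : root_prod (x :: s) w = (1 - w / x%:C) * root_prod s w.
Proof. by rewrite /root_prod big_cons. Qed.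

(** The factorization is recorded for coefficients too, where the nonvanishing of c_n is read
    off. *)
Lemma pseries_div_zeros c s : (forall r, has_radius c r) -> uniq s ->
  (forall x, x \in s -> 0 < x /\ pseries_sum c x%:C = 0) ->
  exists d, [/\ forall r, has_radius d r,
    forall w, pseries_sum c w = root_prod s w * pseries_sum d w &
    c = foldr root_factor d s].
Proof.
elim: s c => [|x s IH] c hc /=.
  move=> _ _; exists c; split => // w; first by rewrite /root_prod big_nil mul1r.
move=> /andP[xs us] H; have [x0 cx] := H x (mem_head _ _).
have [d [hd dE cE]] := pseries_div_zero (lt0r_neq0 x0) hc cx.
have [y ys|e [he eE fE]] := IH d hd us.
  have [y0 cy] := H y ltac:(by rewrite inE ys orbT); split; first exact: y0.
  have yx : y != x by apply: contraNneq xs => <-.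
  move: cy; rewrite dE => /eqP; rewrite mulf_eq0 => /orP[|/eqP dy]; last exact: dy.
  have xC0 : x%:C != 0 :> R[i] by rewrite realC_eq0 gt_eqF.
  rewrite subr_eq0 => /eqP e1.
  have e2 : y%:C = x%:C :> R[i] by rewrite -[LHS](divfK xC0) -e1 mul1r.
  have yxE : y = x by have := @complexI R y x e2.
  by move: yx; rewrite yxE eqxx.
exists e; split; [exact: he| |by rewrite cE fE].
by move=> w; rewrite dE eE root_prod_cons mulrA.
Qed.

Lemma root_prod0 s : root_prod s 0 = 1.
Proof. by rewrite /root_prod big1// => x _; rewrite mul0r subr0. Qed.

Lemma modulus_root_prod s w :
  modulus (root_prod s w) = \prod_(x <- s) modulus (1 - w / x%:C).
Proof.
elim: s => [|x s IH]; first by rewrite /root_prod !big_nil modulus1.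
by rewrite root_prod_cons modulusM IH big_cons.
Qed.

Lemma modulus_root_prod_ge s w rho (q : R) : 0 <= q ->
  (forall x, x \in s -> 0 < x /\ x <= rho) -> (q + 1) * rho <= modulus w ->
  q ^+ size s <= modulus (root_prod s w).
Proof.
move=> q0 + wr; rewrite modulus_root_prod.
elim: s => [_|x s IH H]; first by rewrite big_nil expr0.
rewrite big_cons exprS ler_pM ?exprn_ge0//; last first.
  by apply: IH => y ys; apply: H; rewrite inE ys orbT.
have [x0 xr] := H x (mem_head _ _).
rewrite modulusBC; apply: le_trans (modulus_lB _ _).
rewrite modulus1 modulusM modulusV modulus_real gtr0_norm// lerBrDr ler_pdivlMr//.
by apply: le_trans wr; rewrite ler_wpM2l//; lra.
Qed.

Lemma root_prod_neg s (t : R) :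
  root_prod s (- t)%:C = (\prod_(x <- s) (1 + t / x))%:C.
Proof.
rewrite rmorph_prod; apply: eq_bigr => x _.
by rewrite rmorphN mulNr opprK rmorphD rmorph1 rmorphM fmorphV.
Qed.

Lemma modulus_root_prod_le s w : (forall x, x \in s -> 0 < x) ->
  modulus (root_prod s w) <= \prod_(x <- s) (1 + modulus w / x).
Proof.
rewrite modulus_root_prod; elim: s => [_|x s IH H]; first by rewrite !big_nil.
rewrite !big_cons ler_pM ?prodr_ge0 ?modulus_ge0//.
- by move=> y _; exact: modulus_ge0.
- have x0 := H x (mem_head _ _).
  apply: (le_trans (modulusB _ _)).
  by rewrite modulus1 modulusM modulusV modulus_real gtr0_norm.
by apply: IH => y ys; apply: H; rewrite inE ys orbT.
Qed.

Lemma taylor2_root_prod s z : taylor2 (root_prod s) z.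
Proof.
elim: s => [|x s IH].
  rewrite (_ : root_prod [::] = fun=> 1); first exact: taylor2_cst.
  by apply/funext => w; rewrite /root_prod big_nil.
rewrite (_ : root_prod (x :: s) = fun w => (1 + w * (- x%:C^-1)) * root_prod s w).
  apply: taylor2M => //; apply: taylor2D; first exact: taylor2_cst.
  by apply: taylor2M; [exact: taylor2_id|exact: taylor2_cst].
by apply/funext => w; rewrite root_prod_cons mulrN.
Qed.

Lemma taylor2_entire c z : (forall r, has_radius c r) -> taylor2 (pseries_sum c) z.
Proof.
by move=> hc; apply: (taylor2_pseries (hc (modulus z + 1))); lra.
Qed.

(** If d vanished at x, then 1 - w / x and d(w) would both be O(w - x), and c would have a double
    zero. *)
Lemma quotient_at_zero_neq0 c d s x : (forall r, has_radius d r) ->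
  (forall w, pseries_sum c w = root_prod s w * pseries_sum d w) ->
  x \in s -> x != 0 -> ~ double_zero c x%:C -> pseries_sum d x%:C != 0.
Proof.
move=> hd cE xs x0 ndz; apply/eqP => dx; apply: ndz.
have [e1 [D1 [e10 D10 H1]]] := taylor2_lip (taylor2_entire x%:C hd).
have [e2 [D2 [e20 D20 H2]]] := taylor2_lip (taylor2_root_prod (rem x s) x%:C).
pose M := modulus (root_prod (rem x s) x%:C) + D2 * e2.
exists (Num.min e1 e2), (`|x|^-1 * M * D1); split; first by rewrite lt_min e10.
move=> h; rewrite le_min => /andP[/H1 h1 he2]; have h2 := H2 _ he2.
rewrite cE (_ : root_prod s (x%:C + h) = - h / x%:C * root_prod (rem x s) (x%:C + h)).
  rewrite !modulusM modulusV modulusN modulus_real.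
  rewrite [leRHS](_ : _ = modulus h / `|x| * M * (D1 * modulus h)); last by ring.
  rewrite ler_pM ?mulr_ge0 ?invr_ge0 ?modulus_ge0//; last first.
    by rewrite -(subr0 (pseries_sum d _)) -dx.
  rewrite ler_wpM2l ?mulr_ge0 ?invr_ge0 ?modulus_ge0// /M.
  have := modulus_lB (root_prod (rem x s) (x%:C + h)) (root_prod (rem x s) x%:C).
  have := ler_wpM2l D20 he2; lra.
rewrite /root_prod (big_rem x)//=; congr (_ * _).
by field; rewrite realC_eq0.
Qed.

Definition positive_zeros c : Prop :=
  forall z, pseries_sum c z = 0 -> exists2 x : R, 0 < x & z = x%:C.

(** A Jensen argument: on |w| = 3 rho each factor 1 - w / x has modulus at least 2, so dividing out
    N zeros gives |c_0| <= B / 2^N. Without a complete finite list, arbitrarily long lists of zeros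
    would exist. *)
Lemma zeros_seq c rho : 0 < rho -> (forall r, has_radius c r) -> c 0%N != 0 ->
  positive_zeros c ->
  exists s, [/\ uniq s,
    forall x, x \in s -> [/\ 0 < x, x <= rho & pseries_sum c x%:C = 0] &
    forall x, 0 < x -> x <= rho -> pseries_sum c x%:C = 0 -> x \in s].
Proof.
move=> r0 hc c0 pz; apply: contrapT => none.
have [B B0 bB] := @taylor2_bounded _ (pseries_sum c) (3 * rho) (- (3 * rho) - 1)
  (fun z _ => taylor2_entire z hc).
have long n : exists s, [/\ uniq s, size s = n &
    forall x, x \in s -> [/\ 0 < x, x <= rho & pseries_sum c x%:C = 0]].
  elim: n => [|n [s [us sn sz]]]; first by exists [::].
  apply: contrapT => nolong; apply: none; exists s; split => // x x0 xr cx.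
  apply: contrapT => /negP xs; apply: nolong; exists (x :: s).
  split; [by rewrite /= xs us|by rewrite /= sn|].
  by move=> y; rewrite inE => /orP[/eqP->|/sz//]; split.
have [N hN] : exists N, B < modulus (c 0%N) * 2 ^+ N.
  have c00 : 0 < modulus (c 0%N) by rewrite modulus_gt0.
  have [N hN] := geometric_small (B + 1) (q := 1/2) ltac:(lra) ltac:(lra) c00.
  exists N; have := hN N (leqnn N).
  rewrite expr_div_n expr1n mulrA mulr1 ler_pdivrMr ?exprn_gt0//; lra.
have [s [us sN sz]] := long N.
have [x /sz[]//|d [hd dE cE]] := pseries_div_zeros hc us.
have cd0 : c 0%N = d 0%N.
  by rewrite -(pseries_sum0 c) dE root_prod0 mul1r pseries_sum0.
have bd : forall w, modulus w <= 3 * rho -> modulus (pseries_sum d w) <= B / 2 ^+ N.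
  apply: maximum_modulus_disc => [w _|w wr]; first exact: taylor2_entire.
  rewrite ler_pdivlMr ?exprn_gt0//.
  apply: le_trans (bB w (disc_half_disc _)); last by rewrite wr.
  rewrite dE modulusM mulrC ler_wpM2r ?modulus_ge0// -sN.
  by apply: (@modulus_root_prod_ge _ _ rho) => [//|x /sz[]//|]; rewrite wr; lra.
have : modulus (pseries_sum d 0) <= B / 2 ^+ N by apply: bd; rewrite modulus0; lra.
by rewrite pseries_sum0 -cd0 ler_pdivlMr ?exprn_gt0// leNgt hN.
Qed.

End zeros_of_power_series.

(** * Finite Hadamard factorization and nonvanishing coefficients *)

Section minimal_type.
Context {R : realType}.
Implicit Types (c d e : nat -> R[i]) (z w : R[i]) (s t : seq R) (x r eps : R).

(* The variable is w = z^2: as a function of z, the series has exponential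
   type 0. *)
Definition minimal_type c : Prop := forall eps, 0 < eps ->
  exists r0, forall r, r0 <= r -> forall w, modulus w <= r ^+ 2 ->
    modulus (pseries_sum c w) <= modulus (c 0%N) * expR (eps * r).

Lemma zero_free_part c eps : (forall r, has_radius c r) -> c 0%N != 0 ->
  positive_zeros c -> (forall z, ~ double_zero c z) -> minimal_type c ->
  0 < eps -> exists2 r0, 0 < r0 & forall r, r0 <= r -> exists s d,
  [/\ forall rho, has_radius d rho,
      forall w, pseries_sum c w = root_prod s w * pseries_sum d w,
      c = foldr root_factor d s,
      uniq s &
  [/\ forall x, x \in s -> [/\ 0 < x, x <= r ^+ 2 / 4 & pseries_sum c x%:C = 0],
      forall x, 0 < x -> x <= r ^+ 2 / 4 -> pseries_sum c x%:C = 0 -> x \in s,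
      forall w, modulus w <= r ^+ 2 ->
        modulus (pseries_sum d w) <= modulus (c 0%N) * expR (64 * eps * modulus w / r),
      forall w, modulus w <= r ^+ 2 / 32 ->
        modulus (c 0%N) * expR (- (64 * eps * modulus w / r)) <=
          modulus (pseries_sum d w) &
      forall n, modulus (d n.+1) <= modulus (c 0%N) * (128 * eps / r * 2 ^+ n)]].
Proof.
move=> hc c0 pz ndz mt e0; have [r0 hr0] := mt eps e0.
(* r >= 8 gives r^2 / 32 >= 2 and r >= 128 eps gives 128 eps / r <= 1; both serve the bound on the
   coefficients of d. *)
exists (Num.max (Num.max 8 r0) (128 * eps)).
  by rewrite !lt_max; apply/orP; left; apply/orP; left; lra.
move=> r; rewrite !ge_max -andbA => /and3P[r8 r0r reps].
have rgt0 : 0 < r by lra.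
have r2 : 64 <= r ^+ 2.
  have -> : 64 = 8 ^+ 2 :> R by ring.
  by apply: lerXn2r; rewrite ?nnegrE; lra.
pose rho := r ^+ 2 / 4.
have rho0 : 0 < rho by rewrite /rho; lra.
have [s [us sz szc]] := zeros_seq rho0 hc c0 pz.
have [x /sz[]//|d [hd dE fE]] := pseries_div_zeros hc us.
have d0 : d 0%N = c 0%N.
  by rewrite -(pseries_sum0 c) dE root_prod0 mul1r pseries_sum0.
have mc0 : 0 < modulus (c 0%N) by rewrite modulus_gt0.
(* On |w| = r^2 each removed factor has modulus at least 1, so d inherits the bound of c; the
   maximum principle extends it inside. *)
have bd w : modulus w <= r ^+ 2 ->
    modulus (pseries_sum d w) <= modulus (c 0%N) * expR (eps * r).
  move: w; apply: maximum_modulus_disc => [w _|w wr]; first exact: taylor2_entire.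
  apply: le_trans (hr0 r r0r w _); last by rewrite wr.
  rewrite dE modulusM ler_peMl ?modulus_ge0//.
  have := @modulus_root_prod_ge _ s w rho 1 ltac:(lra).
  rewrite expr1n; apply=> [x /sz[]//|]; rewrite wr /rho; lra.
(* A zero of d in this disc is a zero of c, hence in s, and would be double. *)
have zf w : modulus w <= rho -> pseries_sum d w != 0.
  move=> wr; apply/eqP => dw.
  have [x x0 wx] := pz w ltac:(by rewrite dE dw mulr0).
  have xs : x \in s.
    apply: szc; [exact: x0| |by rewrite -wx dE dw mulr0].
    by move: wr; rewrite wx modulus_real gtr0_norm.
  have := quotient_at_zero_neq0 hd dE xs (lt0r_neq0 x0) (@ndz _).
  by rewrite -wx dw eqxx.
pose U n := (c 0%N)^-1 * d n.
have hU rr : has_radius U rr by exact: has_radiusZ.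
have UE w : pseries_sum U w = (c 0%N)^-1 * pseries_sum d w.
  by apply: (pseries_sumZ _ (hd (modulus w + 1))); lra.
have U01 : U 0%N = 1 by rewrite /U d0 mulVf.
have A0 : 0 < eps * r by rewrite mulr_gt0.
have zfU w : modulus w <= rho -> pseries_sum U w != 0.
  by move=> /zf h; rewrite UE mulf_neq0 ?invr_neq0.
have bU w : modulus w <= rho -> modulus (pseries_sum U w) <= expR (eps * r).
  move=> wr; rewrite UE modulusM modulusV mulrC ler_pdivrMr// mulrC bd//.
  by rewrite /rho in wr; lra.
have dU w : modulus (pseries_sum d w) = modulus (c 0%N) * modulus (pseries_sum U w).
  by rewrite -modulusM UE mulVKf.
have r32 : rho / 8 = r ^+ 2 / 32 by rewrite /rho; lra.
have blog w : modulus w <= r ^+ 2 / 32 ->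
    modulus (pseries_sum (log_coef U) w) <= 64 * eps * modulus w / r.
  rewrite -r32 => wr; apply: (le_trans (log_coef_le rho0 A0 U01 hU zfU bU wr)).
  rewrite le_eqVlt; apply/orP; left; apply/eqP; rewrite /rho.
  by field; rewrite gt_eqF.
have elog w : modulus w <= r ^+ 2 / 32 -> modulus (pseries_sum U w) =
    expR (complex.Re (pseries_sum (log_coef U) w)).
  by rewrite -r32 => wr; apply: (modulus_expR_log rho0 U01 hU zfU); lra.
exists s, d; split; [exact: hd|exact: dE|exact: fE|exact: us|split].
- by move=> x /sz.
- exact: szc.
- move=> w wr; have [wr2|wr2] := leP (modulus w) (r ^+ 2 / 32).
    rewrite dU ler_wpM2l ?modulus_ge0// elog// ler_expR.
    apply: le_trans (blog w wr2); apply: le_trans (Re_le_modulus _).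
    exact: ler_norm.
  (* Beyond r^2 / 32 the crude exponent eps r is already below 64 eps |w| / r. *)
  apply: (le_trans (bd w wr)); rewrite ler_wpM2l ?modulus_ge0// ler_expR.
  rewrite ler_pdivlMr//; have := ler_wpM2l (ltW e0) (ltW wr2).
  by have := mulr_ge0 (ltW e0) (modulus_ge0 w); rewrite expr2; lra.
- move=> w wr; rewrite dU ler_wpM2l ?modulus_ge0// elog// ler_expR.
  have := le_trans (Re_le_modulus _) (blog w wr).
  by rewrite ler_norml => /andP[].
move=> n; have -> : d n.+1 = c 0%N * U n.+1 by rewrite /U mulVKf.
rewrite modulusM ler_wpM2l ?modulus_ge0//.
have eta0 : 0 <= 128 * eps / r by apply: divr_ge0; lra.
apply: log_coef_small; [exact: U01|exact: eta0|by rewrite ler_pdivrMr// mul1r|].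
move=> k; have hlog := has_radius_log_coef rho0 hU zfU.
(* The coefficients of the logarithm come with powers of 2 / (rho / 8) <= 1; the first such power
   times 2 eps r is 128 eps / r. *)
have := @pseries_coef_le _ (log_coef U) (rho / 8) (rho / 2) (2 * (eps * r)) k.+1
  ltac:(lra) ltac:(lra) hlog.
have bl w : modulus w <= rho / 8 ->
    modulus (pseries_sum (log_coef U) w) <= 2 * (eps * r).
  rewrite r32 => wr; apply: (le_trans (blog w wr)).
  rewrite ler_pdivrMr//; have := ler_wpM2l (ltW e0) wr.
  by rewrite /rho expr2; lra.
move=> /(_ bl).
have q0 : 0 < rho / 8 by lra.
rewrite -ler_pdivlMr ?exprn_gt0// => /le_trans; apply.
have -> : 2 ^+ k.+1 * (2 * (eps * r)) / (rho / 8) ^+ k.+1 =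
    (2 / (rho / 8)) ^+ k * (128 * eps / r).
  move: (rho / 8) q0 r32 => q q0 qE; rewrite (expr_div_n 2 q) !exprS.
  have -> : 128 * eps / r = 4 * eps * r / q by rewrite qE; field; rewrite gt_eqF.
  by field; rewrite expf_neq0 gt_eqF.
apply: ler_piMl; first exact: eta0.
apply: exprn_ile1; first by rewrite divr_ge0// ltW.
by rewrite ler_pdivrMr// /rho; lra.
Qed.

(** Taken in the reciprocals 1 / x, as they enter the coefficients of [root_prod]. *)
Fixpoint elem_sym s (n : nat) : R :=
  if s is x :: s' then elem_sym s' n + (if n is m.+1 then elem_sym s' m / x else 0)
  else (n == 0%N)%:R.

Lemma root_factor_delta s n : foldr root_factor (fun k => (k == 0%N)%:R) s n =
  (-1) ^+ n * (elem_sym s n)%:C.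
Proof.
elim: s n => [|x s IH] n /=.
  by case: n => [|n]; rewrite ?expr0 ?mul1r ?mulr0// rmorph0 mulr0.
rewrite /root_factor IH rmorphD mulrDr; congr (_ + _).
case: n => [|n]; first by rewrite oppr0 rmorph0 mulr0.
by rewrite IH rmorphM fmorphV exprS mulN1r mulNr mulrA.
Qed.

Lemma root_factorD d e a s : foldr root_factor (fun n => a * d n + e n) s =
  fun n => a * foldr root_factor d s n + foldr root_factor e s n.
Proof.
elim: s => [//|x s /= ->]; apply/funext => -[|n]; rewrite /root_factor.
  by ring.
by ring.
Qed.

(** Multiplication by 1 - w / x enlarges a bound on the first coefficients by at most 1 + 1 / x. *)
Lemma root_factor_small e s n (eta : R) : (forall x, x \in s -> 0 < x) ->
  (forall k, (k <= n)%N -> modulus (e k) <= eta) ->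
  modulus (foldr root_factor e s n) <= eta * \prod_(x <- s) (1 + 1 / x).
Proof.
move=> + he; elim: s n he => [|x s IH] n he sp /=.
  by rewrite big_nil mulr1 he.
have x0 := sp x (mem_head _ _).
have sp' y : y \in s -> 0 < y by move=> ys; apply: sp; rewrite inE ys orbT.
have eta0 : 0 <= eta := le_trans (modulus_ge0 _) (he 0%N (leq0n _)).
have P0 : 0 <= eta * \prod_(y <- s) (1 + 1 / y).
  rewrite mulr_ge0// big_seq prodr_ge0// => y /sp' y0.
  by rewrite addr_ge0// divr_ge0// ltW.
rewrite big_cons div1r mulrCA mulrDl mul1r /root_factor.
apply: (le_trans (modulusB _ _)); apply: lerD; first exact: IH.
case: n he => [|n] he; first by rewrite modulus0 mulr_ge0// invr_ge0 ltW.
rewrite modulusM modulusV modulus_real gtr0_norm// mulrC.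
rewrite ler_wpM2l ?invr_ge0 ?(ltW x0)//; apply: IH => // k kn.
by apply: he; exact: leqW.
Qed.

Lemma elem_sym_ge0 s n : (forall x, x \in s -> 0 < x) -> 0 <= elem_sym s n.
Proof.
elim: s n => [|x s IH] n sp /=; first by rewrite ler0n.
have x0 := sp x (mem_head _ _).
have sp' y : y \in s -> 0 < y by move=> ys; apply: sp; rewrite inE ys orbT.
by rewrite addr_ge0 ?IH//; case: n => // n; rewrite divr_ge0 ?IH// ltW.
Qed.

(** All terms are nonnegative, and one product of n reciprocals of entries at most X is already at
    least X^(-n). *)
Lemma elem_sym_ge s n (X : R) : 0 < X -> (forall x, x \in s -> 0 < x) ->
  (n <= count (fun x => (x <= X)%R) s)%N -> X^-1 ^+ n <= elem_sym s n.
Proof.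
move=> X0; elim: s n => [|x s IH] n sp /=.
  by rewrite leqn0 => /eqP ->; rewrite expr0.
have x0 := sp x (mem_head _ _).
have sp' y : y \in s -> 0 < y by move=> ys; apply: sp; rewrite inE ys orbT.
have p0 m := elem_sym_ge0 m sp'.
case: n => [_|n]; first by rewrite addr0; exact: (IH 0%N).
have [xX|_] := boolP (x <= X); rewrite ?add0n ?add1n => hn; last first.
  by rewrite -[leLHS]addr0 lerD ?IH// divr_ge0// ltW.
rewrite -[leLHS]add0r lerD// exprSr ler_pM ?exprn_ge0 ?invr_ge0 ?(ltW X0)//.
  exact: IH.
by rewrite lef_pV2.
Qed.

(* c_n / c_0 is, up to sign, the limit of the elementary symmetric functions
   of the reciprocals of finitely many zeros. *)
Lemma coef_neq0 c n t : (forall r, has_radius c r) -> c 0%N != 0 ->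
  positive_zeros c -> (forall z, ~ double_zero c z) -> minimal_type c ->
  uniq t -> size t = n ->
  (forall x, x \in t -> 0 < x /\ pseries_sum c x%:C = 0) ->
  c n != 0.
Proof.
move=> hc c0 pz ndz mt ut st tz; apply/eqP => cn.
have [r0 r00 H] := zero_free_part hc c0 pz ndz mt (@ltr01 R).
have [X X0 tX] : exists2 X, 0 < X & forall x, x \in t -> x <= X.
  exists (\sum_(x <- t) `|x| + 1) => [|x xt]; first by rewrite ltr_wpDl// sumr_ge0.
  rewrite (big_rem x)//= -addrA; apply: (le_trans (ler_norm x)).
  by rewrite lerDl addr_ge0// sumr_ge0.
have mc0 : 0 < modulus (c 0%N) by rewrite modulus_gt0.
(* A bound for prod (1 + 1 / x) independent of r: c(-1) is that product times d(-1), and |d(-1)| >=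
   |c_0| e^(-64 / r) with r >= 8. *)
pose K := modulus (pseries_sum c (-1)) / (modulus (c 0%N) * expR (- 8)).
have K0 : 0 <= K by rewrite divr_ge0 ?modulus_ge0// mulr_ge0 ?modulus_ge0 ?expR_ge0.
have Xn : 0 < X^-1 ^+ n by rewrite exprn_gt0 ?invr_gt0.
pose C := 128 * 2 ^+ n * K.
have C0 : 0 <= C by rewrite /C mulr_ge0// mulr_ge0// exprn_ge0.
(* 2 (X + 1) <= r puts all of t below r^2 / 4; the last entry makes the error C / r smaller than
   X^(-n). *)
pose r := Num.max (Num.max r0 8) (Num.max (2 * (X + 1)) ((C + 1) / X^-1 ^+ n)).
have [r1 r2 r3 r4] : [/\ r0 <= r, 8 <= r, 2 * (X + 1) <= r &
    (C + 1) / X^-1 ^+ n <= r].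
  by rewrite /r !le_max !lexx ?orbT.
clearbody r; have rgt0 : 0 < r by lra.
have [s [d [hd dE fE us [sz szc _ dlow dsmall]]]] := H r r1.
have rsq : (2 * (X + 1)) ^+ 2 <= r ^+ 2.
  by apply: lerXn2r; rewrite ?nnegrE; lra.
have rsq8 : 8 ^+ 2 <= r ^+ 2 by apply: lerXn2r; rewrite ?nnegrE; lra.
have ts x : x \in t -> x \in s.
  move=> xt; have [x0 xz] := tz x xt; apply: szc => //.
  apply: (le_trans (tX x xt)); move: rsq; rewrite expr2.
  have := mulr_ge0 (ltW X0) (ltW X0); lra.
have sp x : x \in s -> 0 < x by case/sz.
have d0 : d 0%N = c 0%N.
  by rewrite -(pseries_sum0 c) dE root_prod0 mul1r pseries_sum0.
have es : X^-1 ^+ n <= elem_sym s n.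
  apply: elem_sym_ge => //; rewrite -st -size_filter; apply: uniq_leq_size => // x xt.
  by rewrite mem_filter tX// ts.
(* d is the constant c_0 plus the small part e. If c_n = 0, the symmetric function of the zeros
   equals the contribution of e up to the factor c_0 and a sign. *)
pose e (k : nat) := if k is m.+1 then d m.+1 else 0.
have dsplit : d = fun k => c 0%N * (k == 0%N)%:R + e k.
  by apply/funext => -[|k]; rewrite /e /= ?mulr1 ?mulr0 ?addr0 ?add0r.
pose eta := modulus (c 0%N) * (128 / r * 2 ^+ n).
have he k : (k <= n)%N -> modulus (e k) <= eta.
  case: k => [|k] kn.
    by rewrite modulus0 !mulr_ge0 ?modulus_ge0 ?exprn_ge0 ?invr_ge0 ?(ltW rgt0).
  rewrite /e /=; apply: (le_trans (dsmall k)); rewrite mulr1.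
  rewrite ler_wpM2l ?modulus_ge0// ler_wpM2l ?divr_ge0 ?(ltW rgt0)//.
  by rewrite ler_eXn2l ?ltr1n//; exact: ltnW.
have := root_factor_small sp he.
have -> : foldr root_factor e s n = - (c 0%N * ((-1) ^+ n * (elem_sym s n)%:C)).
  have := congr1 (fun f => f n) fE; rewrite cn {1}dsplit root_factorD.
  by rewrite root_factor_delta => /esym/eqP; rewrite addrC addr_eq0 => /eqP.
rewrite modulusN !modulusM modulusX modulusN modulus1 expr1n mul1r modulus_real.
rewrite ger0_norm ?elem_sym_ge0// /eta -mulrA ler_pM2l// => le1.
have prodK : \prod_(x <- s) (1 + 1 / x) <= K.
  rewrite /K ler_pdivlMr ?mulr_gt0 ?expR_gt0//.
  have -> : (-1 : R[i]) = (- 1)%:C by rewrite rmorphN rmorph1.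
  rewrite dE modulusM root_prod_neg modulus_real.
  apply: ler_pM; rewrite ?mulr_ge0 ?modulus_ge0 ?expR_ge0 ?ler_norm//.
    by rewrite big_seq prodr_ge0// => y /sp y0; rewrite addr_ge0// divr_ge0// ltW.
  have m1 : modulus (- 1)%:C = 1 :> R by rewrite modulus_real normrN normr1.
  have := dlow (- 1)%:C; rewrite m1 !mulr1 => /(_ _).
  move=> h; apply: le_trans (h _); last by lra.
  rewrite ler_wpM2l ?modulus_ge0// ler_expR lerN2 ler_pdivrMr//; lra.
have : X^-1 ^+ n <= 128 / r * 2 ^+ n * K.
  apply: le_trans es _; apply: le_trans le1 _; rewrite ler_wpM2l//.
  by rewrite mulr_ge0 ?exprn_ge0 ?divr_ge0 ?(ltW rgt0).
rewrite (_ : 128 / r * 2 ^+ n * K = C / r); last by rewrite /C; ring.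
rewrite ler_pdivlMr// mulrC => le2; move: r4; rewrite ler_pdivrMr// => r4.
by have := le_trans r4 le2; rewrite gerDl ler10.
Qed.

End minimal_type.

(** * The Phragmen-Lindelof argument *)

Section phragmen_lindelof.
Context {R : realType}.
Implicit Types (c d h k : nat -> R[i]) (z w : R[i]) (s : seq R).

(** e^(x/5) <= 1 / (1 - x/5), and (1 + x)(1 - x/5) >= 1 amounts to x (4 - x) >= 0. The range up to 4
    is that of 4 |z|^2 / r^2 on |z| <= r. *)
Lemma expR_le_1D (x : R) : 0 <= x -> x <= 4 -> expR (x / 5) <= 1 + x.
Proof.
move=> x0 x4; rewrite -[X in expR X]opprK expRN.
have h := expR_ge1Dx (- (x / 5)).
have h1 : 0 < 1 + - (x / 5) by lra.
apply: le_trans (_ : (1 + - (x / 5))^-1 <= _).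
  by rewrite lef_pV2 ?posrE// expR_gt0.
rewrite -[leLHS]mul1r ler_pdivrMr//.
have := mulr_ge0 x0 (_ : 0 <= 4 - x); lra.
Qed.

Lemma modulus_1D_sqr z (r : R) : 0 < r -> 0 <= complex.Re z ->
  1 + 4 * modulus z ^+ 2 / r ^+ 2 <= modulus (1 + (2 / r)%:C * z) ^+ 2.
Proof.
move=> r0; rewrite !sqr_modulus; case: z => x y /= x0.
rewrite !mul0r !subr0 !addr0 add0r.
have : 0 <= x / r by rewrite divr_ge0// ltW.
have -> : 1 + 4 * (x ^+ 2 + y ^+ 2) / r ^+ 2 = 1 + 4 * (x / r) ^+ 2 + 4 * (y / r) ^+ 2.
  by field; rewrite gt_eqF.
have -> : (1 + 2 / r * x) ^+ 2 + (2 / r * y) ^+ 2 =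
    1 + 4 * (x / r) + 4 * (x / r) ^+ 2 + 4 * (y / r) ^+ 2.
  by field; rewrite gt_eqF.
lra.
Qed.

(** The power (1 + 2 z / r)^n replaces exp(2 n z / r), whose modulus is 1 on the imaginary axis: the
    power dominates an exponent of order |z|^2 / r^2 there too, and still grows at most
    exponentially in |z|. *)
Lemma modulus_1D_exp_ge z (r : R) n : 0 < r -> half_disc r 0 z ->
  expR (2 / 5 * n%:R * modulus z ^+ 2 / r ^+ 2) <= modulus (1 + (2 / r)%:C * z) ^+ n.
Proof.
move=> r0 [zr z0].
rewrite -(@ler_pXn2r _ 2)// ?nnegrE ?expR_ge0 ?exprn_ge0 ?modulus_ge0//.
rewrite -expRM_natl -exprM mulnC exprM.
have -> : 2 * (2 / 5 * n%:R * modulus z ^+ 2 / r ^+ 2) =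
    n%:R * (4 * modulus z ^+ 2 / r ^+ 2 / 5) by ring.
rewrite expRM_natl lerXn2r ?nnegrE ?expR_ge0 ?sqr_ge0//.
apply: le_trans (modulus_1D_sqr r0 z0); apply: expR_le_1D.
  by apply: divr_ge0; [apply: mulr_ge0 => //; exact: sqr_ge0|exact: sqr_ge0].
rewrite ler_pdivrMr ?exprn_gt0// ler_wpM2l// lerXn2r// nnegrE ?modulus_ge0//.
exact: ltW.
Qed.

Lemma modulus_1D_exp_le z (r : R) n : 0 < r ->
  modulus (1 + (2 / r)%:C * z) ^+ n <= expR (2 * n%:R * modulus z / r).
Proof.
move=> r0.
have -> : 2 * n%:R * modulus z / r = n%:R * (2 * modulus z / r) by ring.
rewrite expRM_natl lerXn2r ?nnegrE ?modulus_ge0 ?expR_ge0//.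
apply: le_trans (expR_ge1Dx _); apply: (le_trans (modulusD _ _)).
rewrite modulus1 lerD2l modulusM modulus_real gtr0_norm ?divr_gt0//.
by rewrite mulrAC.
Qed.

Lemma modulus_D_real_ge z (t : R) : 0 <= complex.Re z -> 0 <= t ->
  modulus z <= modulus (z + t%:C) /\ t <= modulus (z + t%:C).
Proof.
move=> z0 t0; split.
  rewrite -(@ler_pXn2r _ 2)// ?nnegrE ?modulus_ge0// !sqr_modulus.
  case: z z0 => x y /= x0; rewrite addr0 lerD2r.
  by apply: lerXn2r; rewrite ?nnegrE; lra.
apply: le_trans (Re_le_modulus _); rewrite ReD /=.
by apply: le_trans (ler_norm _); rewrite lerDr.
Qed.

Lemma sqrt_Re_ge0 w : exists2 z, z ^+ 2 = w & 0 <= complex.Re z.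
Proof.
have [h|h] := leP 0 (complex.Re (sqrtc w)).
  by exists (sqrtc w) => //; exact: sqr_sqrtc.
exists (- sqrtc w); first by rewrite sqrrN sqr_sqrtc.
by rewrite ReN oppr_ge0 ltW.
Qed.

(** Maximum principle for the quotient by (1 + 2 z / r)^N. Since 2/5 * 160 = 64, N >= 160 eps r
    makes the power dominate the boundary bound. *)
Lemma half_disc_growth k (r eps kappa T : R) N :
  0 < r -> 0 < T -> 0 <= kappa -> 160 * eps * r <= N%:R ->
  (forall rho, has_radius k rho) ->
  (forall z, half_disc r 0 z -> modulus z = r \/ complex.Re z = 0 ->
    modulus (pseries_sum k (z ^+ 2) * (z / (z + T%:C))) <=
      kappa * expR (64 * eps * modulus z ^+ 2 / r)) ->
  forall z, half_disc r 0 z ->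
    modulus (pseries_sum k (z ^+ 2) * (z / (z + T%:C))) <=
      kappa * expR (2 * N%:R * modulus z / r).
Proof.
move=> r0 T0 k0 hN hk bd z Kz.
have zT x : half_disc r 0 x -> x + T%:C != 0.
  move=> [_ /modulus_D_real_ge/(_ (ltW T0))[_ h]].
  by rewrite -modulus_gt0; apply: lt_le_trans h.
pose K x := (1 + (2 / r)%:C * x) ^+ N.
have K0 x : half_disc r 0 x -> K x != 0.
  move=> Kx; rewrite -modulus_gt0 modulusX.
  by apply: lt_le_trans (modulus_1D_exp_ge N r0 Kx); exact: expR_gt0.
have K0' x : half_disc r 0 x -> 0 < modulus (K x) by move=> /K0; rewrite modulus_gt0.
suff : modulus (pseries_sum k (z ^+ 2) * (z / (z + T%:C)) * (K z)^-1) <= kappa.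
  rewrite modulusM modulusV ler_pdivrMr ?K0'// => /le_trans; apply.
  by rewrite ler_wpM2l// /K modulusX modulus_1D_exp_le.
move: z Kz; apply: maximum_modulus => z Kz.
  apply: taylor2M.
    apply: taylor2M; first by apply: taylor2_comp_sqr; exact: taylor2_entire.
    apply: taylor2M; first exact: taylor2_id.
    apply: taylor2V; first exact: zT.
    by apply: taylor2D; [exact: taylor2_id|exact: taylor2_cst].
  apply: taylor2V; first exact: K0.
  apply: taylor2X; apply: taylor2D; first exact: taylor2_cst.
  by apply: taylor2M; [exact: taylor2_cst|exact: taylor2_id].
move=> /(bd _ Kz) h; rewrite modulusM modulusV ler_pdivrMr ?K0'//.
apply: (le_trans h); rewrite ler_wpM2l// /K modulusX.
apply: le_trans (modulus_1D_exp_ge N r0 Kz); rewrite ler_expR.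
have -> : 64 * eps * modulus z ^+ 2 / r =
    2 / 5 * (160 * eps * r) * (modulus z ^+ 2 / r ^+ 2) by field; rewrite gt_eqF.
by rewrite -(mulrA _ (_ ^+ 2)) ler_wpM2r ?divr_ge0 ?sqr_ge0// ler_wpM2l.
Qed.

Lemma root_prod_le_neg s w : (forall x, x \in s -> 0 < x) ->
  modulus (root_prod s w) <= modulus (root_prod s (- modulus w)%:C).
Proof.
move=> sp; apply: (le_trans (modulus_root_prod_le _ sp)).
by rewrite root_prod_neg modulus_real ler_norm.
Qed.

(* Phragmen-Lindelof for h / c, without lower bounds on c.  For s the zeros of
   c up to r^2 / 4 and h = P_s k, the function k(z^2) is bounded on the boundary
   of the half disc |z| <= r, Re z >= 0 by a power of |1 + 2 z / r| whose
   exponent is small compared with r.  The weight z / (z + T) makes the bound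
   small near 0 as well, at the price of factors 2 on |z| = T. *)
Theorem phragmen_lindelof c h (C : R) :
  (forall r, has_radius c r) -> c 0%N != 0 ->
  positive_zeros c -> (forall z, ~ double_zero c z) -> minimal_type c ->
  (forall r, has_radius h r) ->
  (forall z, pseries_sum c z = 0 -> pseries_sum h z = 0) ->
  (forall w, modulus (pseries_sum h w) <=
    C * modulus (pseries_sum c (- modulus w)%:C)) ->
  (forall kappa : R, 0 < kappa -> exists t0, forall w, t0 <= modulus w ->
    modulus (pseries_sum h w) <= kappa * modulus (pseries_sum c (- modulus w)%:C)) ->
  forall w, pseries_sum h w = 0.
Proof.
move=> hc c0 pz ndz mt hh hz hC hk w0.
have C0 : 0 <= C.
  have := hC 0; rewrite modulus0 oppr0 !pseries_sum0.
  have := modulus_ge0 (h 0%N); have : 0 < modulus (c 0%N) by rewrite modulus_gt0.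
  by move=> m0 h0 h1; have := le_trans h0 h1; rewrite pmulr_lge0.
have mc0 : 0 < modulus (c 0%N) by rewrite modulus_gt0.
pose G w := modulus (pseries_sum c (- modulus w)%:C).
(* The factor 2 comes from the weight on |z| = T, one e from the growth in the half disc, the other
   from the lower bound for d at -|w0|. *)
suff key (kappa : R) : 0 < kappa ->
    modulus (pseries_sum h w0) <= kappa * (2 * expR 1 * expR 1 * G w0).
  apply: modulus_le_eps_eq => e e0; rewrite subr0.
  have G0 : 0 <= 2 * expR 1 * expR 1 * G w0 by rewrite !mulr_ge0 ?expR_ge0 ?modulus_ge0.
  have e1 : 0 < e / (2 * expR 1 * expR 1 * G w0 + 1) by rewrite divr_gt0//; lra.
  apply: (le_trans (key _ e1)); rewrite mulrAC ler_pdivrMr; last by lra.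
  by rewrite ler_wpM2l ?(ltW e0)//; lra.
move=> k0; have [t0 ht0] := hk _ k0.
pose tau := Num.max 1 t0.
have [tau1 tau0] : 1 <= tau /\ t0 <= tau by rewrite /tau !le_max !lexx orbT.
clearbody tau.
(* For |z| < tau the weight is at most tau / T <= kappa / C when C > 0, which turns the crude
   constant C into kappa. *)
pose T := Num.max (Num.max 1 (tau * C / kappa)) (modulus w0).
have [T1 TC Tw] : [/\ 1 <= T, tau * C / kappa <= T & modulus w0 <= T].
  by rewrite /T !le_max !lexx ?orbT.
clearbody T; have T0 : 0 < T by lra.
(* With N <= 160 eps r + 1 and r >= 6 T this gives 2 N T / r <= 1/2 + 1/3, so the growth factor on
   |z| = T is at most e. *)
pose eps := (640 * T)^-1.
have eps0 : 0 < eps by rewrite invr_gt0; lra.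
have epsT : eps * T = 1 / 640 by rewrite /eps; field; rewrite gt_eqF.
clearbody eps.
have [r0 r00 Hr0] := zero_free_part hc c0 pz ndz mt eps0.
have [r1 Hr1] := mt eps eps0.
pose r := Num.max (Num.max r0 r1) (Num.max (6 * T) tau).
have [rr0 rr1 r6 rtau] : [/\ r0 <= r, r1 <= r, 6 * T <= r & tau <= r].
  by rewrite /r !le_max !lexx ?orbT.
clearbody r; have rgt0 : 0 < r by lra.
have [s [d [hd dE fE us [sz szc dup dlow _]]]] := Hr0 r rr0.
have [x /sz[x0 _ /hz]//|k [hk' kE _]] := pseries_div_zeros hh us.
have sp x : x \in s -> 0 < x by case/sz.
have Pneg w : 0 < modulus (root_prod s (- modulus w)%:C).
  rewrite root_prod_neg modulus_real normr_gt0 gt_eqF// big_seq prodr_gt0// => x /sp x0.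
  by rewrite ltr_wpDr// divr_ge0 ?modulus_ge0// ltW.
have [N hN1 hN2] : exists2 N, 160 * eps * r <= N%:R & N%:R <= 160 * eps * r + 1.
  have p0 : 0 <= 160 * eps * r.
    by have := mulr_ge0 (ltW eps0) (ltW rgt0); lra.
  have /andP[b1 b2] := truncn_itv p0.
  exists (Num.truncn (160 * eps * r)).+1; first exact: ltW.
  by rewrite -natr1 lerD2r.
have tau_sq (x : R) : tau <= x -> t0 <= x ^+ 2.
  by move=> tx; rewrite expr2; have := ler_pM (_ : 0 <= 1) (_ : 0 <= tau) tau1 tx; nra.
have bd z : half_disc r 0 z -> modulus z = r \/ complex.Re z = 0 ->
    modulus (pseries_sum k (z ^+ 2) * (z / (z + T%:C))) <=
      kappa * modulus (c 0%N) * expR (64 * eps * modulus z ^+ 2 / r).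
  move=> Kz; have [zr z0] := Kz.
  have [m1 m2] := modulus_D_real_ge z0 (ltW T0).
  have zT0 : 0 < modulus (z + T%:C) := lt_le_trans T0 m2.
  have fz : modulus (z / (z + T%:C)) <= 1.
    by rewrite modulusM modulusV ler_pdivrMr// mul1r.
  have hzb : tau <= modulus z ->
      modulus (pseries_sum h (z ^+ 2)) <= kappa * G (z ^+ 2).
    by move=> tz; apply: ht0; rewrite modulusX tau_sq.
  case=> [zR|zI].
    (* On the arc |P_s(z^2)| >= 1, so k is bounded by h, hence by kappa |c(-r^2)|, which the minimal
       type controls. *)
    have bk : modulus (pseries_sum k (z ^+ 2)) <=
        kappa * modulus (c 0%N) * expR (eps * r).
      have := hzb ltac:(by rewrite zR).
      rewrite kE modulusM => h1.
      have P1 : 1 <= modulus (root_prod s (z ^+ 2)).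
        have := @modulus_root_prod_ge _ s (z ^+ 2) (r ^+ 2 / 4) 1 ltac:(lra).
        rewrite expr1n; apply=> [x /sz[]//|]; rewrite modulusX zR.
        have := sqr_ge0 r; lra.
      apply: le_trans (_ : modulus (root_prod s (z ^+ 2)) *
        modulus (pseries_sum k (z ^+ 2)) <= _).
        by rewrite ler_peMl ?modulus_ge0.
      apply: (le_trans h1); rewrite -mulrA ler_wpM2l ?(ltW k0)//.
      by apply: Hr1 => //; rewrite modulus_real normrN modulusX zR ger0_norm ?sqr_ge0.
    rewrite modulusM; apply: le_trans (ler_pM (modulus_ge0 _) (modulus_ge0 _) bk fz) _.
    rewrite mulr1 ler_wpM2l ?mulr_ge0 ?modulus_ge0 ?(ltW k0)// ler_expR zR.
    rewrite expr2 mulrA mulfK ?gt_eqF//.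
    by rewrite -mulrA; have := mulr_ge0 (ltW eps0) (ltW rgt0); lra.
  (* On the imaginary axis z^2 is where c is evaluated in the bound for h; the common factor P_s
     cancels, leaving the upper bound for d. *)
  have z2 : z ^+ 2 = (- modulus (z ^+ 2))%:C.
    rewrite modulusX sqr_modulus; case: (z) zI => x y /= ->.
    by apply/eqP; rewrite eq_complex /=; apply/andP; split; apply/eqP; ring.
  have hG : modulus (pseries_sum h (z ^+ 2)) * modulus (z / (z + T%:C)) <=
      kappa * G (z ^+ 2).
    have [tz|tz] := leP tau (modulus z).
      apply: le_trans (ler_pM (modulus_ge0 _) (modulus_ge0 _) (hzb tz) fz) _.
      by rewrite mulr1.
    apply: le_trans (ler_pM (modulus_ge0 _) (modulus_ge0 _) (hC _)
      (_ : _ <= tau / T)) _.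
      rewrite modulusM modulusV; apply: ler_pM;
        rewrite ?modulus_ge0 ?invr_ge0 ?modulus_ge0//.
        exact: ltW.
      by rewrite lef_pV2 ?posrE.
    rewrite -/(G _) mulrAC ler_wpM2r ?modulus_ge0//.
    by rewrite mulrA ler_pdivrMr// mulrC (mulrC kappa) -ler_pdivrMr.
  rewrite modulusM -(ler_pM2l (Pneg (z ^+ 2))) -z2 mulrA -modulusM -kE.
  apply: (le_trans hG); rewrite /G -z2 dE modulusM.
  rewrite mulrCA ler_wpM2l ?modulus_ge0// -(mulrA kappa) ler_wpM2l ?(ltW k0)//.
  rewrite -(modulusX z); apply: dup.
  by rewrite modulusX lerXn2r ?nnegrE ?modulus_ge0// ltW.
have gr := half_disc_growth rgt0 T0 (mulr_ge0 (ltW k0) (ltW mc0)) hN1 hk' bd.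
have bk w : modulus w <= T ^+ 2 ->
    modulus (pseries_sum k w) <= 2 * kappa * modulus (c 0%N) * expR 1.
  move: w; apply: maximum_modulus_disc => [w _|w wT]; first exact: taylor2_entire.
  (* Every w has a square root in the right half plane, so one half disc covers the whole circle |w|
     = T^2. *)
  have [z zw z0] := sqrt_Re_ge0 w.
  have zT : modulus z = T.
    apply/eqP; rewrite -(@eqrXn2 _ 2)// ?modulus_ge0 ?(ltW T0)//.
    by rewrite -modulusX zw wT.
  have Kz : half_disc r 0 z by split => //; rewrite zT; lra.
  have := gr z Kz; rewrite zw modulusM.
  have [m1 m2] := modulus_D_real_ge z0 (ltW T0).
  have zT0 : 0 < modulus (z + T%:C) := lt_le_trans T0 m2.
  have half : 1 / 2 <= modulus (z / (z + T%:C)).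
    rewrite modulusM modulusV ler_pdivlMr// zT.
    have := modulusD z T%:C; rewrite modulus_real (gtr0_norm T0) zT; lra.
  have ex : expR (2 * N%:R * modulus z / r) <= expR 1.
    rewrite ler_expR zT ler_pdivrMr// mul1r.
    have := ler_wpM2r (ltW T0) hN2.
    have : 160 * eps * r * T = 160 * (1 / 640) * r by rewrite -epsT; ring.
    lra.
  move=> g1.
  have kc : 0 <= kappa * modulus (c 0%N) by rewrite mulr_ge0// ltW.
  have g2 := le_trans g1 (ler_wpM2l kc ex).
  have g3 := ler_wpM2l (modulus_ge0 (pseries_sum k w)) half.
  lra.
have w0T : modulus w0 <= T ^+ 2.
  by rewrite expr2; have := ler_wpM2l (ltW T0) T1; lra.
rewrite kE modulusM.
apply: le_trans (ler_pM (modulus_ge0 _) (modulus_ge0 _)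
  (root_prod_le_neg w0 sp) (bk w0 w0T)) _.
have Tr : T ^+ 2 <= r ^+ 2 / 32.
  have : (6 * T) ^+ 2 <= r ^+ 2 by rewrite lerXn2r// nnegrE; lra.
  by rewrite exprMn; have := sqr_ge0 T; lra.
(* Back from k to h: |P_s(w0)| <= |P_s(-|w0|)|, and |d(-|w0|)| >= |c_0| / e reconstitutes
   |c(-|w0|)|. *)
have := dlow (- modulus w0)%:C; rewrite modulus_real normrN (ger0_norm (modulus_ge0 _)).
move=> /(_ (le_trans w0T Tr)) dl.
have ex : expR (-1) <= expR (- (64 * eps * modulus w0 / r)).
  rewrite ler_expR lerN2 ler_pdivrMr// mul1r.
  have := ler_wpM2l (ltW eps0) Tw; lra.
have dl2 : modulus (c 0%N) <= expR 1 * modulus (pseries_sum d (- modulus w0)%:C).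
  rewrite -ler_pdivrMl ?expR_gt0// mulrC -expRN.
  by apply: le_trans dl; rewrite ler_wpM2l ?modulus_ge0.
rewrite /G dE modulusM.
set P := modulus (root_prod _ _); set D := modulus (pseries_sum d _) in dl2 *.
rewrite (_ : kappa * _ = P * (2 * kappa * (expR 1 * D) * expR 1)); last by ring.
rewrite ler_wpM2l ?modulus_ge0// ler_wpM2r ?expR_ge0// ler_wpM2l//.
by rewrite mulr_ge0// ltW.
Qed.

End phragmen_lindelof.

(** * Alternating even series *)

Section alternating_even_series.
Context {R : realType}.
Implicit Types (a b : nat -> R) (f g : R[i] -> R[i]) (c h : nat -> R[i])
  (z w : R[i]).

Definition alt_coef a (n : nat) : R[i] := (-1) ^+ n * (a n)%:C.

Lemma modulus_alt_coef a n : modulus (alt_coef a n) = `|a n|.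
Proof. by rewrite modulusM modulusX modulusN modulus1 expr1n mul1r modulus_real. Qed.

Lemma cvg_modulusP (u : nat -> R[i]) (l : R[i]) : u @ \oo --> l ->
  forall e : R, 0 < e -> exists N, forall n, (N <= n)%N -> modulus (l - u n) <= e.
Proof.
move=> /cvgrPdist_le H e e0; have e0' : 0 < e%:C :> R[i] by rewrite ltcR.
have [N _ hN] := H _ e0'; exists N => n /hN /=.
by rewrite modulus_normc lecR.
Qed.

Lemma alternating_even_series_cvg a f z : alternating_even_series a f ->
  pseries_cvg (alt_coef a) (z ^+ 2) (f z).
Proof.
move=> /(_ z)/cvg_modulusP H e /H[N hN]; exists N => n /hN.
rewrite /series /= big_mkord /psum.
by under eq_bigr do rewrite exprM.
Qed.

Lemma has_radius_of_cvg c : (forall w, exists S, pseries_cvg c w S) ->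
  forall rho, has_radius c rho.
Proof.
move=> H rho r r0 _; have [S hS] := H r%:C.
have [N hN] := hS 1 ltr01.
have term n : (N <= n)%N -> modulus (c n) * r ^+ n <= 2.
  move=> Nn; have := hN n Nn; have := hN n.+1 (leqW Nn).
  rewrite psumS => h1 h2.
  have -> : modulus (c n) * r ^+ n = modulus (c n * r%:C ^+ n).
    by rewrite modulusM modulusX modulus_real gtr0_norm.
  rewrite (_ : c n * r%:C ^+ n = (S - psum c r%:C n) -
    (S - (psum c r%:C n + c n * r%:C ^+ n))); last by ring.
  by apply: (le_trans (modulusB _ _)); lra.
have term0 n : 0 <= modulus (c n) * r ^+ n.
  by rewrite mulr_ge0 ?modulus_ge0 ?exprn_ge0 ?ltW.
exists (2 + \sum_(k < N) modulus (c k) * r ^+ k).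
  by rewrite addr_ge0// sumr_ge0.
move=> n; have [nN|nN] := ltnP n N.
  by rewrite (bigD1 (Ordinal nN))//= addrCA lerDl addr_ge0// sumr_ge0.
by apply: (le_trans (term n nN)); rewrite lerDl sumr_ge0.
Qed.

Lemma has_radius_alt a f rho : alternating_even_series a f ->
  has_radius (alt_coef a) rho.
Proof.
move=> fs; apply: has_radius_of_cvg => w; have [z <- _] := sqrt_Re_ge0 w.
by exists (f z); exact: alternating_even_series_cvg.
Qed.

Lemma alternating_even_seriesE a f z : alternating_even_series a f ->
  f z = pseries_sum (alt_coef a) (z ^+ 2).
Proof. by move=> fs; apply/esym/pseries_cvgE/alternating_even_series_cvg. Qed.

Lemma derive1_eq0 f z (d D : R) : f z = 0 -> 0 < d ->
  (forall h : R[i], modulus h <= d -> modulus (f (z + h)) <= D * modulus h ^+ 2) ->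
  derive1 f z = 0.
Proof.
move=> fz d0 H; rewrite /derive1.
have lim : (fun h : R[i] => h^-1 *: (f (h + z) - f z)) @ 0^' --> (0 : R[i]).
  apply/cvgrPdist_le => e e0.
  (* A positive element of [R[i]] is real. *)
  have eE : e = (complex.Re e)%:C.
    have : 0 <= e := ltW e0.
    rewrite lecE /= => /andP[/eqP + _]; by case: (e) => x y /= ->.
  have e0' : 0 < complex.Re e by move: e0; rewrite eE ltcR.
  have D1 : 0 < `|D| + 1 by rewrite ltr_pwDr.
  have d0' : 0 < d%:C :> R[i] by rewrite ltcR.
  have eD0 : 0 < (complex.Re e / (`|D| + 1))%:C :> R[i] by rewrite ltcR divr_gt0.
  near=> h.
  have h0 : h != 0 by near: h; exact: nbhs_dnbhs_neq.
  have hd : modulus h <= d.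
    rewrite -lecR -modulus_normc; near: h; exact: dnbhs0_le.
  have he : modulus h <= complex.Re e / (`|D| + 1).
    rewrite -lecR -modulus_normc; near: h; exact: dnbhs0_le.
  rewrite sub0r normrN fz subr0 /GRing.scale /= modulus_normc eE lecR.
  rewrite modulusM modulusV mulrC ler_pdivrMr ?modulus_gt0//.
  rewrite addrC; apply: (le_trans (H _ hd)); rewrite expr2 mulrA.
  rewrite ler_wpM2r ?modulus_ge0//; move: he; rewrite ler_pdivlMr//; apply: le_trans.
  rewrite mulrC ler_wpM2l ?modulus_ge0//; have := ler_norm D; lra.
exact: cvg_lim lim.
Unshelve. all: by end_near.
Qed.

(** f is even, so a zero at the origin could not be simple. *)
Lemma simple_zeros_coef0 a f : alternating_even_series a f -> simple_zeros f ->
  alt_coef a 0 != 0.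
Proof.
move=> fs fsimple; apply/eqP => a0.
have fE := alternating_even_seriesE _ fs.
have hc rho := @has_radius_alt a f rho fs.
have f0 : f 0 = 0 by rewrite fE expr0n /= pseries_sum0.
have := fsimple 0 f0; move=> /eqP; apply.
have [d [D [d0 D0 H]]] := taylor2_lip (taylor2_entire 0 hc).
apply: (@derive1_eq0 _ _ (Num.min 1 d) D) => //; first by rewrite lt_min ltr01.
move=> x; rewrite le_min => /andP[x1 xd]; rewrite add0r fE.
have := H (x ^+ 2); rewrite add0r pseries_sum0 a0 subr0 modulusX; apply.
apply: le_trans xd; rewrite expr2 ler_piMl ?modulus_ge0//.
Qed.

Lemma real_zeros_positive a f : alternating_even_series a f -> real_zeros f ->
  alt_coef a 0 != 0 -> positive_zeros (alt_coef a).
Proof.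
move=> fs fr a0 w; have [z <- _] := sqrt_Re_ge0 w.
rewrite -(alternating_even_seriesE _ fs) => fz.
have := fr z fz; case: z fz => x y fz /= y0; exists (x ^+ 2).
  rewrite lt_neqAle sqr_ge0 andbT eq_sym sqrf_eq0; apply/eqP => x0.
  move: fz; rewrite (alternating_even_seriesE _ fs) x0 y0.
  have -> : (0 +i* 0 : R[i]) ^+ 2 = 0 by rewrite expr2 mul0r.
  by rewrite pseries_sum0 => /eqP; rewrite (negbTE a0).
by rewrite y0 rmorphXn.
Qed.

(** With y^2 = z one has (y + h)^2 - z = O(h), so a quadratic bound for the series near z gives one
    for f near y. *)
Lemma simple_zeros_no_double a f z : alternating_even_series a f ->
  positive_zeros (alt_coef a) -> simple_zeros f -> ~ double_zero (alt_coef a) z.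
Proof.
move=> fs pz fsimple [d [D [d0 H]]].
have cz : pseries_sum (alt_coef a) z = 0.
  apply/eqP; rewrite -modulus_eq0 eq_le modulus_ge0 andbT.
  have := H 0; rewrite addr0 modulus0 expr0n /= mulr0; apply; exact: ltW.
have [x x0 zx] := pz z cz.
pose y := (Num.sqrt x)%:C : R[i].
have y2 : y ^+ 2 = z by rewrite -rmorphXn /= sqr_sqrtr ?zx// ltW.
have fE := alternating_even_seriesE _ fs.
have fy : f y = 0 by rewrite fE y2.
have := fsimple y fy; move=> /eqP; apply.
have my := modulus_ge0 y.
pose M := 2 * modulus y + 1.
have M0 : 0 < M by rewrite /M; lra.
apply: (@derive1_eq0 _ _ (Num.min 1 (d / M)) (`|D| * M ^+ 2)) => //.
  by rewrite lt_min ltr01 divr_gt0.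
move=> h; rewrite le_min ler_pdivlMr// => /andP[h1 hd].
rewrite fE sqrrD y2 -addrA.
have e : modulus (y * h *+ 2 + h ^+ 2) <= M * modulus h.
  have -> : y * h *+ 2 + h ^+ 2 = (y + y + h) * h by rewrite mulr2n; ring.
  rewrite modulusM ler_wpM2r ?modulus_ge0//.
  apply: (le_trans (modulusD _ _)).
  by have := modulusD y y; rewrite /M; lra.
apply: le_trans (H _ _) _; first by apply: (le_trans e); rewrite mulrC.
rewrite -mulrA -exprMn.
apply: le_trans (_ : `|D| * modulus (y * h *+ 2 + h ^+ 2) ^+ 2 <= _).
  by rewrite ler_wpM2r ?sqr_ge0// ler_norm.
by rewrite ler_wpM2l// lerXn2r ?nnegrE ?modulus_ge0// mulr_ge0 ?modulus_ge0 ?ltW.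
Qed.

Lemma psum_alt_neg a (t : R) n :
  psum (alt_coef a) (- t)%:C n = (\sum_(k < n) a k * t ^+ k)%:C.
Proof.
rewrite rmorph_sum; apply: eq_bigr => k _.
rewrite /alt_coef rmorphN (exprNn t%:C) mulrACA -exprMn mulrN1 opprK expr1n mul1r.
by rewrite rmorphM rmorphXn.
Qed.

(* Both series are compared through their partial sums of sufficiently large
   order. *)
Lemma pseries_sum_dominated h a (C t : R) w N : 0 <= C -> 0 <= t ->
  (forall rho, has_radius h rho) -> (forall rho, has_radius (alt_coef a) rho) ->
  (forall n, 0 <= a n) ->
  (forall n, (N <= n)%N ->
    modulus (psum h w n) <= C * \sum_(k < n) a k * t ^+ k) ->
  modulus (pseries_sum h w) <= C * modulus (pseries_sum (alt_coef a) (- t)%:C).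
Proof.
move=> C0 t0 hh ha a0 H; apply/ler_addgt0Pl => e e0.
have e1 : 0 < e / 2 by lra.
have e2 : 0 < e / 2 / (C + 1) by rewrite divr_gt0//; lra.
have lt1 z : modulus z < modulus z + 1 by lra.
have [N1 h1] := has_radius_sumP (hh _) (lt1 w) e1.
have [N2 h2] := has_radius_sumP (ha _) (lt1 (- t)%:C) e2.
pose n := (N + N1 + N2)%N.
have i1 := h1 n ltac:(rewrite /n; lia).
have i2 := h2 n ltac:(rewrite /n; lia).
have i3 := H n ltac:(rewrite /n; lia).
have i4 := modulus_lB (pseries_sum h w) (psum h w n).
have i5 := modulus_lB (psum (alt_coef a) (- t)%:C n)
  (pseries_sum (alt_coef a) (- t)%:C).
rewrite modulusBC in i5; move: i2 i5; rewrite psum_alt_neg modulus_real.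
have S0 : 0 <= \sum_(k < n) a k * t ^+ k.
  by rewrite sumr_ge0// => k _; rewrite mulr_ge0// exprn_ge0.
rewrite ger0_norm// ler_pdivlMr; last by lra.
move: (modulus_ge0 (pseries_sum (alt_coef a) (- t)%:C -
  (\sum_(k < n) a k * t ^+ k)%:C)).
move: (\sum_(k < n) a k * t ^+ k) (modulus (_ - _)) i3 => S X i3 X0 i2 i5.
move: (modulus (pseries_sum (alt_coef a) _)) (ler_wpM2l C0 i5) => P.
move: (modulus (psum h w n)) (modulus (pseries_sum h w)) (modulus (_ - _))
  i1 i3 i4 => p q v.
clear -e0 C0 X0 i2; lra.
Qed.

Lemma pseries_sum_le_neg h a (C : R) w : 0 <= C ->
  (forall rho, has_radius h rho) -> (forall rho, has_radius (alt_coef a) rho) ->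
  (forall n, 0 <= a n) -> (forall n, modulus (h n) <= C * a n) ->
  modulus (pseries_sum h w) <= C * modulus (pseries_sum (alt_coef a) (- modulus w)%:C).
Proof.
move=> C0 hh ha a0 H.
apply: (@pseries_sum_dominated _ _ _ _ _ 0%N) => //; first exact: modulus_ge0.
move=> n _; apply: (le_trans (modulus_sum _)); rewrite mulr_sumr.
apply: ler_sum => k _; rewrite modulusM modulusX mulrA.
by rewrite ler_wpM2r// exprn_ge0// modulus_ge0.
Qed.

(** At -t all terms are nonnegative, so the maximum modulus on |w| <= t is attained there. *)
Lemma pseries_alt_neg_mono a w (t : R) : modulus w <= t ->
  (forall rho, has_radius (alt_coef a) rho) -> (forall n, 0 <= a n) ->
  modulus (pseries_sum (alt_coef a) w) <=
    modulus (pseries_sum (alt_coef a) (- t)%:C).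
Proof.
move=> wt ha a0; rewrite -[leRHS]mul1r.
have t0 : 0 <= t by apply: le_trans wt; exact: modulus_ge0.
apply: (@pseries_sum_dominated _ _ _ _ _ 0%N) => // n _.
apply: (le_trans (modulus_sum _)); rewrite mul1r.
apply: ler_sum => k _; rewrite modulusM modulus_alt_coef modulusX ger0_norm//.
by rewrite ler_wpM2l// lerXn2r// nnegrE// modulus_ge0.
Qed.

(** Order less than p < 1 gives M(r) <= exp(r^p) for large r, and r^p = o(r). *)
Lemma growth_order_minimal_type a f : alternating_even_series a f ->
  (forall n, 0 <= a n) -> alt_coef a 0 != 0 -> (growth_order f < 1)%E ->
  minimal_type (alt_coef a).
Proof.
move=> fs a0 c0 ford.
have hc rho := @has_radius_alt a f rho fs.
have fE := alternating_even_seriesE _ fs.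
(* The upper limit is an infimum of suprema over neighbourhoods of +oo. One of these suprema is
   below 1; it is not -oo because the neighbourhood is nonempty. *)
have [p p1 [r1 hp]] : exists2 p : R, p < 1 & exists r1, forall r, r1 < r ->
    ln (ln (max_modulus f r)) / ln r <= p.
  move: ford; rewrite /growth_order limf_esupE.
  move=> /ereal_inf_lt[_ [V [r1 [_ hV]] <-]] hlt.
  have nV : V (r1 + 1) by apply: hV; rewrite ltrDl.
  have ub r : r1 < r -> ((ln (ln (max_modulus f r)) / ln r)%:E <=
      ereal_sup [set (ln (ln (max_modulus f r)) / ln r)%:E | r in V])%E.
    by move=> r1r; apply: ereal_sup_ubound; exists r => //; exact: hV.
  move: hlt ub; case: (ereal_sup _) => [p|//|].
  - rewrite lte_fin => p1 ub; exists p => //; exists r1 => r /ub.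
    by rewrite lee_fin.
  - by move=> _ /(_ (r1 + 1)); rewrite ltrDl ltr01 leeNy_eq => /(_ isT).
move=> eps eps0.
(* For r >= e^L one has r^p <= eps r / 2; the other half of eps r absorbs ln |c_0|. *)
pose L := - ln (eps / 2) / (1 - p).
have mc0 : 0 < modulus (alt_coef a 0) by rewrite modulus_gt0.
pose l0 := ln (modulus (alt_coef a 0)).
exists (Num.max (Num.max (r1 + 1) (expR L)) (Num.max (expR 1) (2 / eps * `|l0|))).
move=> r; rewrite !ge_max => /andP[/andP[h1 h2] /andP[h3 h4]] w wr.
have r_ge1 : 1 < r by apply: lt_le_trans h3; rewrite expR_gt1.
have r0 : 0 < r by lra.
have lnr : 0 < ln r by rewrite ln_gt0.
have fir : modulus (f ('i * r%:C)) = modulus (pseries_sum (alt_coef a) (- r ^+ 2)%:C).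
  by rewrite fE exprMn sqr_i mulN1r rmorphN rmorphXn.
have mir : modulus ('i * r%:C : R[i]) = r.
  rewrite modulusM modulus_real gtr0_norm// /modulus /= expr0n /= add0r expr1n sqrtr1.
  by rewrite mul1r.
apply: le_trans (pseries_alt_neg_mono wr hc a0) _.
rewrite -fir; set M := max_modulus f r.
(* Comparison with a [sup] requires boundedness on the circle, supplied by the value on the negative
   axis. *)
have fM : modulus (f ('i * r%:C)) <= M.
  apply: ub_le_sup; last by exists ('i * r%:C).
  exists (modulus (pseries_sum (alt_coef a) (- r ^+ 2)%:C)) => _ [z zr <-].
  by rewrite fE; apply: pseries_alt_neg_mono => //; rewrite modulusX zr.
apply: (le_trans fM).
have le0 : 0 <= l0 + eps * r / 2.
  have := ler_norm (- l0); rewrite normrN => h5.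
  move: h4; rewrite -[2 / eps]invf_div ler_pdivrMl ?divr_gt0//; lra.
have cE : modulus (alt_coef a 0) * expR (eps * r) = expR (l0 + eps * r).
  by rewrite expRD lnK.
rewrite cE.
have epsr : 0 < eps * r by rewrite mulr_gt0.
have [M1|M1] := leP M 1.
  apply: (le_trans M1); rewrite -expR0 ler_expR; lra.
have M0 : 0 < M by lra.
rewrite -[leLHS]lnK ?posrE// ler_expR.
have lnM : 0 < ln M by rewrite ln_gt0.
suff : ln M <= eps * r / 2 by lra.
rewrite -[leLHS]lnK ?posrE//.
have -> : eps * r / 2 = expR (ln (eps / 2) + ln r).
  by rewrite expRD !lnK ?posrE ?divr_gt0//; ring.
rewrite ler_expR.
have := hp r ltac:(lra); rewrite ler_pdivrMr// => h5.
have lL : L <= ln r by rewrite -ler_expR lnK.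
move: lL; rewrite /L ler_pdivrMr; last by lra.
by rewrite -/M in h5; lra.
Qed.

(** A zero x in the variable w accounts only for the two zeros of f with z^2 = x, so a maximal
    finite list would make the zeros of f finite. *)
Lemma many_zeros a f n : alternating_even_series a f ->
  positive_zeros (alt_coef a) -> countably_infinite_zeros f ->
  exists t : seq R, [/\ uniq t, size t = n & forall x, x \in t ->
    0 < x /\ pseries_sum (alt_coef a) x%:C = 0].
Proof.
move=> fs pz finf; elim: n => [|n [t [ut st tz]]]; first by exists [::].
apply: contrapT => none.
apply: infinite_nat; rewrite -(eq_finite_set finf).
pose t' : seq R[i] :=
  [seq (Num.sqrt x)%:C | x <- t] ++ [seq (- Num.sqrt x)%:C | x <- t].
apply: (sub_finite_set _ (finite_seq t')) => z fz.
have fE := alternating_even_seriesE _ fs.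
have cz : pseries_sum (alt_coef a) (z ^+ 2) = 0 by rewrite -fE.
have [x x0 zx] := pz _ cz.
have xt : x \in t.
  apply: contrapT => /negP xt; apply: none; exists (x :: t).
  split; [by rewrite /= xt ut|by rewrite /= st|].
  move=> y; rewrite inE => /orP[/eqP->|/tz//].
  by split; [exact: x0|rewrite -zx].
have : z ^+ 2 == (Num.sqrt x)%:C ^+ 2.
  by rewrite zx -rmorphXn /= sqr_sqrtr// ltW.
rewrite eqf_sqr /= mem_cat => /orP[/eqP->|/eqP->]; apply/orP.
  by left; apply/mapP; exists x.
by right; apply/mapP; exists x => //; rewrite rmorphN.
Qed.

Lemma alternating_coef_gt0 a f n : alternating_even_series a f ->
  (forall n, 0 <= a n) -> real_zeros f -> simple_zeros f ->
  countably_infinite_zeros f -> (growth_order f < 1)%E -> 0 < a n.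
Proof.
move=> fs a0 fr fsi finf ford.
have c0 := simple_zeros_coef0 fs fsi.
have pz := real_zeros_positive fs fr c0.
have [t [ut st tz]] := many_zeros n fs pz finf.
have := coef_neq0 (fun r => @has_radius_alt a f r fs) c0 pz
  (fun z => @simple_zeros_no_double a f z fs pz fsi)
  (growth_order_minimal_type fs a0 c0 ford) ut st tz.
rewrite -modulus_gt0 modulus_alt_coef normr_gt0 => an.
by rewrite lt_neqAle eq_sym an a0.
Qed.

(* |h_n| <= C a_n with a_n = o(b_n): the finitely many indices at which
   C a_n > (kappa / 2) b_n contribute O(G(t) / t), since some later b_n is
   positive. *)
Lemma pseries_sum_negligible h a b (C kappa : R) : 0 <= C -> 0 < kappa ->
  (forall rho, has_radius h rho) -> (forall rho, has_radius (alt_coef b) rho) ->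
  (forall n, 0 < b n) -> (forall n, modulus (h n) <= C * a n) ->
  (fun n => a n / b n) @ \oo --> (0 : R) ->
  exists t0, forall w, t0 <= modulus w -> modulus (pseries_sum h w) <=
    kappa * modulus (pseries_sum (alt_coef b) (- modulus w)%:C).
Proof.
move=> C0 k0 hh hb b0 hC ab.
have e0 : 0 < kappa / 2 / (C + 1) by rewrite divr_gt0//; lra.
move/cvgrPdist_le : ab => /(_ _ e0)[N _ hN].
have small n : (N <= n)%N -> modulus (h n) <= kappa / 2 * b n.
  move=> /hN /=; rewrite sub0r normrN => h1.
  have h2 : a n <= kappa / 2 / (C + 1) * b n.
    by rewrite -ler_pdivrMr//; apply: le_trans h1; exact: ler_norm.
  apply: (le_trans (hC n)); apply: le_trans (ler_wpM2l C0 h2) _.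
  rewrite mulrA ler_wpM2r ?(ltW (b0 n))//.
  rewrite mulrCA ler_piMr//; first by lra.
  by rewrite ler_pdivrMr; lra.
pose B := \sum_(k < N) modulus (h k).
have B0 : 0 <= B by rewrite sumr_ge0// => k _; exact: modulus_ge0.
(* For t >= 1 the first N terms sum to at most B t^(N-1), and this threshold puts that below (kappa
   / 2) b_N t^N. *)
exists (Num.max 1 (2 * B / (kappa * b N))) => w; rewrite ge_max => /andP[w1 wB].
set t := modulus w in w1 wB *.
apply: (@pseries_sum_dominated _ _ _ _ _ N.+1) => //; try lra.
  by move=> n; exact: ltW.
move=> n Nn; apply: (le_trans (modulus_sum _)).
have tN : 0 < t ^+ N by rewrite exprn_gt0//; lra.
have head : \sum_(k < N) modulus (h k * w ^+ k) <= kappa / 2 * (b N * t ^+ N).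
  apply: le_trans (_ : \sum_(k < N) modulus (h k) * (t ^+ N / t) <= _).
    apply: ler_sum => k _; rewrite modulusM modulusX ler_wpM2l ?modulus_ge0//.
    rewrite ler_pdivlMr; last by lra.
    by rewrite -exprSr ler_weXn2l.
  rewrite -mulr_suml -/B mulrA ler_pdivrMr; last by lra.
  rewrite (_ : kappa / 2 * _ * t = (kappa * b N / 2 * t) * t ^+ N); last by ring.
  rewrite ler_wpM2r ?(ltW tN)//.
  move: wB; rewrite ler_pdivrMr ?mulr_gt0//; lra.
rewrite -(big_mkord xpredT (fun k => modulus (h k * w ^+ k))).
rewrite -(big_mkord xpredT (fun k => b k * t ^+ k)).
rewrite (big_cat_nat (n := N))//=; last exact: ltnW.
rewrite [in leRHS](big_cat_nat (n := N))//=; last exact: ltnW.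
have tail : \sum_(N <= k < n) modulus (h k * w ^+ k) <=
    kappa / 2 * \sum_(N <= k < n) b k * t ^+ k.
  rewrite mulr_sumr; apply: ler_sum_nat => k /andP[Nk _].
  rewrite modulusM modulusX mulrA ler_wpM2r ?exprn_ge0 ?modulus_ge0//.
  exact: small.
have bt k : 0 <= b k * t ^+ k by rewrite mulr_ge0 ?(ltW (b0 _))// exprn_ge0//; lra.
have bNle : b N * t ^+ N <= \sum_(N <= k < n) b k * t ^+ k.
  by rewrite big_ltn// lerDl sumr_ge0.
have : 0 <= \sum_(0 <= k < N) b k * t ^+ k by rewrite sumr_ge0.
rewrite big_mkord; move: head tail bNle.
set H := \sum_(k < N) _; set X := \sum_(N <= k < n) _; set Y := \sum_(N <= k < n) _.
set Z := \sum_(0 <= k < N) _ => i1 i2 i3 i4.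
have k2 : 0 <= kappa / 2 by lra.
have := ler_wpM2l k2 i3; have := ler_wpM2l (ltW k0) i4; lra.
Qed.

End alternating_even_series.

(** * Vanishing even moments *)

Section vanishing_moments.
Context {R : realType}.

Lemma bernoulli_ineq (t : R) n : -1 <= t -> 1 + n%:R * t <= (1 + t) ^+ n.
Proof.
move=> t1; elim: n => [|n IH]; first by rewrite mul0r addr0 expr0.
rewrite exprS -natr1.
have h : 0 <= 1 + t by lra.
apply: le_trans (ler_wpM2l h IH).
have : 0 <= n%:R * (t * t) by rewrite mulr_ge0// -expr2 sqr_ge0.
by lra.
Qed.

(** Bernoulli bounds the distance to 1 by n (2q)^n. With 2q < s < 1, n s^n stays bounded and (2q /
    s)^n tends to 0. *)
Lemma step_approx_lt (q : R) : 0 <= q -> q < 1 / 2 ->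
  (fun n => (1 - q ^+ n) ^+ (n * 2 ^ n)) @ \oo --> (1 : R).
Proof.
move=> q0 q1; apply/cvgrPdist_le => e e0.
pose s := (2 * q + 1) / 2.
have [s0 s1 qs] : [/\ 0 < s, s < 1 & 2 * q < s] by rewrite /s; split; lra.
clearbody s.
have r0 : 0 <= 2 * q / s by rewrite divr_ge0//; lra.
have r1 : 2 * q / s < 1 by rewrite ltr_pdivrMr// mul1r.
have [N hN] := geometric_small (1 - s)^-1 r0 r1 e0.
exists N => // n /= /hN hn.
have qn0 : 0 <= q ^+ n by rewrite exprn_ge0.
have qn1 : q ^+ n <= 1 by rewrite exprn_ile1//; lra.
have up : (1 - q ^+ n) ^+ (n * 2 ^ n) <= 1 by rewrite exprn_ile1//; lra.
rewrite ger0_norm; last by lra.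
have := @bernoulli_ineq (- q ^+ n) (n * 2 ^ n) ltac:(lra).
have : (n * 2 ^ n)%:R * q ^+ n <= e.
  apply: le_trans hn.
  rewrite [leLHS](_ : _ = (n%:R * s ^+ n) * (2 * q / s) ^+ n).
    by rewrite ler_wpM2r ?exprn_ge0// natmul_expr_le// ltW.
  rewrite natrM natrX expr_div_n exprMn.
  by field; rewrite expf_neq0// gt_eqF.
lra.
Qed.

(** (1 - q^n)^m (1 + q^n)^m <= 1, while by Bernoulli the second power is at least m q^n = n (2q)^n
    >= n. The factor n in the exponent m = n 2^n includes the case q = 1/2. *)
Lemma step_approx_ge (q : R) : 1 / 2 <= q -> q <= 1 ->
  (fun n => (1 - q ^+ n) ^+ (n * 2 ^ n)) @ \oo --> (0 : R).
Proof.
move=> q0 q1; apply/cvgrPdist_le => e e0.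
have [N hN] : exists N : nat, e^-1 <= N%:R.
  exists (Num.truncn e^-1).+1.
  have e1 : 0 <= e^-1 by rewrite invr_ge0 ltW.
  by have /andP[_ /ltW] := truncn_itv e1.
exists N => // n /= Nn.
have q00 : 0 <= q by lra.
have qn0 : 0 <= q ^+ n by rewrite exprn_ge0.
have qn1 : q ^+ n <= 1 by rewrite exprn_ile1.
have p0 : 0 <= (1 - q ^+ n) ^+ (n * 2 ^ n) by rewrite exprn_ge0//; lra.
rewrite sub0r normrN ger0_norm//.
have b := @bernoulli_ineq (q ^+ n) (n * 2 ^ n) ltac:(lra).
have n1 : n%:R <= (n * 2 ^ n)%:R * q ^+ n.
  rewrite natrM natrX -mulrA -exprMn -[leLHS]mulr1 ler_wpM2l//.
  by rewrite exprn_ege1//; lra.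
have big : e^-1 <= (1 + q ^+ n) ^+ (n * 2 ^ n).
  apply: le_trans b; apply: (le_trans hN); apply: le_trans (_ : n%:R <= _).
    by rewrite ler_nat.
  by lra.
have prod1 : (1 - q ^+ n) ^+ (n * 2 ^ n) * (1 + q ^+ n) ^+ (n * 2 ^ n) <= 1.
  rewrite -exprMn exprn_ile1//.
    by rewrite mulr_ge0//; lra.
  by have := sqr_ge0 (q ^+ n); rewrite expr2; lra.
have ei : 0 < e^-1 by rewrite invr_gt0.
have : (1 - q ^+ n) ^+ (n * 2 ^ n) * e^-1 <= 1.
  by apply: le_trans prod1; rewrite ler_wpM2l.
by rewrite ler_pdivrMr// mul1r.
Qed.

Context d (T : measurableType d) (mu : {measure set T -> \bar R}) (D : set T).
Hypothesis mD : measurable D.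
Context (y : T -> R).
Hypothesis iy : mu.-integrable D (EFin \o y).

Lemma integrable_mul_bounded (phi : T -> R) (M : R) : measurable_fun D phi ->
  (forall x, D x -> `|phi x| <= M) ->
  mu.-integrable D (EFin \o (fun x => y x * phi x)).
Proof.
move=> mphi bphi.
have -> : EFin \o (fun x => y x * phi x) = ((EFin \o y) \* (EFin \o phi))%E.
  by apply/funext => x /=; rewrite EFinM.
apply: integrableMl => //.
exists M; split; first exact: num_real.
by move=> N MN x Dx; apply: le_trans (ltW MN); exact: bphi.
Qed.

Lemma cvg_Rintegral_bounded (phi_ : nat -> T -> R) (phi : T -> R) (M : R) :
  (forall n, measurable_fun D (phi_ n)) ->
  (forall n x, D x -> `|phi_ n x| <= M) ->
  (forall x, D x -> phi_ ^~ x @ \oo --> phi x) ->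
  (fun n => \int[mu]_(x in D) (y x * phi_ n x)) @ \oo -->
    \int[mu]_(x in D) (y x * phi x).
Proof.
move=> mphi bphi cphi.
have my : measurable_fun D y by apply/measurable_EFinP; exact: measurable_int iy.
have mlim : measurable_fun D phi by exact: measurable_fun_cvg mphi cphi.
have [|||||ilim _ H] := @dominated_convergence _ _ _ mu D mD
  (fun n => EFin \o (fun x => y x * phi_ n x)) (EFin \o (fun x => y x * phi x))
  (EFin \o (fun x => `|y x| * M)).
- by move=> n; apply/measurable_EFinP; exact: measurable_funM.
- by apply/measurable_EFinP; exact: measurable_funM.
- apply: aeW => x Dx; apply: cvg_EFin; first exact: nearW.
  by apply: cvgM; [exact: cvg_cst|exact: cphi].
- have -> : EFin \o (fun x => `|y x| * M) = (fun x => M%:E * (abse \o (EFin \o y)) x)%E.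
    by apply/funext => x /=; rewrite EFinM muleC.
  by apply: integrableZl => //; exact: integrable_abse.
- apply: aeW => x n Dx /=; rewrite lee_fin normrM ler_wpM2l//; exact: bphi.
rewrite /Rintegral; apply: fine_cvg.
by rewrite fineK//; exact: integrable_fin_num.
Qed.

End vanishing_moments.

(** * Even moments determine an integrable function *)

Section even_moments.
Context {R : realType} (mu : {measure set (measurableTypeR R) -> \bar R}).
Let D : set (measurableTypeR R) := `]0, 1[%classic.
Context (y : R -> R).
Hypothesis iy : mu.-integrable D (EFin \o y).

Let mD : measurable D.
Proof. exact: measurable_itv. Qed.

Lemma measurable_even_sum (c : nat -> R) n (E : set (measurableTypeR R)) :
  measurable_fun E (fun x : R => \sum_(k < n) c k * x ^+ (2 * k)).
Proof.
elim: n => [|n IH].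
  by under eq_fun do rewrite big_ord0; exact: measurable_cst.
under eq_fun do rewrite big_ord_recr /=.
apply: measurable_funD => //; apply: measurable_funM; first exact: measurable_cst.
exact: measurable_funX.
Qed.

Lemma even_sum_bounded (c : nat -> R) n x : D x ->
  `|\sum_(k < n) c k * x ^+ (2 * k)| <= \sum_(k < n) `|c k|.
Proof.
rewrite /D /= in_itv /= => /andP[x0 x1].
apply: (le_trans (ler_norm_sum _ _ _)); apply: ler_sum => k _.
rewrite normrM ler_piMr// normrX exprn_ile1//.
by rewrite ger0_norm; exact: ltW.
Qed.

Lemma integrable_mul_even_sum (c : nat -> R) n :
  mu.-integrable D (EFin \o (fun x => y x * \sum_(k < n) c k * x ^+ (2 * k))).
Proof.
apply: (@integrable_mul_bounded _ _ _ _ _ mD _ iy _ (\sum_(k < n) `|c k|)).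
  exact: measurable_even_sum.
exact: even_sum_bounded.
Qed.

Lemma integrable_mul_even_power n :
  mu.-integrable D (EFin \o (fun x => y x * x ^+ (2 * n))).
Proof.
apply: (@integrable_mul_bounded _ _ _ _ _ mD _ iy _ 1).
  exact: measurable_funX.
move=> x; rewrite /D /= in_itv /= => /andP[x0 x1].
by rewrite normrX exprn_ile1// ger0_norm; exact: ltW.
Qed.

Lemma Rintegral_mul_even_sum (c : nat -> R) n :
  \int[mu]_(x in D) (y x * \sum_(k < n) c k * x ^+ (2 * k)) =
  \sum_(k < n) c k * \int[mu]_(x in D) (y x * x ^+ (2 * k)).
Proof.
elim: n => [|n IH].
  under eq_Rintegral do rewrite big_ord0 mulr0.
  by rewrite big_ord0 Rintegral_cst// mul0r.
under eq_Rintegral do rewrite big_ord_recr /= mulrDr mulrCA.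
rewrite big_ord_recr /= RintegralD//.
- by rewrite IH RintegralZl//; exact: integrable_mul_even_power.
- exact: integrable_mul_even_sum.
have -> : EFin \o (fun x => c n * (y x * x ^+ (2 * n))) =
    (fun x => (c n)%:E * (EFin \o (fun x => (y x * x ^+ (2 * n))%R)) x)%E.
  by apply/funext => x /=; rewrite EFinM.
by apply: integrableZl => //; exact: integrable_mul_even_power.
Qed.

Hypothesis moments0 :
  forall n, \int[mu]_(x in D) (y x * x ^+ (2 * n)) = 0.

Lemma Rintegral_mul_poly0 (p : {poly R}) :
  \int[mu]_(x in D) (y x * p.[x ^+ 2]) = 0.
Proof.
have pE (x : R) : p.[x ^+ 2] = \sum_(k < size p) p`_k * x ^+ (2 * k).
  by rewrite horner_coef; apply: eq_bigr => k _; rewrite exprM.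
under eq_Rintegral do rewrite pE.
rewrite Rintegral_mul_even_sum big1// => k _.
by rewrite moments0 mulr0.
Qed.

(* With q(t) = al t + be chosen so that 0 <= q <= 1 on [0, 1] and
   q(c^2) = 1/2, the polynomials (1 - q^n)^(n 2^n) tend boundedly to the
   indicator of t < c^2. *)
Lemma Rintegral_lt0 (c : R) : 0 < c -> c < 1 ->
  \int[mu]_(x in D) (y x * (x < c)%R%:R) = 0.
Proof.
move=> c0 c1.
have [al [be [al0 [be0 ab1 abc]]]] : exists al be : R, 0 < al /\
    [/\ 0 <= be, al + be <= 1 & al * c ^+ 2 + be = 1 / 2].
  have c2 : 0 < c ^+ 2 by rewrite exprn_gt0.
  have c21 : c ^+ 2 < 1 by rewrite exprn_ilt1// ltW.
  (* The line through (c^2, 1/2) also passes through (1, 1) if c^2 <= 1/2, and through (0, 0)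
     otherwise. *)
  have [h|h] := leP (c ^+ 2) (1 / 2).
    exists (1 / (2 - 2 * c ^+ 2)), ((1 - 2 * c ^+ 2) / (2 - 2 * c ^+ 2)).
    have dn : 0 < 2 - 2 * c ^+ 2 by lra.
    split; first by rewrite divr_gt0.
    split.
    - by rewrite divr_ge0 ?(ltW dn)//; lra.
    - by rewrite -mulrDl ler_pdivrMr// mul1r; lra.
    - by field; rewrite gt_eqF.
  exists (1 / (2 * c ^+ 2)), 0; split; first by rewrite divr_gt0// mulr_gt0.
  split => //; first by rewrite addr0 ler_pdivrMr ?mulr_gt0//; lra.
  by field; rewrite gt_eqF.
pose q (x : R) := al * x ^+ 2 + be.
pose p n : {poly R} := (1 - (al *: 'X + be%:P) ^+ n) ^+ (n * 2 ^ n).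
have pE n x : (p n).[x ^+ 2] = (1 - q x ^+ n) ^+ (n * 2 ^ n).
  by rewrite /p !(horner_exp, hornerD, hornerN, hornerZ, hornerX, hornerC).
have q01 x : D x -> 0 <= q x /\ q x <= 1.
  rewrite /D /= in_itv /= => /andP[x0 x1].
  have x2 : 0 <= x ^+ 2 by exact: sqr_ge0.
  have x21 : x ^+ 2 <= 1 by rewrite exprn_ile1// ltW.
  have := ler_wpM2l (ltW al0) x2; have := ler_wpM2l (ltW al0) x21.
  by rewrite /q; split; lra.
have mq : measurable_fun D q.
  apply: measurable_funD; last exact: measurable_cst.
  by apply: measurable_funM; [exact: measurable_cst|exact: measurable_funX].
have lim := @cvg_Rintegral_bounded _ _ _ _ _ mD _ iy
  (fun n x => (p n).[x ^+ 2]) (fun x => (x < c)%R%:R) 1 _ _ _.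
have : (fun n => \int[mu]_(x in D) (y x * (p n).[x ^+ 2])) @ \oo -->
    \int[mu]_(x in D) (y x * (x < c)%R%:R).
  apply: lim.
  - move=> n; under eq_fun do rewrite pE.
    apply: measurable_funX; apply: measurable_funB; first exact: measurable_cst.
    exact: measurable_funX.
  - move=> n x /q01[qx0 qx1]; rewrite pE.
    have h0 : 0 <= q x ^+ n by rewrite exprn_ge0.
    have h1 : q x ^+ n <= 1 by rewrite exprn_ile1.
    by rewrite ger0_norm ?exprn_ge0 ?exprn_ile1//; lra.
  - move=> x Dx; have [qx0 qx1] := q01 x Dx.
    under eq_fun do rewrite pE.
    move: Dx; rewrite /D /= in_itv /= => /andP[x0 x1].
    have [xc|xc] := ltP x c.
      apply: step_approx_lt => //; rewrite -abc /q ltrD2r ltr_pM2l//.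
      by rewrite ltr_pXn2r ?nnegrE ?(ltW x0) ?(ltW c0).
    apply: step_approx_ge => //; rewrite -abc /q lerD2r ler_pM2l//.
    by apply: lerXn2r; rewrite ?nnegrE// ltW.
under eq_fun do rewrite Rintegral_mul_poly0.
move=> /cvg_lim <-//; exact: lim_cst.
Qed.

(** The sets E over which y has integral 0 on D form a Dynkin system, complements being covered by
    the moment of order 0. It contains the half lines ]-oo, c[, a generating class stable under
    intersection. *)
Lemma even_moments_eq0 : {ae mu, forall x, D x -> y x = 0}.
Proof.
have mfy : measurable_fun D (EFin \o y) by exact: measurable_int iy.
have ifin (E : set (measurableTypeR R)) : measurable E ->
    mu.-integrable (D `&` E) (EFin \o y).
  move=> mE; apply: (integrableS mD) iy; first exact: measurableI.
  exact: subIsetl.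
have all0 : (\int[mu]_(x in D) (y x)%:E = 0)%E.
  have := moments0 0; rewrite /Rintegral.
  under eq_integral do rewrite muln0 expr0 mulr1.
  move=> h; rewrite -[LHS]fineK ?h//; exact: integrable_fin_num.
have key (E : set (measurableTypeR R)) : measurable E ->
    (\int[mu]_(x in D `&` E) (y x)%:E = 0)%E.
  move=> mE; have : <<s @RGenInftyO.G R >> E.
    have := mE; rewrite [X in X E](_ : _ = <<s @RGenInftyO.G R >>)//.
    exact: RGenInftyO.measurableE.
  apply: (@dynkin_induction _ (measurableTypeR R) (@RGenInftyO.G R)
    (fun E => (\int[mu]_(x in D `&` E) (y x)%:E = 0)%E)).
  - exact: RGenInftyO.measurableE.
  - move=> _ _ [a ->] [b ->]; exists (Num.min a b).
    by apply/seteqP; split => x /=; rewrite !in_itv /= lt_min => /andP.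
  - by rewrite setIT.
  - move=> _ [c ->].
    have [c0|c0] := leP c 0.
      rewrite (_ : _ `&` _ = set0) ?integral_set0//.
      apply/seteqP; split => x //=; rewrite !in_itv /= => -[/andP[x0 _] xc].
      by have := lt_trans x0 xc; rewrite ltNge c0.
    have [c1|c1] := leP 1 c.
      rewrite (_ : _ `&` _ = D)//; apply/setIidl => x /=.
      by rewrite !in_itv /= => /andP[_ /lt_le_trans]; apply.
    have := Rintegral_lt0 c0 c1; rewrite /Rintegral integral_mkcondr => h.
    rewrite (_ : (\int[mu]_(x in D) _)%E =
        (\int[mu]_(x in D) (y x * (x < c)%R%:R)%:E)%E).
      rewrite -[LHS]fineK ?h//; apply: integrable_fin_num => //.
      apply: (@integrable_mul_bounded _ _ _ _ _ mD _ iy _ 1).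
        have -> : (fun x : R => (x < c)%R%:R : R) = \1_(`]-oo, c[%classic).
          by apply/funext => x; rewrite indicE mem_setE.
        exact: measurable_indic.
      by move=> x _; case: (x < c); rewrite ?normr1// normr0.
    apply: eq_integral => x _; rewrite /patch mem_setE in_itv /=.
    by case: ifP; rewrite ?mulr1 ?mulr0.
  - move=> S mS S0; have := all0.
    rewrite -{1}(setIT D) -(setUv S) setIUr integral_setU ?S0 ?add0e//.
    + exact: measurableI.
    + by apply: measurableI => //; exact: measurableC.
    + by rewrite -setIUr setUv setIT.
    + by apply/disj_setPS => x [[_ ?] [_]].
  - move=> F mF tF F0; rewrite setI_bigcupr integral_bigcup//.
    + by apply: eseries0 => i _ _; exact: F0.
    + exact: trivIset_setIl.
    + by move=> k; exact: measurableI.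
    + by rewrite -setI_bigcupr; apply: ifin; exact: bigcupT_measurable.
have := @integral_ae_eq _ _ _ mu D mD (cst 0%E) (EFin \o y) iy
  (measurable_cst _) _.
move=> /(_ _)/filterS; apply; first by move=> x /= h /h[].
move=> E ED mE; rewrite integral0.
by rewrite -(key E mE) setIidr.
Qed.

End even_moments.

(** * Completeness *)

Section completeness.
Context {R : realType} (mu : {measure set (measurableTypeR R) -> \bar R}).
Let D : set (measurableTypeR R) := `]0, 1[%classic.
Implicit Types (a b : nat -> R) (f g : R[i] -> R[i]).

Lemma psum_alt_real a (r : R) n :
  psum (alt_coef a) r%:C n = (\sum_(k < n) (-1) ^+ k * a k * r ^+ k)%:C.
Proof.
rewrite rmorph_sum; apply: eq_bigr => k _.
by rewrite /alt_coef !rmorphM !rmorphXn rmorphN1.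
Qed.

Lemma alternating_even_series_real a f (r : R) : alternating_even_series a f ->
  complex.Im (f r%:C) = 0.
Proof.
move=> fs; apply/eqP; rewrite -normr_eq0 eq_le normr_ge0 andbT.
apply/ler_addgt0Pl => e e0; rewrite addr0.
have [N hN] := alternating_even_series_cvg r%:C fs e0.
apply: le_trans (hN N (leqnn N)); apply: le_trans (Im_le_modulus _).
by rewrite -rmorphXn psum_alt_real ImD ImN /= subr0.
Qed.

(** The absolute values are the terms of the series in w at -t^2; the bound provides the constant
    for dominated convergence. *)
Lemma alternating_even_sum_bounded a f (t : R) : alternating_even_series a f ->
  (forall n, 0 <= a n) -> exists M : R, forall n,
    \sum_(k < n) `|(-1) ^+ k * a k * t ^+ (2 * k)| <= M.
Proof.
move=> fs a0; have t2 : 0 <= t ^+ 2 by exact: sqr_ge0.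
have [B B0 hB] := @has_radius_alt _ a f (t ^+ 2 + 2) fs (t ^+ 2 + 1)
  ltac:(lra) ltac:(lra).
exists (B / (1 - t ^+ 2 / (t ^+ 2 + 1))) => n.
have mt : modulus (- t ^+ 2)%:C = t ^+ 2 by rewrite modulus_real normrN ger0_norm.
have := @psum_diff_le _ _ (- t ^+ 2)%:C _ _ 0 n hB.
rewrite mt psum0 subr0 add0n expr0 mulr1 psum_alt_neg modulus_real => H.
apply: le_trans (H ltac:(lra)).
rewrite ger0_norm; last by rewrite sumr_ge0// => k _; rewrite mulr_ge0// exprn_ge0.
apply: ler_sum => k _.
rewrite !normrM normrX normrN1 expr1n mul1r (ger0_norm (a0 _)) exprM.
by rewrite (ger0_norm (exprn_ge0 _ t2)).
Qed.

Context (y : R -> R).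
Hypothesis iy : mu.-integrable D (EFin \o y).

Let mD : measurable D.
Proof. exact: measurable_itv. Qed.

Definition even_moment (n : nat) : R := \int[mu]_(x in D) (y x * x ^+ (2 * n)).

Lemma even_moment_le n : `|even_moment n| <= \int[mu]_(x in D) `|y x|.
Proof.
have ip := integrable_mul_even_power iy n.
apply: le_trans (le_normr_Rintegral mD ip) _.
apply: le_Rintegral => //.
- exact: (integrable_abse ip).
- exact: (integrable_abse iy).
move=> x; rewrite /D /= in_itv /= => /andP[x0 x1].
by rewrite normrM ler_piMr// normrX exprn_ile1// ger0_norm// ltW.
Qed.

(** Termwise integration: at w = t^2 the moment series is the integral of y(x) f(t x), so
    annihilating f(lambda_n x) means vanishing at lambda_n^2. *)
Lemma pseries_cvg_integral a f (t : R) : alternating_even_series a f ->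
  (forall n, 0 <= a n) ->
  pseries_cvg (alt_coef (fun n => a n * even_moment n)) (t ^+ 2)%:C
    (\int[mu]_(x in D) (y x * complex.Re (f (t * x)%:C)))%:C.
Proof.
move=> fs a0; have [M hM] := alternating_even_sum_bounded t fs a0.
pose c k := (-1) ^+ k * a k * t ^+ (2 * k).
have lim : (fun n => \int[mu]_(x in D) (y x * \sum_(k < n) c k * x ^+ (2 * k)))
    @ \oo --> \int[mu]_(x in D) (y x * complex.Re (f (t * x)%:C)).
  apply: (@cvg_Rintegral_bounded _ _ _ _ _ mD _ iy _ _ M).
  - by move=> n; exact: measurable_even_sum.
  - by move=> n x Dx; apply: le_trans (hM n); exact: even_sum_bounded.
  move=> x _; apply/cvgrPdist_le => e e0.
  have [N hN] := alternating_even_series_cvg (t * x)%:C fs e0.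
  exists N => // n /= /hN; apply: le_trans; apply: le_trans (Re_le_modulus _).
  rewrite -rmorphXn psum_alt_real ReD ReN /=.
  rewrite [X in _ - X](_ : _ = \sum_(k < n) (-1) ^+ k * a k * (t * x) ^+ 2 ^+ k)//.
  apply: eq_bigr => k _; rewrite /c -exprM exprMn; ring.
move=> e e0; move/cvgrPdist_le : lim => /(_ _ e0)[N _ hN].
exists N => n /hN /=; rewrite psum_alt_real -rmorphB modulus_real.
rewrite Rintegral_mul_even_sum//.
rewrite [X in `|_ - X| <= _ -> _](_ : _ =
  \sum_(k < n) (-1) ^+ k * (a k * even_moment k) * t ^+ 2 ^+ k)//.
by apply: eq_bigr => k _; rewrite /c /even_moment exprM; ring.
Qed.

Lemma real_completeness a b f g (lam : nat -> R) :
  (forall n, 0 <= a n) -> (forall n, 0 <= b n) ->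
  alternating_even_series a f -> alternating_even_series b g ->
  real_zeros f -> real_zeros g -> simple_zeros f -> simple_zeros g ->
  countably_infinite_zeros f -> countably_infinite_zeros g ->
  enum_positive_zeros g lam ->
  (growth_order f < 1)%E -> (growth_order g < 1)%E ->
  (fun n => a n / b n) @ \oo --> (0 : R) ->
  (forall n, \int[mu]_(x in D) (y x * complex.Re (f (lam n * x)%:C)) = 0) ->
  {ae mu, forall x, D x -> y x = 0}.
Proof.
move=> a0 b0 fs gs fr gr fsi gsi finf ginf [_ lamP] ford gord ab yf.
have ap n : 0 < a n by exact: (alternating_coef_gt0 n fs).
have bp n : 0 < b n by exact: (alternating_coef_gt0 n gs).
have gc0 := simple_zeros_coef0 gs gsi.
have gpz := real_zeros_positive gs gr gc0.
have ha rho : has_radius (alt_coef a) rho by exact: has_radius_alt fs.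
have hb rho : has_radius (alt_coef b) rho by exact: has_radius_alt gs.
pose C := \int[mu]_(x in D) `|y x|.
have C0 : 0 <= C by exact: le_trans (normr_ge0 _) (even_moment_le 0).
pose h := alt_coef (fun n => a n * even_moment n).
have hC n : modulus (h n) <= C * a n.
  rewrite modulus_alt_coef normrM ger0_norm// mulrC ler_wpM2r//.
  exact: even_moment_le.
have hh rho : has_radius h rho.
  move=> r r0 r1; have [B B0 hB] := ha rho r r0 r1.
  exists (C * B) => [|n]; first exact: mulr_ge0.
  apply: le_trans (_ : C * a n * r ^+ n <= _).
    by rewrite ler_wpM2r ?exprn_ge0// ltW.
  by rewrite -mulrA ler_wpM2l//; have := hB n; rewrite modulus_alt_coef ger0_norm.
have [K K0 hK] : exists2 K, 0 <= K & forall n, a n <= K * b n.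
  move/cvgrPdist_le : (ab) => /(_ _ ltr01)[N _ hN].
  have q0 k : 0 <= a k / b k by rewrite divr_ge0.
  exists (1 + \sum_(k < N) a k / b k); first by rewrite addr_ge0// sumr_ge0.
  move=> n; rewrite -ler_pdivrMr//; have [nN|nN] := ltnP n N.
    by rewrite (bigD1 (Ordinal nN))//= addrCA lerDl addr_ge0// sumr_ge0.
  have := hN n nN; rewrite sub0r normrN ger0_norm// => /le_trans; apply.
  by rewrite lerDl sumr_ge0.
have hz z : pseries_sum (alt_coef b) z = 0 -> pseries_sum h z = 0.
  move=> bz; have [x x0 zx] := gpz z bz.
  have x2 : z = (Num.sqrt x ^+ 2)%:C by rewrite sqr_sqrtr// ltW.
  have : [set x : R | 0 < x /\ zeros g x%:C] (Num.sqrt x).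
    split; first by rewrite sqrtr_gt0.
    have e : (Num.sqrt x)%:C ^+ 2 = z by rewrite x2 rmorphXn.
    by rewrite /zeros /= (alternating_even_seriesE _ gs) e.
  rewrite -lamP => -[n _ lamn].
  rewrite x2 -lamn; apply: pseries_cvgE.
  by have := pseries_cvg_integral (lam n) fs a0; rewrite yf.
have hbd w : modulus (pseries_sum h w) <=
    C * K * modulus (pseries_sum (alt_coef b) (- modulus w)%:C).
  apply: pseries_sum_le_neg => // [|n]; first exact: mulr_ge0.
  by apply: (le_trans (hC n)); rewrite -mulrA ler_wpM2l.
have h0 := phragmen_lindelof hb gc0 gpz
  (fun z => @simple_zeros_no_double _ b g z gs gpz gsi)
  (growth_order_minimal_type gs b0 gc0 gord) hh hz hbd
  (fun kappa k0 => pseries_sum_negligible C0 k0 hh hb bp hC ab).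
apply: even_moments_eq0 iy _ => n.
have := pseries_sum_eq0 ltr01 (hh 1) (fun w _ => h0 w) n.
move=> /eqP; rewrite -modulus_eq0 modulus_alt_coef normr_eq0 mulf_eq0.
by rewrite gt_eqF//= => /eqP.
Qed.

End completeness.

Theorem theorem1 (R : realType)
    (mu : {measure set (measurableTypeR R) -> \bar R})
    (a b : nat -> R) (f g : R[i] -> R[i]) (lam : nat -> R)
    (a_ge0 : forall n, 0 <= a n) (b_ge0 : forall n, 0 <= b n)
    (f_series : alternating_even_series a f)
    (g_series : alternating_even_series b g)
    (f_entire : entire f) (g_entire : entire g)
    (f_real : real_zeros f) (g_real : real_zeros g)
    (f_simple : simple_zeros f) (g_simple : simple_zeros g)
    (f_infinite : countably_infinite_zeros f)
    (g_infinite : countably_infinite_zeros g)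
    (lamP : enum_positive_zeros g lam)
    (f_order : (growth_order f < 1)%E) (g_order : (growth_order g < 1)%E)
    (ab_cvg0 : (fun n => a n / b n) @ \oo --> (0 : R)) :
  complete_L1 mu `]0, 1[ (fun (n : nat) (x : R) => f (lam n * x)%:C).
Proof.
move=> y [iRe iIm] yF.
(* f is real on the real axis, so the real and imaginary parts of y satisfy the annihilation
   conditions separately. *)
have aeRe : {ae mu, forall x, `]0, 1[%classic x -> complex.Re (y x) = 0}.
  apply: (real_completeness iRe a_ge0 b_ge0 f_series g_series f_real g_real
    f_simple g_simple f_infinite g_infinite lamP f_order g_order ab_cvg0) => n.
  have := congr1 (@complex.Re R) (yF n); rewrite /cintegral /=.
  under eq_Rintegral => x _.
    rewrite (_ : complex.Re _ = complex.Re (y x) * complex.Re (f (lam n * x)%:C)).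
      over.
    have := alternating_even_series_real (lam n * x) f_series.
    by case: (y x) (f _) => p q [p' q'] /= ->; rewrite mulr0 subr0.
  by [].
have aeIm : {ae mu, forall x, `]0, 1[%classic x -> complex.Im (y x) = 0}.
  apply: (real_completeness iIm a_ge0 b_ge0 f_series g_series f_real g_real
    f_simple g_simple f_infinite g_infinite lamP f_order g_order ab_cvg0) => n.
  have := congr1 (@complex.Im R) (yF n); rewrite /cintegral /=.
  under eq_Rintegral => x _.
    rewrite (_ : complex.Im _ = complex.Im (y x) * complex.Re (f (lam n * x)%:C)).
      over.
    have := alternating_even_series_real (lam n * x) f_series.
    by case: (y x) (f _) => p q [p' q'] /= ->; rewrite mulr0 add0r.
  by [].
apply: (@filterS2 _ _ (ae_filter_ringOfSetsType mu)) aeRe aeIm => x hRe hIm Dx.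
by apply/eqP; rewrite eq_complex hRe// hIm//= eqxx.
Qed.
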